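(* Let $\omega$ be a non-quasianalytic concave weight function. Let $\sigma$ be a weight function satisfying $\sigma(t)=o(t)$ as $t\to\infty$ and $$\forall x>0\ \exists y>0\ \exists C\ge 1\ \forall 1\le j\le k:\quad \frac{S^x_j}{j\,S^x_{j-1}}\le C\,\frac{S^y_k}{k\,S^y_{k-1}},$$ where $\{S^x\}_{x>0}$ is the weight matrix associated with $\sigma$. Then the following are equivalent: (1) For every compact $E\subseteq\mathbb{R}^n$ the jet mapping $j^\infty_E:\mathcal{B}^{\{\omega\}}(\mathbb{R}^n)\to\mathcal{B}^{\{\sigma\}}(E)$ is surjective. (2) There is $C>0$ such that $\int_1^\infty \frac{\omega(tu)}{u^2}\,du\le C\sigma(t)+C$ for all $t>0$.
   Context: A weight function is a continuous increasing $\omega:[0,\infty)\to[0,\infty)$ with $\omega(0)=0$, $\omega(t)\to\infty$, $\omega(2t)=O(\omega(t))$, $\omega(t)=O(t)$, $\log t=o(\omega(t))$ as $t\to\infty$, and $\varphi(t):=\omega(e^t)$ convex. It is non-quasianalytic if $\int_0^\infty\frac{\omega(t)}{1+t^2}dt<\infty$. Up to equivalence (changing $\omega$ only on a bounded set) one assumes $\omega|_{[0,1]}=0$; the Young conjugate is $\varphi^*(t)=\sup_{s\ge0}(st-\varphi(s))$. The weight matrix associated with $\omega$ is $\{W^x\}_{x>0}$, $W^x_k:=\exp(\frac1x\varphi^*(xk))$, $k\in\mathbb{N}$. For a weight function $\omega$, $\mathcal{B}^{\{\omega\}}(\mathbb{R}^n)$ is the union over $\rho\in\mathbb{N}$ of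 the spaces of $f\in C^\infty(\mathbb{R}^n)$ with $\sup_{x\in\mathbb{R}^n,\alpha\in\mathbb{N}^n}|\partial^\alpha f(x)|\exp(-\frac1\rho\varphi^*(\rho|\alpha|))<\infty$. For a compact $E\subseteq\mathbb{R}^n$, a jet is $F=(F^\alpha)_{\alpha\in\mathbb{N}^n}$ with $F^\alpha\in C^0(E)$; for $a,x\in E$, $p\in\mathbb{N}$, $|\alpha|\le p$ put $(R^p_aF)^\alpha(x)=F^\alpha(x)-\sum_{|\beta|\le p-|\alpha|}\frac{(x-a)^\beta}{\beta!}F^{\alpha+\beta}(a)$. For a positive sequence $M=(M_k)$, $\mathcal{B}^{\{M\}}(E)$ is the set of jets $F$ for which there exist $C,\rho>0$ with $|F^\alpha(a)|\le C\rho^{|\alpha|}M_{|\alpha|}$ and $|(R^p_aF)^\alpha(b)|\le C\rho^{p+1}M_{p+1}\frac{|b-a|^{p+1-|\alpha|}}{(p+1-|\alpha|)!}$ for all $\alpha$, $p\ge|\alpha|$, $a,b\in E$. For a weight function $\sigma$ with weight matrix $\{S^x\}$, $\mathcal{B}^{\{\sigma\}}(E):=\bigcup_{x>0}\mathcal{B}^{\{S^x\}}(E)$. The jet map is $j^\infty_E(f)=(\partial^\alpha f|_E)_\alpha$. *)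

(* Defs.v *)
From Stdlib Require Import Reals ClassicalEpsilon.
From mathcomp Require Import all_boot.
Set Implicit Arguments.
Unset Strict Implicit.
Unset Printing Implicit Defensive.

Local Open Scope R_scope.

Definition Rsup (E : R -> Prop) : R :=
  match excluded_middle_informative (bound E /\ exists x, E x) with
  | left H => proj1_sig (completeness E (proj1 H) (proj2 H))
  | right _ => 0
  end.

(** Young conjugate of phi(s) = om(e^s):  phi^*(t) = sup_{s>=0} (s t - phi s). *)
Definition young_conj (om : R -> R) (t : R) : R :=
  Rsup (fun y => exists s, 0 <= s /\ y = s * t - om (exp s)).

Definition wmat (om : R -> R) (x : R) (k : nat) : R :=
  exp (/ x * young_conj om (x * INR k)).

Definition is_weight_function (om : R -> R) : Prop :=
  (forall t, 0 <= t -> forall eps, 0 < eps -> exists delta, 0 < delta /\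
      forall s, 0 <= s -> Rabs (s - t) < delta -> Rabs (om s - om t) < eps) /\
  (forall s t, 0 <= s -> s <= t -> om s <= om t) /\
  (forall t, 0 <= t -> 0 <= om t) /\
  om 0 = 0 /\
  (forall M, exists T, forall t, T <= t -> M <= om t) /\
  (exists C T, forall t, T <= t -> om (2 * t) <= C * om t) /\
  (exists C T, forall t, T <= t -> om t <= C * t) /\
  (forall eps, 0 < eps -> exists T, forall t, T <= t -> ln t <= eps * om t) /\
  (forall s1 s2 l, 0 <= l <= 1 ->
      om (exp (l * s1 + (1 - l) * s2)) <= l * om (exp s1) + (1 - l) * om (exp s2)).

Definition non_quasianalytic (om : R -> R) : Prop :=
  exists M, forall T, 0 <= T ->
    exists pr : Riemann_integrable (fun t => om t / (1 + t ^ 2)) 0 T,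
      RiemannInt pr <= M.

Definition concave_on_nonneg (om : R -> R) : Prop :=
  forall s t l, 0 <= s -> 0 <= t -> 0 <= l <= 1 ->
    l * om s + (1 - l) * om t <= om (l * s + (1 - l) * t).

Definition little_o_t (sg : R -> R) : Prop :=
  forall eps, 0 < eps -> exists T, forall t, T <= t -> sg t <= eps * t.

(** The improper integral int_1^oo g(u) du exists (nonneg. integrand) and is <= M. *)
Definition improper_int_1_le (g : R -> R) (M : R) : Prop :=
  forall T, 1 <= T -> exists pr : Riemann_integrable g 1 T, RiemannInt pr <= M.

Notation pt n := ('I_n -> R).
Notation mi n := {ffun 'I_n -> nat}.

Definition mabs n (a : mi n) : nat := (\sum_(i < n) a i)%N.
Definition mzero n : mi n := [ffun _ => 0%N].
Definition mincr n (a : mi n) (i : 'I_n) : mi n :=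
  [ffun j => if j == i then (a j).+1 else a j].
Definition madd n (a b : mi n) : mi n := [ffun j => (a j + b j)%N].
Definition upd n (x : pt n) (i : 'I_n) (h : R) : pt n :=
  fun j => if j == i then x j + h else x j.
Definition origin n : pt n := fun _ => 0.

Definition dist n (x y : pt n) : R :=
  sqrt (\big[Rplus/0]_(i < n) Rsqr (x i - y i)).

Definition cont_at n (g : pt n -> R) (x : pt n) : Prop :=
  forall eps, 0 < eps -> exists delta, 0 < delta /\
    forall y, dist y x < delta -> Rabs (g y - g x) < eps.

Definition smooth_with_derivs n (f : pt n -> R) (D : mi n -> pt n -> R) : Prop :=
  (forall x, D (@mzero n) x = f x) /\
  (forall a x, cont_at (D a) x) /\
  (forall a i x, derivable_pt_lim (fun h => D a (upd x i h)) 0 (D (mincr a i) x)).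

Definition B_omega_bound n (om : R -> R) (D : mi n -> pt n -> R) : Prop :=
  exists rho : nat, (1 <= rho)%N /\ exists C,
    forall x a, Rabs (D a x) * exp (- (/ INR rho) * young_conj om (INR rho * INR (mabs a))) <= C.

Definition compact_Rn n (E : pt n -> Prop) : Prop :=
  (exists B, forall x, E x -> dist x (@origin n) <= B) /\
  (forall x, (forall eps, 0 < eps -> exists y, E y /\ dist x y < eps) -> E x).

Definition mpow n (v : pt n) (b : mi n) : R := \big[Rmult/1]_(i < n) (v i ^ b i).
Definition mfact n (b : mi n) : R := \big[Rmult/1]_(i < n) INR (factorial (b i)).
Definition bnat n m (b : {ffun 'I_n -> 'I_m}) : mi n := [ffun i => nat_of_ord (b i)].

Definition taylor_rem n (F : mi n -> pt n -> R) (p : nat) (a : pt n) (al : mi n) (x : pt n) : R :=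
  let m := (p - mabs al)%N in
  F al x - \big[Rplus/0]_(b : {ffun 'I_n -> 'I_m.+1} | (mabs (bnat b) <= m)%N)
             (mpow (fun i => x i - a i) (bnat b) / mfact (bnat b) * F (madd al (bnat b)) a).

Definition in_B_seq_E n (M : nat -> R) (E : pt n -> Prop) (F : mi n -> pt n -> R) : Prop :=
  (forall al a, E a -> forall eps, 0 < eps -> exists delta, 0 < delta /\
      forall b, E b -> dist b a < delta -> Rabs (F al b - F al a) < eps) /\
  exists C rho, 0 < C /\ 0 < rho /\
    (forall al a, E a -> Rabs (F al a) <= C * rho ^ mabs al * M (mabs al)) /\
    (forall al (p : nat) a b, (mabs al <= p)%N -> E a -> E b ->
       Rabs (taylor_rem F p a al b) <=
         C * rho ^ (p.+1) * M (p.+1) * dist b a ^ (p.+1 - mabs al)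
           / INR (factorial (p.+1 - mabs al))).

Definition in_B_sigma_E n (sg : R -> R) (E : pt n -> Prop) (F : mi n -> pt n -> R) : Prop :=
  exists x, 0 < x /\ in_B_seq_E (wmat sg x) E F.

Definition jet_surjective n (om sg : R -> R) (E : pt n -> Prop) : Prop :=
  forall F, in_B_sigma_E sg E F ->
    exists f D, smooth_with_derivs f D /\ B_omega_bound om D /\
      forall al a, E a -> D al a = F al a.

(* Main.v *)
(** For jets at the origin, one extension of a lacunary jet yields constants [C], [rho]
    and, for all [p] and [N], functions with derivatives bounded by [C W^rho_k], [p]-th
    derivative [S^1_p] at [0], and vanishing derivatives of orders [p+1, ..., N].  By Bang's
    argument the [p]-th derivative stays above [S^1_p / 2] on an interval of length about
    [sum_(k > p) W^rho_(k-1) / W^rho_k]; a finite difference of order [p] then bounds this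
    tail by a multiple of [p / t] for [p] about [sg t], and the tail controls (2).

    Conversely, let [K_m = sum_(l >= m) om (2^l) / 2^l], so that [2^m K_m] is at most a multiple
    of [sg (2^m) + 1].  At a scale [delta] about [A K_m], infinite convolutions of indicators
    give partitions of unity at the cost of a factor [exp (eta om (2^m))], with [eta]
    arbitrarily small, while Taylor polynomials of degree [q - 1], where [S^x_q] is about
    [2^(m q) exp (- sg (2^m) / x)], differ by at most [exp (- sg (2^m) / (2 x))] at neighbouring
    points of [E].  The extension is a telescoping series over the scales in which the degree
    is raised before the cutoffs are refined. *)
From HB Require Import structures.
From Stdlib Require Import ZArith Reals Lra Classical ClassicalEpsilon FunctionalExtensionality.
From Coquelicot Require Import Coquelicot.
From mathcomp Require Import all_boot zify.
Require Import Defs.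
Set Implicit Arguments.
Unset Strict Implicit.
Unset Printing Implicit Defensive.
Local Open Scope R_scope.

(** * Finite sums and elementary calculus *)

(** Consecutive scales satisfy [delta i.+1 = delta i / 4], but the tails [K m] may decay so slowly
    that the level [m i.+1] lies far beyond [m i], and then nothing bounds [sg (2 ^ m i.+1)] in
    terms of [sg (2 ^ m i)]. Refining the cutoffs at the old degree would cost a factor governed by
    the level [m i.+1] against a gain governed by [m i]. With the degree raised first, each move is
    paid for at a single level: raising costs and gains at [m i], refining at [m i.+1]. Raising at
    the coarse scale is admissible because [2 ^ l * delta i] stays below a multiple of
    [sg (2 ^ l) + 1] for all [l] up to [m i.+1], and every intermediate degree suits one of the
    levels in between. In the other direction [p] is tied to [t] by [t ^ p <= S^1_p exp (sg t)]: for
    [p] above [sg t] the number [S^1_p] is at least [(t / e) ^ p], so a derivative of order [p] that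
    exceeds half of it on an interval much longer than [p / t] contradicts the bound on the function
    itself. *)

Fact RplusA : associative Rplus. Proof. by move=> x y z; ring. Qed.
Fact RmultA : associative Rmult. Proof. by move=> x y z; ring. Qed.
HB.instance Definition _ := Monoid.isComLaw.Build R 0 Rplus RplusA Rplus_comm Rplus_0_l.
HB.instance Definition _ := Monoid.isComLaw.Build R 1 Rmult RmultA Rmult_comm Rmult_1_l.
HB.instance Definition _ := Monoid.isMulLaw.Build R 0 Rmult Rmult_0_l Rmult_0_r.
HB.instance Definition _ :=
  Monoid.isAddLaw.Build R Rmult Rplus Rmult_plus_distr_r Rmult_plus_distr_l.

Lemma rsum_le (I : Type) (r : seq I) (P : pred I) (F G : I -> R) :
  (forall i, P i -> F i <= G i) ->
  \big[Rplus/0]_(i <- r | P i) F i <= \big[Rplus/0]_(i <- r | P i) G i.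
Proof. move=> h; apply: (big_ind2 (fun x y => x <= y)) => // *; lra. Qed.

Lemma rsum_ge0 (I : Type) (r : seq I) (P : pred I) (F : I -> R) :
  (forall i, P i -> 0 <= F i) -> 0 <= \big[Rplus/0]_(i <- r | P i) F i.
Proof. move=> h; apply: (big_ind (fun x => 0 <= x)) => // *; lra. Qed.

Lemma rsum_abs (I : Type) (r : seq I) (P : pred I) (F : I -> R) :
  Rabs (\big[Rplus/0]_(i <- r | P i) F i) <= \big[Rplus/0]_(i <- r | P i) Rabs (F i).
Proof.
apply: (big_ind2 (fun x y => Rabs x <= y)) => [|x1 x2 y1 y2 h1 h2|i _].
- by rewrite Rabs_R0; lra.
- by apply: Rle_trans (Rabs_triang _ _) _; lra.
- lra.
Qed.

Lemma rsumZ (I : Type) (r : seq I) (P : pred I) (c : R) (F : I -> R) :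
  \big[Rplus/0]_(i <- r | P i) (c * F i) = c * \big[Rplus/0]_(i <- r | P i) F i.
Proof. by rewrite big_distrr. Qed.

Lemma rsumB (I : Type) (r : seq I) (P : pred I) (F G : I -> R) :
  \big[Rplus/0]_(i <- r | P i) (F i - G i) =
  \big[Rplus/0]_(i <- r | P i) F i - \big[Rplus/0]_(i <- r | P i) G i.
Proof.
rewrite (eq_bigr (fun i => F i + -1 * G i)) => [|i _]; last by ring.
by rewrite big_split /= rsumZ; ring.
Qed.

Lemma rsum_const n (c : R) : \big[Rplus/0]_(i < n) c = INR n * c.
Proof.
elim: n => [|n IH]; first by rewrite big_ord0 /=; ring.
by rewrite big_ord_recr IH S_INR /=; ring.
Qed.

Lemma rprod_ge0 (I : Type) (r : seq I) (P : pred I) (F : I -> R) :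
  (forall i, P i -> 0 <= F i) -> 0 <= \big[Rmult/1]_(i <- r | P i) F i.
Proof. move=> h; apply: (big_ind (fun x => 0 <= x)) => // *; [lra|nra]. Qed.

Lemma rprod_le (I : Type) (r : seq I) (P : pred I) (F G : I -> R) :
  (forall i, P i -> 0 <= F i <= G i) ->
  \big[Rmult/1]_(i <- r | P i) F i <= \big[Rmult/1]_(i <- r | P i) G i.
Proof.
move=> h; suff: 0 <= \big[Rmult/1]_(i <- r | P i) F i <= \big[Rmult/1]_(i <- r | P i) G i by lra.
apply: (big_ind2 (fun x y => 0 <= x <= y)) => // *; first lra.
by split; [apply: Rmult_le_pos|apply: Rmult_le_compat]; lra.
Qed.

Lemma rprod_abs (I : Type) (r : seq I) (P : pred I) (F : I -> R) :
  Rabs (\big[Rmult/1]_(i <- r | P i) F i) = \big[Rmult/1]_(i <- r | P i) Rabs (F i).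
Proof.
apply: (big_ind2 (fun x y => Rabs x = y)) => [|x1 x2 y1 y2 <- <-|//].
- by rewrite Rabs_R1.
- by rewrite Rabs_mult.
Qed.

Lemma rprod_const n (c : R) : \big[Rmult/1]_(i < n) c = c ^ n.
Proof.
elim: n => [|n IH]; first by rewrite big_ord0.
by rewrite big_ord_recr IH /=; ring.
Qed.

Lemma exp_le a b : a <= b -> exp a <= exp b.
Proof. by case=> [h|->]; [left; apply: exp_increasing|lra]. Qed.

Lemma exp_INR (k : nat) (a : R) : exp (INR k * a) = exp a ^ k.
Proof.
elim: k => [|k IH]; first by rewrite Rmult_0_l exp_0.
by rewrite S_INR Rmult_plus_distr_r Rmult_1_l exp_plus IH /=; ring.
Qed.

Lemma pow_exp_ln (r : R) (k : nat) : 0 < r -> r ^ k = exp (INR k * ln r).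
Proof. by move=> h; rewrite exp_INR exp_ln. Qed.

Lemma INR_le m n : (m <= n)%N -> INR m <= INR n.
Proof. by move=> h; apply: le_INR; lia. Qed.

Lemma pow_mono x m n : 1 <= x -> (m <= n)%N -> x ^ m <= x ^ n.
Proof. by move=> h1 h2; apply: Rle_pow => //; lia. Qed.

Lemma pow2_ge1 l : 1 <= 2 ^ l. Proof. by apply: pow_R1_Rle; lra. Qed.

Lemma half_pow_gt0 l : 0 < (/ 2) ^ l. Proof. by apply: pow_lt; lra. Qed.

Lemma pow2_half l : 2 ^ l * (/ 2) ^ l = 1.
Proof. by rewrite -Rpow_mult_distr Rinv_r ?pow1; lra. Qed.

Lemma nat_nondecreasing (f : nat -> R) : (forall m, f m <= f m.+1) ->
  forall m m', (m <= m')%N -> f m <= f m'.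
Proof.
move=> hf m m' h; rewrite -(subnKC h); elim: (m' - m)%N => [|k IH]; first by rewrite addn0; lra.
by rewrite addnS; have := hf (m + k)%N; lra.
Qed.

Lemma ln2_gt0 : 0 < ln 2.
Proof. by rewrite -ln_1; apply: ln_increasing; lra. Qed.

Lemma expr_eq (x : R) (k : nat) : x ^ k.+1 = x * x ^ k. Proof. by []. Qed.

Lemma deriv_le (f f' g g' : R -> R) (a h : R) : 0 <= h ->
  (forall s, 0 <= s <= h -> derivable_pt_lim f (a + s) (f' s)) ->
  (forall s, 0 <= s <= h -> derivable_pt_lim g s (g' s)) ->
  (forall s, 0 <= s <= h -> f' s <= g' s) ->
  f a <= g 0 -> f (a + h) <= g h.
Proof.
move=> h0 df dg le' le0; case: (Req_dec h 0) => [->|hn].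
  by rewrite Rplus_0_r.
have hp : 0 < h by lra.
have d : forall c, 0 <= c <= h ->
  derivable_pt_lim (fun s => g s - f (a + s)) c (g' c - f' c).
  move=> c hc; apply: derivable_pt_lim_minus; first exact: dg.
  have -> : f' c = f' c * 1 by ring.
  apply: (derivable_pt_lim_comp (fun s => a + s) f); last exact: df.
  have -> : 1 = 0 + 1 by ring.
  apply: derivable_pt_lim_plus; [exact: derivable_pt_lim_const|exact: derivable_pt_lim_id].
have [c [e [c1 c2]]] := MVT_cor2 (fun s => g s - f (a + s)) (fun s => g' s - f' s) 0 h hp d.
have := le' c (conj (Rlt_le _ _ c1) (Rlt_le _ _ c2)).
move: e; rewrite /= Rplus_0_r => e h1.
have : 0 <= (g' c - f' c) * (h - 0) by apply: Rmult_le_pos; lra.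
lra.
Qed.

Lemma deriv_abs_le (f f' g g' : R -> R) (a h : R) : 0 <= h ->
  (forall s, 0 <= s <= h -> derivable_pt_lim f (a + s) (f' s)) ->
  (forall s, 0 <= s <= h -> derivable_pt_lim g s (g' s)) ->
  (forall s, 0 <= s <= h -> Rabs (f' s) <= g' s) ->
  Rabs (f a) <= g 0 -> Rabs (f (a + h)) <= g h.
Proof.
move=> h0 df dg le' le0; apply: Rabs_le; split.
- suff: - f (a + h) <= g h by lra.
  apply: (@deriv_le (fun x => - f x) (fun s => - f' s) g g') => //.
  + by move=> s hs; apply: derivable_pt_lim_opp; apply: df.
  + by move=> s hs; have := le' s hs; split_Rabs; lra.
  + by move: le0; split_Rabs; lra.
- apply: (@deriv_le f f' g g') => //.
  + by move=> s hs; have := le' s hs; split_Rabs; lra.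
  + by move: le0; split_Rabs; lra.
Qed.

Lemma derivable_pt_lim_expZ (l B s : R) :
  derivable_pt_lim (fun s => B * exp (l * s)) s (B * l * exp (l * s)).
Proof.
have -> : B * l * exp (l * s) = B * (exp (l * s) * l) by ring.
apply: derivable_pt_lim_scal.
apply: (derivable_pt_lim_comp (fun s => l * s) exp); last exact: derivable_pt_lim_exp.
have {2}-> : l = l * 1 by ring.
by apply: derivable_pt_lim_scal; exact: derivable_pt_lim_id.
Qed.

Lemma INR_fact_gt0 k : 0 < INR k`!.
Proof. by apply: lt_0_INR; have := fact_gt0 k; lia. Qed.

Lemma pow_le_fact_exp (k : nat) z : 0 <= z -> z ^ k / INR k`! <= exp z.
Proof.
elim: k z => [|k IH] z hz.
  by rewrite /= Rdiv_1_r; have := exp_ineq1_le z; lra.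
have -> : z = 0 + z by ring.
rewrite {2}Rplus_0_l.
apply: (@deriv_le (fun y => y ^ k.+1 / INR (k.+1)`!) (fun y => y ^ k / INR k`!) exp exp) => //.
- move=> s hs; rewrite Rplus_0_l.
  have -> : s ^ k / INR k`! = (/ INR (k.+1)`!) * (INR k.+1 * s ^ k).
    rewrite factS mult_INR; have := INR_fact_gt0 k; have := lt_0_INR k.+1 ltac:(lia).
    by move=> *; field; lra.
  have -> : (fun y => y ^ k.+1 / INR (k.+1)`!) = (fun y => / INR (k.+1)`! * y ^ k.+1).
    by apply: functional_extensionality => y; rewrite /Rdiv; ring.
  by apply: derivable_pt_lim_scal; exact: (derivable_pt_lim_pow s k.+1).
- by move=> s _; exact: derivable_pt_lim_exp.
- by move=> s hs; apply: IH; lra.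
- rewrite exp_0 /= Rmult_0_l /Rdiv Rmult_0_l; lra.
Qed.

Lemma archimed_nat x : exists n : nat, x <= INR n.
Proof.
case: (Rle_dec x 0) => h; first by exists 0%N.
have [h1 _] := archimed x; exists (Z.to_nat (up x)).
rewrite INR_IZR_INZ Z2Nat.id; first lra.
by apply: le_IZR; lra.
Qed.

Lemma nat_floor x : 0 <= x -> exists n : nat, INR n <= x < INR n + 1.
Proof.
move=> h; have [m hm] := archimed_nat x.
elim: m hm => [|m IH] hm.
  by exists 0%N => /=; move: hm => /=; lra.
case: (Rle_dec x (INR m)) => h1; first exact: IH.
case: (Req_dec x (INR m.+1)) => [e|ne].
- by exists m.+1; lra.
- by exists m; move: hm ne; rewrite S_INR; lra.
Qed.

Lemma nat_ceil x : 0 <= x -> exists n : nat, x <= INR n < x + 1.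
Proof.
move=> h; have [n [h1 h2]] := nat_floor h.
case: (Req_dec x (INR n)) => [e|ne]; first by exists n; lra.
by exists n.+1; rewrite S_INR; lra.
Qed.

Lemma cauchy_rate_limit (u r : nat -> R) :
  (forall N N', (N <= N')%N -> Rabs (u N' - u N) <= r N) ->
  (forall eps, 0 < eps -> exists N, forall m, (N <= m)%N -> r m < eps) ->
  exists l, forall N, Rabs (l - u N) <= r N.
Proof.
move=> hu hr.
have [|l hl] := Rcomplete.R_complete u.
  move=> eps e0; have [N hN] := hr eps e0; exists N => a b ha hb; rewrite /R_dist.
  case: (leqP a b) => h.
    by rewrite Rabs_minus_sym; apply: Rle_lt_trans (hu _ _ h) (hN _ _); lia.
  by apply: Rle_lt_trans (hu _ _ (ltnW h)) (hN _ _); lia.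
exists l => N; apply: Rnot_lt_le => hlt.
have [N' hN'] := hl (Rabs (l - u N) - r N) ltac:(lra).
have := hN' (N + N')%N ltac:(lia); have := hu N (N + N')%N ltac:(lia).
by rewrite /R_dist; split_Rabs; lra.
Qed.

(** * Weight matrices *)

Lemma Rsup_ub (E : R -> Prop) y : bound E -> E y -> y <= Rsup E.
Proof.
move=> hb hy; rewrite /Rsup; case: excluded_middle_informative => [[h1 h2]|h].
  by case: completeness => m [hm _] /=; apply: hm.
by case: h; split => //; exists y.
Qed.

Lemma Rsup_le (E : R -> Prop) B : (exists y, E y) -> (forall y, E y -> y <= B) -> Rsup E <= B.
Proof.
move=> he hB; rewrite /Rsup; case: excluded_middle_informative => [[h1 h2]|h].
  by case: completeness => m [_ hm] /=; apply: hm => y; exact: hB.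
by case: h; split => //; exists B => y; exact: hB.
Qed.

Lemma exp_ge1 s : 0 <= s -> 1 <= exp s.
Proof. by move=> h; rewrite -exp_0; exact: exp_le. Qed.

Lemma ln_ge0 r : 1 <= r -> 0 <= ln r.
Proof. by move=> h; rewrite -ln_1; case: h => [h|<-]; [left; apply: ln_increasing; lra|lra]. Qed.

Lemma ln_le_mono x y : 0 < x -> x <= y -> ln x <= ln y.
Proof. by move=> h; case=> [h1|->]; [left; exact: ln_increasing|lra]. Qed.

Section Weight.
Variables (om : R -> R) (H : is_weight_function om).

Lemma om_mono s t : 0 <= s -> s <= t -> om s <= om t.
Proof. by case: H => _ []; auto. Qed.

Lemma om_ge0 t : 0 <= t -> 0 <= om t.
Proof. by case: H => _ [_] []; auto. Qed.

Lemma om_ln_le eps : 0 < eps -> exists C, 0 <= C /\ forall t, 1 <= t -> ln t <= eps * om t + C.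
Proof.
case: H => _ [_] [_] [_] [_] [_] [_] [h _] e0; have [T hT] := h eps e0.
exists (Rmax 0 (ln (Rmax 1 T))); split; first exact: Rmax_l.
move=> t ht; have p := om_ge0 (t := t) ltac:(lra).
have pe : 0 <= eps * om t by apply: Rmult_le_pos; lra.
have m1 := Rmax_l 0 (ln (Rmax 1 T)); have m2 := Rmax_r 0 (ln (Rmax 1 T)).
case: (Rle_dec T t) => hT1; first by have := hT t hT1; lra.
have : ln t <= ln (Rmax 1 T).
  by apply: ln_le_mono; [lra|have := Rmax_r 1 T; lra].
lra.
Qed.

Lemma om_double : exists D, 1 <= D /\ forall t, 0 <= t -> om (2 * t) <= D * om t + D.
Proof.
case: (H) => _ [_] [_] [_] [_] [[C [T hT]] _].
pose B := om (2 * Rmax 0 T).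
have B0 : 0 <= B by apply: om_ge0; have := Rmax_l 0 T; lra.
exists (Rmax 1 (Rmax C B)); split; first exact: Rmax_l.
have h1 := Rmax_l 1 (Rmax C B); have h2 := Rmax_r 1 (Rmax C B).
have h3 := Rmax_l C B; have h4 := Rmax_r C B.
set D := Rmax 1 _ in h1 h2 *.
move=> t ht; have p := om_ge0 ht.
have pD : 0 <= D * om t by apply: Rmult_le_pos; lra.
case: (Rle_dec T t) => hT1.
  have := hT t hT1; have : C * om t <= D * om t by apply: Rmult_le_compat_r; lra.
  lra.
suff : om (2 * t) <= B by lra.
by apply: om_mono; [lra|have := Rmax_r 0 T; lra].
Qed.

Lemma om_scale A : 0 <= A -> exists D, 1 <= D /\ forall t, 0 <= t -> om (A * t) <= D * om t + D.
Proof.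
move=> hA; have [D [D1 hD]] := om_double.
have [k hk] : exists k : nat, A <= 2 ^ k.
  have [k hk] := archimed_nat A; exists k; apply: Rle_trans hk _.
  elim: k => [|k IH]; first by rewrite /=; lra.
  have h1 : 1 <= 2 ^ k by apply: pow_R1_Rle; lra.
  by rewrite S_INR /=; lra.
suff [D' [h1 h2]] : exists D', 1 <= D' /\ forall t, 0 <= t -> om (2 ^ k * t) <= D' * om t + D'.
  exists D'; split=> // t ht.
  apply: Rle_trans (h2 t ht); apply: om_mono; first exact: Rmult_le_pos.
  exact: Rmult_le_compat_r.
elim: k {hk} => [|k [D' [h1 h2]]].
  by exists 1; split; [lra|move=> t ht; rewrite /= Rmult_1_l; lra].
exists (D * (2 * D')); split; first nra.
move=> t ht; have -> : 2 ^ k.+1 * t = 2 * (2 ^ k * t) by rewrite /=; ring.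
have p2 : 0 <= 2 ^ k * t by apply: Rmult_le_pos => //; apply: pow_le; lra.
apply: Rle_trans (hD _ p2) _.
have h3 := h2 t ht; have h4 := om_ge0 ht.
have : D * om (2 ^ k * t) <= D * (D' * om t + D') by apply: Rmult_le_compat_l; lra.
have h5 : 0 <= D * D' * om t by apply: Rmult_le_pos => //; nra.
have h6 : D <= D * D' by nra.
lra.
Qed.

Lemma om_convex s1 s2 s3 : s1 <= s2 -> s2 <= s3 ->
  (s3 - s1) * om (exp s2) <= (s3 - s2) * om (exp s1) + (s2 - s1) * om (exp s3).
Proof.
case: H => _ [_] [_] [_] [_] [_] [_] [_ h] h12 h23.
case: (Req_dec s1 s3) => [e|ne].
  have e1 : s1 = s2 by lra.
  by subst; lra.
have p : 0 < s3 - s1 by lra.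
have hl : 0 <= (s3 - s2) / (s3 - s1) <= 1.
  split; first by apply: Rle_mult_inv_pos; lra.
  apply: (Rmult_le_reg_r (s3 - s1)) => //; rewrite /Rdiv Rmult_assoc Rinv_l; lra.
have := h s1 s3 _ hl.
have -> : (s3 - s2) / (s3 - s1) * s1 + (1 - (s3 - s2) / (s3 - s1)) * s3 = s2 by field; lra.
move=> h1; have h2 := Rmult_le_compat_l _ _ _ (Rlt_le _ _ p) h1.
apply: Rle_trans h2 _; apply: Req_le; field; lra.
Qed.

(** Finiteness comes from [ln r <= om r / t + C]; without it [Rsup] would silently return its
    default value 0. *)
Lemma young_bound t : bound (fun y => exists s, 0 <= s /\ y = s * t - om (exp s)).
Proof.
case: (Rle_dec t 0) => ht.
  exists 0 => y [s [hs ->]]; have := om_ge0 (Rlt_le _ _ (exp_pos s)); nra.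
have [C [C0 hC]] := om_ln_le (eps := / t) ltac:(apply: Rinv_0_lt_compat; lra).
exists (C * t) => y [s [hs ->]].
have := hC _ (exp_ge1 hs); rewrite ln_exp => h.
have := Rmult_le_compat_r t _ _ ltac:(lra) h.
have -> : (/ t * om (exp s) + C) * t = om (exp s) + C * t by field; lra.
lra.
Qed.

Lemma wmat_gt0 x k : 0 < wmat om x k. Proof. exact: exp_pos. Qed.

(* Both bounds say that the weight matrix entry [W^x_k] is the supremum of
   [r^k exp (- om r / x)] over [r >= 1]. *)
Lemma wmat_ge x k r : 0 < x -> 1 <= r -> r ^ k * exp (- (om r / x)) <= wmat om x k.
Proof.
move=> x0 r1; rewrite pow_exp_ln; last lra.
rewrite -exp_plus /wmat; apply: exp_le.
have h : ln r * (x * INR k) - om r <= young_conj om (x * INR k).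
  apply: Rsup_ub; first exact: young_bound.
  by exists (ln r); split; [exact: ln_ge0|rewrite exp_ln //; lra].
have := Rmult_le_compat_l (/ x) _ _ (Rlt_le _ _ (Rinv_0_lt_compat _ x0)) h.
apply: Rle_trans; apply: Req_le; field; lra.
Qed.

Lemma wmat_le x k B : 0 < x ->
  (forall r, 1 <= r -> r ^ k * exp (- (om r / x)) <= B) -> wmat om x k <= B.
Proof.
move=> x0 hB.
have B0 : 0 < B.
  by apply: Rlt_le_trans (hB 1 ltac:(lra)); rewrite pow1 Rmult_1_l; exact: exp_pos.
rewrite /wmat -(exp_ln _ B0); apply: exp_le.
apply: (Rmult_le_reg_l x) => //; rewrite -Rmult_assoc Rinv_r ?Rmult_1_l; last lra.
apply: Rsup_le; first by exists (0 * (x * INR k) - om (exp 0)), 0; split => //; lra.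
move=> y [s [hs ->]].
have := hB _ (exp_ge1 hs); rewrite -exp_INR -exp_plus -{1}(exp_ln _ B0).
move=> h1; have h : INR k * s + - (om (exp s) / x) <= ln B.
  by case: (Rle_dec (INR k * s + - (om (exp s) / x)) (ln B)) => // /Rnot_le_lt /exp_increasing; lra.
have := Rmult_le_compat_l x _ _ (Rlt_le _ _ x0) h.
apply: Rle_trans; apply: Req_le; field; lra.
Qed.

Lemma wmat_pow_le x k r : 0 < x -> 1 <= r -> r ^ k <= wmat om x k * exp (om r / x).
Proof.
move=> x0 r1; have h := wmat_ge k x0 r1.
have := Rmult_le_compat_r _ _ _ (Rlt_le _ _ (exp_pos (om r / x))) h.
rewrite Rmult_assoc -[in X in X -> _]exp_plus.
have -> : - (om r / x) + om r / x = 0 by ring.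
by rewrite exp_0 Rmult_1_r.
Qed.

Lemma om_div_ge0 x r : 0 < x -> 0 <= r -> 0 <= om r / x.
Proof. by move=> x0 r0; apply: Rle_mult_inv_pos => //; exact: om_ge0. Qed.

Lemma wmat0_le1 x : 0 < x -> wmat om x 0 <= 1.
Proof.
move=> x0; apply: wmat_le => // r r1; rewrite /= Rmult_1_l -exp_0; apply: exp_le.
by have := om_div_ge0 (r := r) x0 ltac:(lra); lra.
Qed.

(** In a product of two terms of the suprema, at [r] and [r'], both can be moved to the larger of
    the two radii: the powers grow, and of the two penalties only that of the larger radius is
    kept. *)
Lemma wmat_mulM x j k : 0 < x -> wmat om x j * wmat om x k <= wmat om x (j + k).
Proof.
move=> x0.
have h : forall r r', 1 <= r -> 1 <= r' ->
  (r ^ j * exp (- (om r / x))) * (r' ^ k * exp (- (om r' / x))) <= wmat om x (j + k).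
  move=> r r' h1 h2; set m := Rmax r r'.
  have m1 : r <= m by exact: Rmax_l.
  have m2 : r' <= m by exact: Rmax_r.
  apply: Rle_trans (wmat_ge (j + k) x0 (r := m) ltac:(lra)).
  rewrite Rdef_pow_add.
  have e1 : exp (- (om r / x)) * exp (- (om r' / x)) <= exp (- (om m / x)).
    rewrite -exp_plus; apply: exp_le.
    have p1 := om_div_ge0 (r := r) x0 ltac:(lra).
    have p2 := om_div_ge0 (r := r') x0 ltac:(lra).
    by rewrite /m /Rmax; case: Rle_dec => _; lra.
  have -> : r ^ j * exp (- (om r / x)) * (r' ^ k * exp (- (om r' / x))) =
    (r ^ j * r' ^ k) * (exp (- (om r / x)) * exp (- (om r' / x))) by ring.
  apply: Rmult_le_compat => //.
  + by apply: Rmult_le_pos; apply: pow_le; lra.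
  + by left; apply: Rmult_lt_0_compat; exact: exp_pos.
  + by apply: Rmult_le_compat; try (apply: pow_le; lra); apply: pow_incr; lra.
have wk := wmat_gt0 x k.
suff : wmat om x j <= wmat om x (j + k) / wmat om x k.
  move=> h1; have := Rmult_le_compat_r _ _ _ (Rlt_le _ _ wk) h1.
  have -> : wmat om x (j + k) / wmat om x k * wmat om x k = wmat om x (j + k) by field; lra.
  by [].
apply: wmat_le => // r r1.
have p : 0 < r ^ j * exp (- (om r / x)).
  by apply: Rmult_lt_0_compat; [apply: pow_lt; lra|exact: exp_pos].
apply: (Rmult_le_reg_r (wmat om x k)) => //.
have -> : wmat om x (j + k) / wmat om x k * wmat om x k = wmat om x (j + k) by field; lra.
apply: (Rmult_le_reg_l (/ (r ^ j * exp (- (om r / x))))); first exact: Rinv_0_lt_compat.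
rewrite -[X in X <= _]Rmult_assoc Rinv_l ?Rmult_1_l; last lra.
apply: wmat_le => // r' r1'.
apply: (Rmult_le_reg_l (r ^ j * exp (- (om r / x)))) => //.
by rewrite -[X in _ <= X]Rmult_assoc Rinv_r ?Rmult_1_l; [exact: h|lra].
Qed.

(** For fixed [r] the term of order [k + 1] is the geometric mean of the terms of orders [k] and
    [k + 2]. *)
Lemma wmat_logconvex x k : 0 < x -> wmat om x k.+1 * wmat om x k.+1 <= wmat om x k * wmat om x k.+2.
Proof.
move=> x0; set B := wmat om x k * wmat om x k.+2.
have B0 : 0 < B by apply: Rmult_lt_0_compat; exact: wmat_gt0.
have s0 := sqrt_lt_R0 _ B0.
suff h : wmat om x k.+1 <= sqrt B.
  rewrite -(sqrt_sqrt B); last lra.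
  by apply: Rmult_le_compat => //; left; exact: wmat_gt0.
apply: wmat_le => // r r1.
have e0 := exp_pos (- (om r / x)).
have p : 0 <= r ^ k.+1 * exp (- (om r / x)) by apply: Rmult_le_pos; [apply: pow_le|]; lra.
rewrite -(sqrt_square _ p); apply: sqrt_le_1; [nra|lra|].
have -> : (r ^ k.+1 * exp (- (om r / x))) * (r ^ k.+1 * exp (- (om r / x))) =
  (r ^ k * exp (- (om r / x))) * (r ^ k.+2 * exp (- (om r / x))) by rewrite /=; ring.
apply: Rmult_le_compat; try (apply: Rmult_le_pos; [apply: pow_le|]; lra); exact: wmat_ge.
Qed.

Lemma wmat_mono_x x y k : 0 < x -> x <= y -> wmat om x k <= wmat om y k.
Proof.
move=> x0 xy; apply: wmat_le => // r r1.
apply: Rle_trans (wmat_ge k (x := y) ltac:(lra) r1).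
apply: Rmult_le_compat_l; first by apply: pow_le; lra.
apply: exp_le; suff : om r / y <= om r / x by lra.
apply: Rmult_le_compat_l; first by apply: om_ge0; lra.
by apply: Rinv_le_contravar.
Qed.

(** [A ^ k r ^ k = (A r) ^ k], and [om (A r) <= D om r + D] turns the penalty at [r] with parameter
    [x] into the penalty at [A r] with parameter [D x]; the additive [D] becomes the constant
    [exp (/ x)]. *)
Lemma wmat_geom A x : 1 <= A -> 0 < x ->
  exists y C, 0 < y /\ x <= y /\ 0 < C /\ forall k, A ^ k * wmat om x k <= C * wmat om y k.
Proof.
move=> A1 x0; have [D [D1 hD]] := om_scale (A := A) ltac:(lra).
have Dx : 0 < D * x by nra.
exists (D * x), (exp (/ x)); split => //; split; first nra; split; first exact: exp_pos.
move=> k; have Ak : 0 < A ^ k by apply: pow_lt; lra.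
suff : wmat om x k <= exp (/ x) * wmat om (D * x) k / A ^ k.
  move=> h1; have := Rmult_le_compat_l _ _ _ (Rlt_le _ _ Ak) h1.
  have -> : A ^ k * (exp (/ x) * wmat om (D * x) k / A ^ k) = exp (/ x) * wmat om (D * x) k by field; lra.
  by [].
apply: wmat_le => // r r1.
apply: (Rmult_le_reg_l (A ^ k)) => //.
have -> : A ^ k * (exp (/ x) * wmat om (D * x) k / A ^ k) = exp (/ x) * wmat om (D * x) k by field; lra.
rewrite -Rmult_assoc -Rpow_mult_distr.
have h1 := wmat_ge k Dx (r := A * r) ltac:(nra).
have h2 := hD r ltac:(lra).
apply: Rle_trans (Rmult_le_compat_l _ _ _ (Rlt_le _ _ (exp_pos (/ x))) h1).
have -> : forall a b c, a * (b * c) = b * (a * c) by move=> *; ring.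
apply: Rmult_le_compat_l; first by apply: pow_le; nra.
rewrite -exp_plus; apply: exp_le.
have := Rmult_le_compat_r (/ (D * x)) _ _ (Rlt_le _ _ (Rinv_0_lt_compat _ Dx)) h2.
rewrite /Rdiv; have -> : (D * om r + D) * / (D * x) = om r * / x + / x by field; lra.
lra.
Qed.
End Weight.

(** * Necessity of the integral condition *)

Lemma coord_le_dist n (x y : pt n) i : Rabs (x i - y i) <= dist x y.
Proof.
rewrite -sqrt_Rsqr_abs /dist; apply: sqrt_le_1_alt.
rewrite (bigD1 i) //=.
rewrite -[X in X <= _]Rplus_0_r; apply: Rplus_le_compat_l.
by apply: rsum_ge0 => j _; exact: Rle_0_sqr.
Qed.

Lemma dist_le_sum n (x y : pt n) : dist x y <= \big[Rplus/0]_(i < n) Rabs (x i - y i).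
Proof.
have p : 0 <= \big[Rplus/0]_(i < n) Rabs (x i - y i).
  by apply: rsum_ge0 => i _; exact: Rabs_pos.
rewrite /dist -[X in _ <= X](sqrt_Rsqr _ p); apply: sqrt_le_1_alt.
suff [] : 0 <= \big[Rplus/0]_(i < n) Rabs (x i - y i) /\
  \big[Rplus/0]_(i < n) Rsqr (x i - y i) <= Rsqr (\big[Rplus/0]_(i < n) Rabs (x i - y i)) by [].
apply: (big_ind2 (fun a b => 0 <= a /\ b <= Rsqr a)).
- by rewrite /Rsqr; lra.
- by move=> a1 a2 b1 b2 [h1 h2] [h3 h4]; rewrite /Rsqr in h2 h4 *; split; nra.
- by move=> i _; split; [exact: Rabs_pos|rewrite -Rsqr_abs; lra].
Qed.

Lemma dist_refl n (x : pt n) : dist x x = 0.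
Proof.
rewrite /dist big1 ?sqrt_0 // => i _.
by rewrite Rminus_diag Rsqr_0.
Qed.

Lemma compact_origin n : compact_Rn (fun a : pt n => a = @origin n).
Proof.
split; first by exists 0 => x ->; rewrite dist_refl; lra.
move=> x h; apply: functional_extensionality => i; rewrite /origin.
apply: NNPP => ne; have e0 : 0 < Rabs (x i) by apply: Rabs_pos_lt.
have [y [-> hd]] := h _ e0; have := coord_le_dist x (@origin n) i.
by rewrite /origin Rminus_0_r; rewrite /origin in hd; lra.
Qed.

Lemma taylor_rem_diag n (F : mi n -> pt n -> R) p a al : taylor_rem F p a al a = 0.
Proof.
rewrite /taylor_rem (bigD1 [ffun _ => ord0]) /=; last first.
  by rewrite /mabs big1 // => i _; rewrite /bnat !ffunE.
rewrite big1 => [|b /andP[_ hb]].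
  rewrite /mpow big1 => [|i _]; last by rewrite !ffunE.
  rewrite /mfact big1 => [|i _]; last by rewrite !ffunE.
  rewrite (_ : madd al _ = al); first by field.
  by apply/ffunP => i; rewrite !ffunE /= addn0.
suff -> : mpow (fun i => a i - a i) (bnat b) = 0 by rewrite /Rdiv !Rmult_0_l.
have [i hi] : exists i, b i != ord0.
  apply/existsP; rewrite -negb_forall; apply: contra hb => /forallP h.
  apply/eqP; apply/ffunP => i; rewrite ffunE; apply/eqP.
  by have := h i.
rewrite /mpow (bigD1 i) //= ffunE Rminus_diag.
have -> : nat_of_ord (b i) = (nat_of_ord (b i)).-1.+1 by have : (nat_of_ord (b i) != 0)%N by []; lia.
by rewrite /= !Rmult_0_l.
Qed.

Definition axis n (i0 : 'I_n) (k : nat) : mi n := [ffun j => if j == i0 then k else 0%N].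

Lemma mabs_axis n (i0 : 'I_n) k : mabs (axis i0 k) = k.
Proof.
rewrite /mabs (bigD1 i0) //= ffunE eqxx big1 ?addn0 // => i hi.
by rewrite ffunE (negbTE hi).
Qed.

(** On a one-point set all Taylor remainders vanish, so every sequence bounded by a multiple of
    [S^1] becomes a jet when placed along one coordinate axis. Restricting the extension to that
    axis gives functions of one variable. *)
Lemma borel_extension n (om sg : R -> R) : (1 <= n)%N ->
  (forall E : pt n -> Prop, compact_Rn E -> jet_surjective om sg E) ->
  forall (F : nat -> R) (C0 : R), 0 < C0 -> (forall k, Rabs (F k) <= C0 * wmat sg 1 k) ->
  exists (g : nat -> R -> R) (C rho : R), 0 < C /\ 0 < rho /\
    (forall k h, derivable_pt_lim (g k) h (g k.+1 h)) /\
    (forall k h, Rabs (g k h) <= C * wmat om rho k) /\ forall k, g k 0 = F k.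
Proof.
move=> n1 hE F C0 C0p hF; pose i0 : 'I_n := Ordinal n1.
(* The test [al == axis i0 (al i0)] singles out the multi-indices carried by the coordinate [i0];
   all other entries are zero. *)
pose J (al : mi n) (x : pt n) := if al == axis i0 (al i0) then F (al i0) else 0.
have hJ : in_B_sigma_E sg (fun a => a = @origin n) J.
  exists 1; split; first lra.
  split; first by move=> al a _ eps e0; exists 1; split; [lra|move=> b _ _; rewrite /J Rminus_diag Rabs_R0].
  exists C0, 1; split => //; split; first lra; split.
    move=> al a _; rewrite pow1 Rmult_1_r /J; case: eqP => [e|_].
      by rewrite {2}e mabs_axis; exact: hF.
    by rewrite Rabs_R0; apply: Rmult_le_pos; [lra|left; exact: exp_pos].
  move=> al p a b _ -> ->; rewrite taylor_rem_diag Rabs_R0.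
  apply: Rle_mult_inv_pos; last exact: INR_fact_gt0.
  apply: Rmult_le_pos; last by apply: pow_le; rewrite dist_refl; lra.
  apply: Rmult_le_pos; last by left; exact: exp_pos.
  by rewrite pow1; lra.
have [f [D [[_ [_ hD]] [[rho [rho1 [C hC]]] hDF]]]] := hE _ (@compact_origin n) _ hJ.
have rho0 : 0 < INR rho by apply: lt_0_INR; lia.
have C0' : 0 <= C.
  apply: Rle_trans (hC (@origin n) (@mzero n)).
  by apply: Rmult_le_pos; [exact: Rabs_pos|left; exact: exp_pos].
exists (fun k h => D (axis i0 k) (upd (@origin n) i0 h)), (C + 1), (INR rho); split; first lra.
split => //; split; [|split].
- move=> k h.
  have e : axis i0 k.+1 = mincr (axis i0 k) i0.
    by apply/ffunP => j; rewrite !ffunE; case: eqP.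
  have := hD (axis i0 k) i0 (upd (@origin n) i0 h); rewrite -e => hd eps e0.
  have [delta hdelta] := hd eps e0; exists delta => s s0 hs; have := hdelta s s0 hs.
  have u : forall s, upd (upd (@origin n) i0 h) i0 s = upd (@origin n) i0 (h + s).
    by move=> s'; apply: functional_extensionality => j; rewrite /upd; case: eqP => _; lra.
  by rewrite !u !Rplus_0_l Rplus_0_r.
- move=> k h; have := hC (upd (@origin n) i0 h) (axis i0 k); rewrite mabs_axis => h1.
  have w0 : 0 < wmat om (INR rho) k by exact: exp_pos.
  have e : exp (- / INR rho * young_conj om (INR rho * INR k)) * wmat om (INR rho) k = 1.
    by rewrite /wmat -exp_plus -exp_0; congr exp; ring.
  have := Rmult_le_compat_r _ _ _ (Rlt_le _ _ w0) h1.
  rewrite Rmult_assoc e Rmult_1_r; nra.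
- move=> k; have -> : upd (@origin n) i0 0 = @origin n.
    by apply: functional_extensionality => j; rewrite /upd; case: eqP => _; lra.
  rewrite hDF // /J ffunE eqxx.
  by case: eqP.
Qed.

(* If no pair (C, rho) served all p and N, one lacunary jet built from bad pairs
   would have an extension, and its constants would serve one of these pairs. *)
Lemma borel_extension_uniform n (om sg : R -> R) : (1 <= n)%N -> is_weight_function om ->
  (forall E : pt n -> Prop, compact_Rn E -> jet_surjective om sg E) ->
  exists (C rho : R), 0 < C /\ 0 < rho /\ forall p N : nat,
  exists (g : nat -> R -> R), 
    (forall k h, derivable_pt_lim (g k) h (g k.+1 h)) /\
    (forall k h, Rabs (g k h) <= C * wmat om rho k) /\ g p 0 = wmat sg 1 p /\
    forall k, (p < k)%N -> (k <= N)%N -> g k 0 = 0.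
Proof.
move=> n1 hom hE; pose S := wmat sg 1.
have S0 k : 0 < S k by exact: exp_pos.
have W0 rho k : 0 < wmat om rho k by exact: exp_pos.
(* One integer codes both constants, [C = rho = m + 1]. The property is monotone in [m] because the
   weight matrix increases with its parameter. *)
pose ok (m p N : nat) := exists (g : nat -> R -> R),
    (forall k h, derivable_pt_lim (g k) h (g k.+1 h)) /\
    (forall k h, Rabs (g k h) <= INR m.+1 * wmat om (INR m.+1) k) /\ g p 0 = S p /\
    forall k, (p < k)%N -> (k <= N)%N -> g k 0 = 0.
have INR0 m : 0 < INR m.+1 by apply: lt_0_INR; lia.
have okC g p N C rho : 0 < C -> 0 < rho -> (forall k h, derivable_pt_lim (g k) h (g k.+1 h)) ->
    (forall k h, Rabs (g k h) <= C * wmat om rho k) -> g p 0 = S p ->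
    (forall k, (p < k)%N -> (k <= N)%N -> g k 0 = 0) ->
    forall m, C <= INR m -> rho <= INR m -> ok m p N.
  move=> C0 rho0 hd hb hp hN m hm1 hm2; exists g; split => //; split => // k h.
  apply: Rle_trans (hb k h) _; rewrite S_INR; apply: Rmult_le_compat; try lra; first exact: Rlt_le.
  by apply: wmat_mono_x => //; lra.
apply: NNPP => hno.
have bad m : exists p N, ~ ok m p N.
  apply: NNPP => h; apply: hno; exists (INR m.+1), (INR m.+1).
  split => //; split => // p N; apply: NNPP => h'.
  by apply: h; exists p, N.
have okmono m m' p N : (m <= m')%N -> ok m p N -> ok m' p N.
  move=> hm [g [h1 [h2 [h3 h4]]]]; exists g; split => //; split => // k h.
  apply: Rle_trans (h2 k h) _; have := INR_le (m := m.+1) (n := m'.+1) hm => le.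
  apply: Rmult_le_compat; [exact: Rlt_le|exact: Rlt_le|exact: le|].
  exact: wmat_mono_x.
(* For one fixed [p] the jet with the single entry [S p] has an extension that serves all [N] at
   once; hence the bad pairs for large [m] have arbitrarily large [p]. *)
have fixp p : exists m, forall N, ok m p N.
  have [|k|g [C [rho [C0 [rho0 [hd [hb hF]]]]]]] :=
    borel_extension n1 hE (F := fun k => if k == p then S p else 0) (C0 := 1).
  - lra.
  - rewrite Rmult_1_l; case: eqP => [->|_]; first by rewrite Rabs_right; [exact: Rle_refl|left; exact: S0].
    by rewrite Rabs_R0; exact: Rlt_le.
  have [m hm] := archimed_nat (Rmax C rho); exists m => N.
  apply: (okC _ _ _ _ _ _ _ hd hb _ _ m) => //.
  + by rewrite hF eqxx.
  + by move=> k hk _; rewrite hF; case: eqP => // e; lia.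
  + by have := Rmax_l C rho; lra.
  + by have := Rmax_r C rho; lra.
have badP m P : exists pN : nat * nat, (P < pN.1)%N /\ ~ ok m pN.1 pN.2.
  have [m' hm'] : exists m', (m <= m')%N /\ forall p, (p <= P)%N -> forall N, ok m' p N.
    elim: P => [|P [m1 [h1 h2]]].
      have [m1 h1] := fixp 0%N; exists (maxn m m1); split; first by lia.
      move=> p hp N; have -> : p = 0%N by lia.
      by apply: okmono (h1 N); lia.
    have [m2 h3] := fixp P.+1; exists (maxn m1 m2); split; first by lia.
    move=> p hp N; case: (ltngtP p P.+1) => hlt; last 1 first.
    + by rewrite hlt; apply: okmono (h3 N); lia.
    + by apply: okmono (h2 p _ N); lia.
    + by lia.
  have [p [N hN]] := bad m'; exists (p, N) => /=; split.
    by rewrite ltnNge; apply/negP => hle; apply: hN; apply: hm'.2.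
  by move=> h; apply: hN; apply: okmono h; case: hm'.
have [pick hpick] : exists pick : nat -> nat -> nat * nat,
    forall m P, (P < (pick m P).1)%N /\ ~ ok m (pick m P).1 (pick m P).2.
  exists (fun m P => proj1_sig (constructive_indefinite_description _ (badP m P))) => m P.
  by case: constructive_indefinite_description.
(* Each pair starts beyond both components of the preceding one, so the gap [p < k <= N] of a pair
   contains the first component of no other pair, and the lacunary jet vanishes there. *)
pose fix sq (m : nat) : nat * nat :=
  if m is m'.+1 then pick m (maxn (sq m').1 (sq m').2) else pick 0%N 0%N.
have sqS m : ((sq m).1 < (sq m.+1).1)%N /\ ((sq m).2 < (sq m.+1).1)%N.
  by have [h _] := hpick m.+1 (maxn (sq m).1 (sq m).2); rewrite /=; lia.
have sqbad m : ~ ok m (sq m).1 (sq m).2 by case: m => [|m]; exact: (hpick _ _).2.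
have sqmono m m' : (m < m')%N -> ((sq m).1 < (sq m').1)%N /\ ((sq m).2 < (sq m').1)%N.
  elim: m' => [//|m' IH] h; have h1 := sqS m'.
  case: (ltngtP m m') => [/IH|h2|e]; [by lia|by lia|by rewrite e].
pose F k := if excluded_middle_informative (exists m, k = (sq m).1) then S k else 0.
have [|k|g [C [rho [C0 [rho0 [hd [hb hF]]]]]]] := borel_extension n1 hE (F := F) (C0 := 1).
- lra.
- rewrite Rmult_1_l /F; case: excluded_middle_informative => h /=.
    by rewrite Rabs_right; [exact: Rle_refl|left; exact: S0].
  by rewrite Rabs_R0; exact: Rlt_le.
have [m hm] := archimed_nat (Rmax C rho); apply: (sqbad m).
apply: (okC _ _ _ _ _ _ _ hd hb _ _ m) => //.
- by rewrite hF /F; case: excluded_middle_informative => // h; case: h; exists m.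
- move=> k hk1 hk2; rewrite hF /F; case: excluded_middle_informative => // -[m' e].
  exfalso; case: (ltngtP m m') => hm'; last by subst; lia.
  + by have := sqmono _ _ hm'; lia.
  + by have := sqmono _ _ hm'; lia.
- by have := Rmax_l C rho; lra.
- by have := Rmax_r C rho; lra.
Qed.

(** * Bang's argument and the tail of the quotients *)

Lemma ratio_mono (M : nat -> R) : (forall k, 0 < M k) ->
  (forall k, M k.+1 * M k.+1 <= M k * M k.+2) ->
  forall k q, (k <= q)%N -> M k.+1 * M q <= M k * M q.+1.
Proof.
move=> M0 hM k q; elim: q => [|q IH] hkq.
  have -> : k = 0%N by lia.
  by rewrite Rmult_comm; lra.
case: (ltngtP k q.+1) => hlt; [|by lia|by rewrite hlt Rmult_comm; lra].
have h1 := IH ltac:(lia); have h2 := hM q.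
have q0 := M0 q; have q1 := M0 q.+1; have k0 := M0 k; have k1 := M0 k.+1; have q2 := M0 q.+2.
apply: (Rmult_le_reg_r (M q.+1 * M q)); first exact: Rmult_lt_0_compat.
have -> : M k.+1 * M q.+1 * (M q.+1 * M q) = (M k.+1 * M q) * (M q.+1 * M q.+1) by ring.
have -> : M k * M q.+2 * (M q.+1 * M q) = (M k * M q.+1) * (M q * M q.+2) by ring.
by apply: Rmult_le_compat => //; apply: Rmult_le_pos; lra.
Qed.

(* Bang's argument: at a point where the k-th derivative is at most e^(k-q-1) M_k for
   all k <= q+1, a step of length at most M_q / (e M_(q+1)) costs at most a factor e. *)
Lemma bang (h : nat -> R -> R) (M : nat -> R) (N : nat) :
  (forall k, 0 < M k) -> (forall k, M k.+1 * M k.+1 <= M k * M k.+2) ->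
  (forall k x, derivable_pt_lim (h k) x (h k.+1 x)) ->
  (forall k x, Rabs (h k x) <= M k) ->
  (forall k, (k < N)%N -> h k 0 = 0) ->
  forall j q, (q + j)%N = N -> forall x,
  0 <= x <= \big[Rplus/0]_(i < j) (M (q + i)%N / (exp 1 * M (q + i).+1)) ->
  forall k, (k <= q)%N -> Rabs (h k x) <= exp (INR k - INR q) * M k.
Proof.
move=> M0 hM hd hb h0; elim=> [|j IH] q hqN x.
  rewrite big_ord0 => hx k hk; have -> : x = 0 by lra.
  case: (ltngtP k q) => hlt; [|by lia|].
    by rewrite h0 ?Rabs_R0; [apply: Rmult_le_pos; left; [exact: exp_pos|]|lia].
  by rewrite hlt Rminus_diag exp_0 Rmult_1_l.
rewrite big_ord_recl /= addn0.
set X := \big[Rplus/0]_(i < j) _ => hx.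
have eX : X = \big[Rplus/0]_(i < j) (M (q.+1 + i)%N / (exp 1 * M (q.+1 + i).+1)).
  by apply: eq_bigr => i _; rewrite /bump /= !addnA !addn1.
have X0 : 0 <= X.
  apply: rsum_ge0 => i _; apply: Rle_mult_inv_pos; first exact: Rlt_le.
  by apply: Rmult_lt_0_compat; [exact: exp_pos|].
have {}IH := IH q.+1 ltac:(lia).
(* [x0] is the part of [x] covered by the induction hypothesis at [q + 1]; the remaining step [s]
   has length at most [M q / (exp 1 * M q.+1)]. *)
pose x0 := Rmin x X; pose s := x - x0.
have e1 := exp_pos 1; have Mq := M0 q; have Mq1 := M0 q.+1.
have hx0 : 0 <= x0 <= X by rewrite /x0 /Rmin; case: Rle_dec => ?; lra.
have hs : 0 <= s <= M q / (exp 1 * M q.+1).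
  have p : 0 <= M q / (exp 1 * M q.+1).
    by apply: Rle_mult_inv_pos; [lra|apply: Rmult_lt_0_compat].
  by rewrite /s /x0 /Rmin; case: Rle_dec => ?; lra.
pose l := exp 1 * (M q.+1 / M q).
have l0 : 0 < l by apply: Rmult_lt_0_compat => //; apply: Rdiv_lt_0_compat.
(* Descent on the order from [q + 1], where the global bound is available. Since the quotients
   increase, [exp 1 * M k.+1 <= l * M k], so [exp (l * r)] is a common majorant for all orders; at
   the end [l * s <= 1], and the loss is one factor [exp 1]. *)
have claim : forall i k, (k + i)%N = q.+1 -> forall r, 0 <= r ->
    Rabs (h k (x0 + r)) <= exp (INR k - INR q.+1) * M k * exp (l * r).
  elim=> [|i IHi] k hk r r0.
    have -> : k = q.+1 by lia.
    rewrite Rminus_diag exp_0 Rmult_1_l; apply: Rle_trans (hb _ _) _.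
    rewrite -{1}(Rmult_1_r (M q.+1)); apply: Rmult_le_compat_l; first lra.
    by apply: exp_ge1; apply: Rmult_le_pos; lra.
  apply: (@deriv_abs_le (h k) (fun r => h k.+1 (x0 + r))
     (fun r => exp (INR k - INR q.+1) * M k * exp (l * r))
     (fun r => exp (INR k - INR q.+1) * M k * l * exp (l * r))) => //.
  - by move=> r' _; exact: derivable_pt_lim_expZ.
  - move=> r' hr'; apply: Rle_trans (IHi k.+1 _ r' _) _; [lia|lra|].
    apply: Rmult_le_compat_r; first by left; exact: exp_pos.
    rewrite !S_INR; have -> : INR k + 1 - (INR q + 1) = (INR k - (INR q + 1)) + 1 by ring.
    rewrite exp_plus !Rmult_assoc; apply: Rmult_le_compat_l; first by left; exact: exp_pos.
    have -> : M k * l = exp 1 * (M k * (M q.+1 / M q)) by rewrite /l; ring.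
    apply: Rmult_le_compat_l; first lra.
    apply: (Rmult_le_reg_r (M q)) => //.
    have -> : M k * (M q.+1 / M q) * M q = M k * M q.+1 by field; lra.
    by apply: ratio_mono => //; lia.
  - rewrite Rmult_0_r exp_0 Rmult_1_r; apply: IH; last by lia.
    by rewrite -eX.
move=> k hk; have := claim (q.+1 - k)%N k ltac:(lia) s ltac:(lra).
have -> : x0 + s = x by rewrite /s; ring.
move=> h1; apply: Rle_trans h1 _.
have -> : exp (INR k - INR q) * M k = exp (INR k - INR q.+1) * M k * exp 1.
  by rewrite S_INR (_ : INR k - INR q = (INR k - (INR q + 1)) + 1) ?exp_plus; ring.
apply: Rmult_le_compat_l.
  by apply: Rmult_le_pos; [left; exact: exp_pos|exact: Rlt_le].
apply: exp_le; apply: Rle_trans (Rmult_le_compat_l _ _ _ (Rlt_le _ _ l0) hs.2) _.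
by apply: Req_le; rewrite /l; field; lra.
Qed.

(** The difference of order [p] with step [d] is at most [2 ^ p * B] and, by the mean value theorem,
    at least [c * d ^ p]. The induction replaces the whole family by its first difference, which
    uses up one step of the interval. *)
Lemma fin_diff_le p (g : nat -> R -> R) (d c B a : R) : 0 <= d ->
  (forall k x, derivable_pt_lim (g k) x (g k.+1 x)) ->
  (forall x, Rabs (g 0%N x) <= B) ->
  (forall y, a <= y <= a + INR p * d -> c <= g p y) -> c * d ^ p <= 2 ^ p * B.
Proof.
move=> d0; elim: p g c B => [|p IH] g c B hd hB hc.
  have := hc a ltac:(rewrite /=; lra); have := hB a.
  by rewrite /=; split_Rabs; lra.
have -> : c * d ^ p.+1 = (c * d) * d ^ p by rewrite /=; ring.
have -> : 2 ^ p.+1 * B = 2 ^ p * (2 * B) by rewrite /=; ring.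
apply: (IH (fun k x => g k (x + d) - g k x)).
- move=> k x; apply: derivable_pt_lim_minus; last exact: hd.
  have -> : g k.+1 (x + d) = g k.+1 (x + d) * 1 by ring.
  apply: (derivable_pt_lim_comp (fun s => s + d) (g k)); last exact: hd.
  have -> : 1 = 1 + 0 by ring.
  by apply: derivable_pt_lim_plus; [exact: derivable_pt_lim_id|exact: derivable_pt_lim_const].
- by move=> x; have := hB x; have := hB (x + d); split_Rabs; lra.
- move=> y; rewrite S_INR in hc; have pd : 0 <= INR p * d by apply: Rmult_le_pos; [exact: pos_INR|].
  move=> hy; case: (Req_dec d 0) => [->|dn]; first by rewrite Rplus_0_r; lra.
  have [e [he [h1 h2]]] := MVT_cor2 (g p) (g p.+1) y (y + d) ltac:(lra) (fun c _ => hd p c).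
  rewrite he; have -> : y + d - y = d by ring.
  by apply: Rmult_le_compat_r => //; apply: hc; lra.
Qed.

(** [W_p] is [W_0 <= 1] times [p] quotients, none of which exceeds the quotient that follows
    them. *)
Lemma wmat_ratio_pow om rho p : is_weight_function om -> 0 < rho ->
  wmat om rho p <= (wmat om rho p.+1 / wmat om rho p) ^ p.
Proof.
move=> hom r0; pose W := wmat om rho; have W0 k : 0 < W k by exact: exp_pos.
suff h : forall k, (k <= p)%N -> W k <= (W p.+1 / W p) ^ k by exact: h.
have u0 : 0 < W p.+1 / W p by exact: Rdiv_lt_0_compat.
elim=> [|k IH] hk; first exact: wmat0_le1.
rewrite /=; apply: (Rmult_le_reg_r (W p)) => //.
apply: Rle_trans (ratio_mono W0 (fun k => wmat_logconvex hom k r0) (ltnW hk)) _.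
have -> : W p.+1 / W p * (W p.+1 / W p) ^ k * W p = (W p.+1 / W p) ^ k * W p.+1.
  by field; have := W0 p; lra.
by apply: Rmult_le_compat_r; [exact: Rlt_le|apply: IH; lia].
Qed.

Lemma pow_le_reg a b p : 0 <= b -> (0 < p)%N -> a ^ p <= b ^ p -> a <= b.
Proof.
move=> b0 p0 h; apply: Rnot_lt_le => hlt.
have : b ^ p < a ^ p; last lra.
case: p p0 h => // p _ h {h}; elim: p => [|p IH]; first by rewrite /=; lra.
by rewrite expr_eq (expr_eq a); apply: Rmult_le_0_lt_compat => //; apply: pow_le.
Qed.

(** The sum is split at [q0]. The first [q0] terms are at most [/ mu] each and contribute at most
    [p / t]. For the rest, equal to [exp 1 * X], Bang's argument keeps the derivative of order [p]
    above [S / 2] on [[0, X]], and the difference of order [p] gives [X * t <= 2 e p]. Altogether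
    [p + 2 e^2 p <= 19 p]. *)
Lemma tail_bound (om sg : R -> R) (C rho t : R) (p j : nat) (g : nat -> R -> R) :
  is_weight_function om -> is_weight_function sg -> 1 <= C -> 0 < rho -> 1 <= t ->
  sg t + ln (4 * C) + 1 <= INR p ->
  (forall k h, derivable_pt_lim (g k) h (g k.+1 h)) ->
  (forall k h, Rabs (g k h) <= C * wmat om rho k) -> g p 0 = wmat sg 1 p ->
  (forall k, (p < k)%N -> (k <= p + j)%N -> g k 0 = 0) ->
  t * \big[Rplus/0]_(i < j) (wmat om rho (p + i)%N / wmat om rho (p + i).+1) <= 19 * INR p.
Proof.
move=> hom hsg C1 rho0 t1 hp hd hb hgp hg0.
pose W := wmat om rho; pose S := wmat sg 1 p; pose T i := W (p + i)%N / W (p + i).+1.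
rewrite -/(W _) (eq_bigr (fun i : 'I_j => T i)) //.
have W0 k : 0 < W k by exact: exp_pos.
have S0 : 0 < S by exact: exp_pos.
have T0 i : 0 < T i by exact: Rdiv_lt_0_compat.
have rm := ratio_mono W0 (fun k => wmat_logconvex hom k rho0).
have lnC : 0 <= ln (4 * C) by apply: ln_ge0; lra.
have sgt : 0 <= sg t by apply: om_ge0 => //; lra.
have p1 : 1 <= INR p by lra.
have pn : (0 < p)%N by case: (posnP p) p1 => // -> /=; lra.
have hS : t ^ p <= S * exp (sg t).
  by have := wmat_pow_le hsg p Rlt_0_1 t1; rewrite Rdiv_1_r.
have SW : S <= C * W p.
  by have := hb p 0; rewrite hgp Rabs_right //; left.
pose mu := W p.+1 / W p; have mu0 : 0 < mu by exact: Rdiv_lt_0_compat.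
have hW : W p <= mu ^ p by exact: wmat_ratio_pow.
have T1 i : T i <= / mu.
  have -> : / mu = W p / W p.+1 by rewrite /mu; field; have := W0 p; have := W0 p.+1; lra.
  apply: (Rmult_le_reg_r (W (p + i).+1)) => //.
  have -> : T i * W (p + i).+1 = W (p + i)%N by rewrite /T; field; have := W0 (p + i).+1; lra.
  apply: (Rmult_le_reg_r (W p.+1)) => //.
  have -> : W p / W p.+1 * W (p + i).+1 * W p.+1 = W p * W (p + i).+1 by field; have := W0 p.+1; lra.
  by rewrite Rmult_comm; apply: rm; lia.
(* [Y] is such that [q0 >= ln Y] gives [2 * C * W p * exp (- q0) <= S / 2]; the price is that the
   first [q0] quotients are lost to Bang's argument. *)
pose Y := 4 * C * W p / S.
have hY : 4 <= Y.
  apply: (Rmult_le_reg_r S) => //; have -> : Y * S = 4 * (C * W p) by rewrite /Y; field; lra.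
  lra.
have [q0 [q01 q02]] := nat_ceil (ln_ge0 (r := Y) ltac:(lra)).
(* [ln Y] is at most [ln (4 * C) + sg t + p * ln (mu / t)]. The lower bound on [p] absorbs the first
   two summands and the rounding of [q0], and [ln u <= u - 1] leaves [p * mu / t]. *)
have hq0 : INR q0 * t <= INR p * mu.
  have hlS : INR p * ln t - sg t <= ln S.
    have := ln_le_mono (x := t ^ p) ltac:(apply: pow_lt; lra) hS.
    by rewrite ln_mult ?ln_exp ?ln_pow //; [lra|lra|exact: exp_pos].
  have hlW : ln (W p) <= INR p * ln mu.
    by rewrite -ln_pow //; exact: ln_le_mono.
  have lY : ln Y = ln (4 * C) + ln (W p) - ln S.
    have i0 := Rinv_0_lt_compat _ S0.
    have cw : 0 < 4 * C * W p by apply: Rmult_lt_0_compat => //; lra.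
    by rewrite /Y /Rdiv (ln_mult _ _ cw i0) ln_mult ?ln_Rinv //; lra.
  have hu : ln (mu / t) <= mu / t - 1.
    have u0 : 0 < mu / t by apply: Rdiv_lt_0_compat; lra.
    by have := exp_ineq1_le (ln (mu / t)); rewrite exp_ln //; lra.
  have lu : ln (mu / t) = ln mu - ln t.
    by rewrite /Rdiv ln_mult ?ln_Rinv //; [lra|apply: Rinv_0_lt_compat; lra].
  have : INR q0 <= INR p * (mu / t).
    have := Rmult_le_compat_l (INR p) _ _ ltac:(lra) hu; rewrite lu; lra.
  move/(Rmult_le_compat_r t _ _ ltac:(lra)).
  by have -> : INR p * (mu / t) * t = INR p * mu by field; lra.
have headb (m : nat) : (m <= q0)%N -> t * \big[Rplus/0]_(i < m) T i <= INR p.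
  move=> hm; have : \big[Rplus/0]_(i < m) T i <= INR q0 * / mu.
    apply: (Rle_trans _ (\big[Rplus/0]_(i < m) / mu)); first by apply: rsum_le => i _; exact: T1.
    by rewrite rsum_const; apply: Rmult_le_compat_r; [left; exact: Rinv_0_lt_compat|exact: INR_le].
  move/(Rmult_le_compat_l t _ _ ltac:(lra)) => h1; apply: Rle_trans h1 _.
  apply: (Rmult_le_reg_r mu) => //.
  by have -> : t * (INR q0 * / mu) * mu = INR q0 * t by field; lra.
case: (leqP j q0) => hj.
  by apply: Rle_trans (headb j hj) _; lra.
pose X := \big[Rplus/0]_(i < j - q0) (T (q0 + i)%N / exp 1).
have e1 := exp_pos 1.
have X0 : 0 <= X by apply: rsum_ge0 => i _; apply: Rle_mult_inv_pos => //; exact: Rlt_le.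
have eS : \big[Rplus/0]_(i < j) T i = \big[Rplus/0]_(i < q0) T i + exp 1 * X.
  rewrite -(big_mkord xpredT T) (big_cat_nat (n := q0)) ?big_mkord //=; last exact: ltnW.
  congr (_ + _); rewrite /X -rsumZ -{1}(add0n q0) big_addn big_mkord; apply: eq_bigr => i _.
  by rewrite addnC; field; lra.
rewrite eS Rmult_plus_distr_l.
have hX : X * t <= 2 * exp 1 * INR p.
  have gp : forall y, 0 <= y <= 0 + INR p * (X / INR p) -> S / 2 <= g p y.
    have -> : INR p * (X / INR p) = X by field; lra.
    rewrite Rplus_0_l => y hy.
    (* Subtracting the value at 0 makes order 0 vanish there as well, as Bang's argument requires;
       it doubles the bound at that order, hence the majorant [2 * C * W (p + k)]. *)
    pose h k x := if k is 0%N then g p x - S else g (p + k)%N x.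
    have := @bang h (fun k => 2 * C * W (p + k)%N) j _ _ _ _ _ (j - q0)%N q0 _ y _ 0%N.
    rewrite /h Rminus_0_l addn0 => hbang.
    suff : Rabs (g p y - S) <= S / 2 by split_Rabs; lra.
    apply: Rle_trans (hbang _ _ _ _ _ _ _ _) _.
    - by move=> k; have := W0 (p + k)%N; nra.
    - move=> k; rewrite !addnS.
      have -> : 2 * C * W (p + k).+1 * (2 * C * W (p + k).+1) = 4 * C * C * (W (p + k).+1 * W (p + k).+1) by ring.
      have -> : 2 * C * W (p + k)%N * (2 * C * W (p + k).+2) = 4 * C * C * (W (p + k)%N * W (p + k).+2) by ring.
      by apply: Rmult_le_compat_l; [nra|exact: wmat_logconvex].
    - case=> [|k] x; last by rewrite !addnS; exact: hd.
      rewrite -[g _ x]Rminus_0_r addn1; apply: derivable_pt_lim_minus; first exact: hd.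
      exact: derivable_pt_lim_const.
    - case=> [|k] x; last by apply: Rle_trans (hb _ _) _; have := W0 (p + k.+1)%N; rewrite -/(W _); nra.
      by rewrite addn0; have := hb p x; rewrite -/(W _); split_Rabs; lra.
    - by case=> [|k] hk; [rewrite hgp /S; ring|apply: hg0; lia].
    - lia.
    - split; first lra; apply: Rle_trans hy.2 _; apply: Req_le; apply: eq_bigr => i _.
      rewrite /T !addnS !addnA; have := W0 (p + q0 + i)%N; have := W0 (p + q0 + i).+1.
      by move=> *; field; lra.
    - by [].
    - apply: (Rmult_le_reg_l (exp (INR q0))); first exact: exp_pos.
      rewrite -Rmult_assoc -exp_plus Rplus_opp_r exp_0 Rmult_1_l.
      have : Y <= exp (INR q0) by rewrite -(exp_ln Y); [exact: exp_le|lra].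
      move/(Rmult_le_compat_r (S / 2) _ _ ltac:(lra)); apply: Rle_trans.
      by apply: Req_le; rewrite /Y; field; lra.
  have Xp : 0 <= X / INR p by apply: Rle_mult_inv_pos; lra.
  have hfd := fin_diff_le Xp hd (B := C) _ gp.
  have {}hfd : S / 2 * (X / INR p) ^ p <= 2 ^ p * C.
    apply: hfd => x; apply: Rle_trans (hb _ _) _.
    by have := wmat0_le1 hom rho0; have := W0 0%N; rewrite -/(W _); nra.
  (* Here [t ^ p <= S * exp (sg t)] cancels [S], and [2 * C * exp (sg t) <= exp 1 ^ p] by the lower
     bound on [p]. *)
  have : (X * t / (2 * INR p)) ^ p <= (exp 1) ^ p.
    have -> : X * t / (2 * INR p) = (X / INR p) * / 2 * t by field; lra.
    rewrite (Rpow_mult_distr _ t) (Rpow_mult_distr (X / INR p)).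
    apply: Rle_trans (Rmult_le_compat_l _ _ _ _ hS) _.
      by apply: Rmult_le_pos; apply: pow_le; lra.
    have p2 := half_pow_gt0 p.
    have : (/ 2) ^ p * (S / 2 * (X / INR p) ^ p) <= C.
      have := Rmult_le_compat_l _ _ _ (Rlt_le _ _ p2) hfd.
      by rewrite -[X in _ <= X -> _]Rmult_assoc (Rmult_comm _ (2 ^ p)) pow2_half Rmult_1_l.
    move/(Rmult_le_compat_l (2 * exp (sg t)) _ _ ltac:(have := exp_pos (sg t); lra)) => h2.
    have -> : (X / INR p) ^ p * (/ 2) ^ p * (S * exp (sg t)) = 
       2 * exp (sg t) * ((/ 2) ^ p * (S / 2 * (X / INR p) ^ p)) by field; lra.
    apply: Rle_trans h2 _.
    rewrite -exp_INR Rmult_1_r.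
    have -> : 2 * exp (sg t) * C = exp (sg t + ln (2 * C)).
      by rewrite exp_plus exp_ln; lra.
    apply: exp_le; have := ln_le_mono (x := 2 * C) (y := 4 * C) ltac:(lra) ltac:(lra); lra.
  move/(pow_le_reg (Rlt_le _ _ e1) pn).
  move/(Rmult_le_compat_r (2 * INR p) _ _ ltac:(lra)).
  have -> : X * t / (2 * INR p) * (2 * INR p) = X * t by field; lra.
  lra.
have h3 := headb q0 (leqnn _).
have e3 := exp_le_3.
have : exp 1 * (X * t) <= exp 1 * (2 * exp 1 * INR p) by apply: Rmult_le_compat_l; lra.
have : exp 1 * exp 1 * INR p <= 9 * INR p by apply: Rmult_le_compat_r; nra.
lra.
Qed.

(** * From the tail bound to the integral condition *)

Lemma rpow_exp r k a : 1 <= r -> r ^ k * exp (- a) = exp (INR k * ln r - a).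
Proof. by move=> r1; rewrite pow_exp_ln ?exp_plus //; lra. Qed.

Lemma om_exp_ln (om : R -> R) r : 1 <= r -> om r = om (exp (ln r)).
Proof. by move=> r1; rewrite exp_ln //; lra. Qed.

(** Let [p] be the slope of [om (exp s) / rho] on [[L - 1, L]], rounded down. By convexity
    [p * s - om (exp s) / rho] is nearly maximal there, so [W_p] is at most [exp ((p + 1) * L - om
    (exp (L - 1)) / rho)]. Against [S^1_p >= exp (p * L - sg (exp L))] the terms [p * L] cancel, and
    the remaining [L] is absorbed by [sg (exp L)]. *)
Lemma om_le_of_wmat_le (om sg : R -> R) (C rho : R) :
  is_weight_function om -> is_weight_function sg -> 1 <= C -> 0 < rho ->
  (forall p, wmat sg 1 p <= C * wmat om rho p) ->
  exists D, 0 < D /\ forall t, 1 <= t -> om t <= D * (sg t + 1).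
Proof.
move=> hom hsg C1 rho0 hW.
have [C2 [C20 hln]] := om_ln_le hsg Rlt_0_1.
have lnC : 0 <= ln C by apply: ln_ge0.
have main L : 1 <= L -> om (exp (L - 1)) / rho <= 2 * sg (exp L) + (C2 + ln C).
  move=> L1; have eL : 1 <= exp L by apply: exp_ge1; lra.
  pose d := om (exp L) - om (exp (L - 1)).
  have d0 : 0 <= d.
    suff : om (exp (L - 1)) <= om (exp L) by rewrite /d; lra.
    by apply: om_mono => //; [left; exact: exp_pos|apply: exp_le; lra].
  have [p [p1 p2]] := nat_floor (Rle_mult_inv_pos _ _ d0 rho0).
  rewrite -/(Rdiv d rho) in p1 p2.
  have ed : d = d / rho * rho by field; lra.
  have dl : INR p * rho <= d by rewrite ed; apply: Rmult_le_compat_r; lra.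
  have du : d <= (INR p + 1) * rho by rewrite ed; apply: Rmult_le_compat_r; lra.
  have hup : wmat om rho p <= exp ((INR p + 1) * L - om (exp (L - 1)) / rho).
    apply: wmat_le => // r r1; rewrite rpow_exp //; apply: exp_le.
    have s0 := ln_ge0 r1; rewrite (om_exp_ln om r1); set s := ln r in s0 *.
    have p0 := pos_INR p.
    apply: (Rmult_le_reg_r rho) => //.
    have -> : (INR p * s - om (exp s) / rho) * rho = INR p * rho * s - om (exp s) by field; lra.
    have -> : ((INR p + 1) * L - om (exp (L - 1)) / rho) * rho
       = (INR p + 1) * rho * L - om (exp (L - 1)) by field; lra.
    have pr : 0 <= INR p * rho by apply: Rmult_le_pos; lra.
    case: (Rle_dec L s) => h1.
      have := om_convex hom (s1 := L - 1) (s2 := L) (s3 := s) ltac:(lra) h1.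
      have := Rmult_le_compat_r (s - L) _ _ ltac:(lra) dl.
      rewrite /d in d0 *; nra.
    case: (Rle_dec (L - 1) s) => h2.
      have : om (exp (L - 1)) <= om (exp s).
        by apply: om_mono => //; [left; exact: exp_pos|exact: exp_le].
      nra.
    have := om_convex hom (s1 := s) (s2 := L - 1) (s3 := L) ltac:(lra) ltac:(lra).
    have := Rmult_le_compat_r (L - 1 - s) _ _ ltac:(lra) du.
    rewrite /d; nra.
  have h1 := wmat_pow_le hsg p Rlt_0_1 eL; rewrite Rdiv_1_r in h1.
  have h2 := hW p; have h3 := hln _ eL; rewrite ln_exp in h3.
  have : exp (INR p * L) <= exp (ln C + ((INR p + 1) * L - om (exp (L - 1)) / rho) + sg (exp L)).
    rewrite exp_INR; apply: Rle_trans h1 _; rewrite exp_plus exp_plus exp_ln; last lra.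
    apply: Rmult_le_compat_r; first by left; exact: exp_pos.
    by apply: Rle_trans h2 _; apply: Rmult_le_compat_l; lra.
  move=> h4; have : INR p * L <= ln C + ((INR p + 1) * L - om (exp (L - 1)) / rho) + sg (exp L).
    by apply: Rnot_lt_le => /exp_increasing; lra.
  lra.
have [D [D1 hD]] := om_scale hsg (A := exp 1) ltac:(left; exact: exp_pos).
exists (rho * (2 * D + C2 + ln C)); split; first by apply: Rmult_lt_0_compat; lra.
move=> t t1; have := main (ln t + 1) ltac:(have := ln_ge0 t1; lra).
have -> : ln t + 1 - 1 = ln t by ring.
rewrite exp_plus exp_ln ?(Rmult_comm t); last lra.
have h1 := hD t ltac:(lra); have s0 := om_ge0 hsg (t := t) ltac:(lra).
move=> h2; apply: (Rmult_le_reg_r (/ rho)); first exact: Rinv_0_lt_compat.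
have -> : rho * (2 * D + C2 + ln C) * (sg t + 1) * / rho = (2 * D + C2 + ln C) * (sg t + 1) by field; lra.
apply: Rle_trans h2 _; nra.
Qed.

(** Beyond [mu] the convex function [om (exp s)] has slope at least [rho * (k + 1)], the jump over
    the last factor 2 being divided by [ln 2 <= 1]. Hence [r ^ k.+1 * exp (- om r / rho)] no longer
    grows there, and for [r <= mu] one factor [r] is at most [mu]. *)
Lemma wmat_ratio_le (om : R -> R) rho k mu : is_weight_function om -> 0 < rho -> 2 <= mu ->
  rho * INR k.+1 <= om mu - om (mu / 2) -> wmat om rho k.+1 <= mu * wmat om rho k.
Proof.
move=> hom rho0 mu2 hd.
apply: wmat_le => // r r1; case: (Rle_dec r mu) => hr.
  rewrite expr_eq Rmult_assoc; apply: Rmult_le_compat => //; try lra.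
    by apply: Rmult_le_pos; [apply: pow_le; lra|left; exact: exp_pos].
  exact: wmat_ge.
have h1 := wmat_ge hom k rho0 (r := mu) ltac:(lra).
apply: Rle_trans (Rmult_le_compat_l mu _ _ ltac:(lra) h1).
have -> : mu * (mu ^ k * exp (- (om mu / rho))) = mu ^ k.+1 * exp (- (om mu / rho)) by rewrite /=; ring.
rewrite !rpow_exp; try lra.
apply: exp_le.
have s0 : ln mu <= ln r by apply: ln_le_mono; lra.
rewrite (om_exp_ln om r1) (@om_exp_ln om mu) in hd *; try lra.
have e2 : mu / 2 = exp (ln mu - ln 2).
  by rewrite /Rminus exp_plus exp_Ropp !exp_ln; lra.
have l2 : 0 < ln 2 <= 1.
  split; first exact: ln2_gt0.
  by rewrite -(ln_exp 1); apply: ln_le_mono; [lra|have := exp_ineq1_le 1; lra].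
rewrite e2 in hd.
have := om_convex hom (s1 := ln mu - ln 2) (s2 := ln mu) (s3 := ln r) ltac:(lra) s0.
set a := om (exp (ln mu - ln 2)) in hd *; set b := om (exp (ln mu)) in hd *.
set c := om (exp (ln r)) => hc.
have hk : rho * INR k.+1 * (ln r - ln mu) <= c - b.
  apply: (Rmult_le_reg_l (ln 2)); first lra.
  have : rho * INR k.+1 * (ln r - ln mu) <= (b - a) * (ln r - ln mu) by apply: Rmult_le_compat_r; lra.
  have : ln 2 * (rho * INR k.+1 * (ln r - ln mu)) <= 1 * (rho * INR k.+1 * (ln r - ln mu)).
    apply: Rmult_le_compat_r; last lra.
    by apply: Rmult_le_pos; [apply: Rmult_le_pos; [lra|exact: pos_INR]|lra].
  nra.
apply: (Rmult_le_reg_l rho) => //.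
have -> : rho * (INR k.+1 * ln r - c / rho) = rho * INR k.+1 * ln r - c by field; lra.
have -> : rho * (INR k.+1 * ln mu - b / rho) = rho * INR k.+1 * ln mu - b by field; lra.
lra.
Qed.

Lemma geo_sum_le (c : R) I : 0 <= c -> \big[Rplus/0]_(l < I) (c * (/ 2) ^ l) <= 2 * c.
Proof.
elim: I c => [|I IH] c c0; first by rewrite big_ord0; lra.
rewrite big_ord_recl /= Rmult_1_r (eq_bigr (fun l : 'I_I => c / 2 * (/ 2) ^ l)).
  by apply: Rle_trans (Rplus_le_compat_l c _ _ (IH (c / 2) _)) _; lra.
by move=> l _; rewrite add0n; field.
Qed.

(** The first selected term dominates the others as in a geometric series of ratio one half, and it
    is itself at most [v]. *)
Lemma geo_sum_cond_le (c v : R) (b : nat -> bool) I : 0 <= c -> 0 <= v ->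
  (forall l, b l -> c * (/ 2) ^ l <= v) ->
  \big[Rplus/0]_(l < I | b l) (c * (/ 2) ^ l) <= 2 * v.
Proof.
elim: I c b => [|I IH] c b c0 v0 hb; first by rewrite big_ord0; lra.
case hb0 : (b 0%N).
  have := hb 0%N hb0; rewrite /= Rmult_1_r => hcv.
  apply: (Rle_trans _ (2 * c)); last lra.
  apply: Rle_trans (geo_sum_le I.+1 c0); rewrite big_mkcond; apply: rsum_le => l _.
  have : 0 <= c * (/ 2) ^ l by apply: Rmult_le_pos => //; apply: pow_le; lra.
  by case: (b l) => ?; lra.
rewrite big_mkcond big_ord_recl /= hb0 Rplus_0_l -big_mkcond /=.
rewrite (eq_bigr (fun l : 'I_I => c / 2 * (/ 2) ^ l)) => [|l _]; last by rewrite add0n; field.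
apply: (IH (c / 2) (fun l => b l.+1)) => //; first lra.
by move=> l hl; have := hb l.+1 hl; rewrite /=; lra.
Qed.

Definition Rleb (a b : R) : bool := if Rle_dec a b then true else false.
Lemma RlebP a b : reflect (a <= b) (Rleb a b).
Proof. by rewrite /Rleb; case: Rle_dec => h; constructor. Qed.

(** Replaces a real number by a count of integers, so that a weighted sum over levels becomes a
    double sum over levels and orders. *)
Lemma le_count_Rleb x N : x <= INR N -> x <= 1 + \big[Rplus/0]_(k < N | Rleb (INR k.+1) x) 1.
Proof.
elim: N => [|N IH] hx; first by rewrite big_ord0; move: hx; rewrite /=; lra.
case: (Rle_dec x (INR N)) => h1.
  apply: Rle_trans (IH h1) _; apply: Rplus_le_compat_l.
  rewrite big_mkcond [X in _ <= X]big_mkcond big_ord_recr /=.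
  by case: (Rleb _ x); lra.
rewrite big_mkcond (eq_bigr (fun i : 'I_N.+1 => if i == ord_max then (if Rleb (INR N.+1) x then 1 else 0) else 1)).
  rewrite big_ord_recr /= eqxx.
  rewrite (eq_bigr (fun=> 1)) => [|i _]; last by rewrite -val_eqE /= ltn_eqF.
  rewrite rsum_const; move: hx; rewrite -/(INR N.+1) S_INR; case: (Rleb _ x); lra.
move=> i _; case: eqP => [->//|ne].
case: RlebP => // h2; exfalso; apply: h2; apply: Rle_trans (_ : INR N <= x); last lra.
apply: INR_le; have := ltn_ord i; have : (nat_of_ord i <> N) by move=> e; apply: ne; apply: val_inj.
lia.
Qed.

(** A layer-cake argument. After summation by parts each increment [d l] is counted by the orders
    [k] with [rho * (k + 1) <= d l]. For such [l] the quotient [W_k / W_(k+1)] is at least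
    [/ (2 ^ l.+1 * t)], so the order [k] contributes at most twice [t * W_k / W_(k+1)]. Orders below
    [p] contribute at most 1 each; the others are summed by the tail bound. *)
Lemma dyadic_sum_le (om sg : R -> R) (rho D t : R) (p I : nat) :
  is_weight_function om -> is_weight_function sg -> 0 < rho -> 1 <= t -> 0 < D ->
  om t <= D * (sg t + 1) -> 
  (forall j, t * \big[Rplus/0]_(i < j) (wmat om rho (p + i)%N / wmat om rho (p + i).+1) <= 19 * INR p) ->
  \big[Rplus/0]_(l < I) (/ 2 * (/ 2) ^ l * om (2 ^ l.+1 * t)) <= D * (sg t + 1) + rho * (2 + 80 * INR p).
Proof.
move=> hom hsg rho0 t1 D0 hD htail.
have W0 k : 0 < wmat om rho k by exact: exp_pos.
have pw := pow2_ge1.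
pose d l := om (2 ^ l.+1 * t) - om (2 ^ l * t).
have d0 l : 0 <= d l.
  have h : om (2 ^ l * t) <= om (2 ^ l.+1 * t).
    by apply: om_mono => //; have := pw l; rewrite /=; nra.
  by rewrite /d; lra.
pose A := \big[Rplus/0]_(l < I) (/ 2 * (/ 2) ^ l * om (2 ^ l.+1 * t)).
have hp := half_pow_gt0.
(* [A] is the weighted sum of the increments plus half of a shifted sum that is at most [om t + A];
   solving for [A] gives the factor 2. *)
have hA : A <= om t + 2 * \big[Rplus/0]_(l < I) (/ 2 * (/ 2) ^ l * d l).
  have e1 : A = \big[Rplus/0]_(l < I) (/ 2 * (/ 2) ^ l * d l)
     + / 2 * \big[Rplus/0]_(l < I) ((/ 2) ^ l * om (2 ^ l * t)).
    by rewrite -rsumZ -big_split; apply: eq_bigr => l _; rewrite /d /=; ring.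
  have e2 : \big[Rplus/0]_(l < I) ((/ 2) ^ l * om (2 ^ l * t)) <= om t + A.
    have -> : om t + A = \big[Rplus/0]_(l < I.+1) ((/ 2) ^ l * om (2 ^ l * t)).
      by rewrite big_ord_recl /= !Rmult_1_l.
    rewrite big_ord_recr /=.
    have h1 : 0 <= om (2 ^ I * t) by apply: om_ge0 => //; have := pw I; nra.
    by have := Rmult_le_pos _ _ (Rlt_le _ _ (hp I)) h1; lra.
  lra.
rewrite -/A; apply: Rle_trans hA _.
suff : \big[Rplus/0]_(l < I) (/ 2 * (/ 2) ^ l * d l) <= rho * (1 + 40 * INR p) by lra.
have [N0 hN0] : exists N, forall l, (l < I)%N -> d l / rho <= INR N.
  elim: (I) => [|J [N hN]]; first by exists 0%N.
  have [N' hN'] := archimed_nat (d J / rho); exists (maxn N N') => l hl.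
  case: (ltngtP l J) => h1; last 1 first.
  - by rewrite h1; apply: Rle_trans hN' _; apply: INR_le; lia.
  - by apply: Rle_trans (hN l h1) _; apply: INR_le; lia.
  - by lia.
pose N := (p + N0)%N.
have hN l : (l < I)%N -> d l / rho <= INR N.
  by move=> hl; apply: Rle_trans (hN0 l hl) _; apply: INR_le; rewrite /N; lia.
pose b k l := Rleb (INR k.+1) (d l / rho).
have step1 : \big[Rplus/0]_(l < I) (/ 2 * (/ 2) ^ l * d l) <=
  rho * \big[Rplus/0]_(l < I) (/ 2 * (/ 2) ^ l + \big[Rplus/0]_(k < N | b k l) (/ 2 * (/ 2) ^ l)).
  rewrite -rsumZ; apply: rsum_le => l _.
  have := le_count_Rleb (hN l (ltn_ord l)); rewrite -/(b _ _) => h.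
  have hl : 0 < / 2 * (/ 2) ^ l by have := hp l; lra.
  have -> : \big[Rplus/0]_(k < N | b k l) (/ 2 * (/ 2) ^ l) =
     / 2 * (/ 2) ^ l * \big[Rplus/0]_(k < N | b k l) 1.
    by rewrite -rsumZ; apply: eq_bigr => k _; ring.
  have -> : / 2 * (/ 2) ^ l * d l = rho * (/ 2 * (/ 2) ^ l * (d l / rho)) by field; lra.
  apply: Rmult_le_compat_l; first lra.
  have := Rmult_le_compat_l _ _ _ (Rlt_le _ _ hl) h.
  by rewrite Rmult_plus_distr_l Rmult_1_r.
apply: Rle_trans step1 _; apply: Rmult_le_compat_l; first lra.
rewrite big_split /=; apply: Rplus_le_compat.
  by apply: Rle_trans (geo_sum_le I (c := / 2) _) _; lra.
rewrite (exchange_big_dep xpredT) //=.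
pose f (k : nat) := \big[Rplus/0]_(l < I | b k l) (/ 2 * (/ 2) ^ l).
rewrite -(big_mkord xpredT f) (big_cat_nat (n := p)) //=; last by rewrite /N; lia.
have f1 k : f k <= 1.
  apply: Rle_trans (_ : \big[Rplus/0]_(l < I) (/ 2 * (/ 2) ^ l) <= 1).
    rewrite /f big_mkcond; apply: rsum_le => l _.
    by have := hp l; case: (b k l); lra.
  by apply: Rle_trans (geo_sum_le I (c := / 2) _) _; lra.
have h1 : \big[Rplus/0]_(0 <= k < p) f k <= INR p.
  rewrite big_mkord; apply: (Rle_trans _ (\big[Rplus/0]_(k < p) 1)); first by apply: rsum_le.
  by rewrite rsum_const; lra.
have f2 k : f k <= 2 * (t * (wmat om rho k / wmat om rho k.+1)).
  apply: geo_sum_cond_le; [lra| |].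
    by apply: Rmult_le_pos; [lra|left; exact: Rdiv_lt_0_compat].
  move=> l /RlebP hl; have hm := pw l.
  have := @wmat_ratio_le om rho k (2 ^ l.+1 * t) hom rho0 ltac:(rewrite /=; nra).
  have -> : 2 ^ l.+1 * t / 2 = 2 ^ l * t by rewrite /=; field.
  move=> h; have {}h : wmat om rho k.+1 <= 2 ^ l.+1 * t * wmat om rho k.
    apply: h; rewrite -/(d l); have -> : d l = rho * (d l / rho) by field; lra.
    by apply: Rmult_le_compat_l; lra.
  have i2 : (/ 2 * (/ 2) ^ l) * 2 ^ l.+1 = 1.
    by rewrite -(expr_eq (/ 2)) -Rpow_mult_distr Rinv_l ?pow1; lra.
  apply: (Rmult_le_reg_r (wmat om rho k.+1)) => //.
  have -> : t * (wmat om rho k / wmat om rho k.+1) * wmat om rho k.+1 = t * wmat om rho k.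
    by field; have := W0 k.+1; lra.
  have hl0 : 0 <= / 2 * (/ 2) ^ l by have := hp l; lra.
  have := Rmult_le_compat_l _ _ _ hl0 h.
  have -> : / 2 * (/ 2) ^ l * (2 ^ l.+1 * t * wmat om rho k) =
     (/ 2 * (/ 2) ^ l * 2 ^ l.+1) * (t * wmat om rho k) by ring.
  by rewrite i2 Rmult_1_l.
have h2 : \big[Rplus/0]_(p <= k < N) f k <= 38 * INR p.
  rewrite -{1}(add0n p) big_addn big_mkord.
  apply: (Rle_trans _ (2 * (t * \big[Rplus/0]_(i < N - p) (wmat om rho (p + i)%N / wmat om rho (p + i).+1)))).
    by rewrite -!rsumZ; apply: rsum_le => i _; rewrite addnC; exact: f2.
  have := htail (N - p)%N; lra.
have := pos_INR p; lra.
Qed.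

Lemma weight_continuous (om : R -> R) t : is_weight_function om -> 0 < t -> continuous om t.
Proof.
move=> [hc _] t0; apply/continuity_pt_filterlim => eps e0.
have [delta [d0 hd]] := hc t (Rlt_le _ _ t0) eps e0.
exists (Rmin delta t); split; first by apply: Rmin_case.
move=> s [_ hs]; apply: hd; move: hs; rewrite /= /R_dist;
  have := Rmin_l delta t; have := Rmin_r delta t; split_Rabs; lra.
Qed.

Lemma weight_quot_continuous (om : R -> R) t u : is_weight_function om -> 0 < t -> 0 < u ->
  continuous (fun u => om (t * u) / u ^ 2) u.
Proof.
move=> hom t0 u0; apply: continuous_mult.
  apply: continuous_comp.
    by apply: (continuous_scal_r t (fun u : R => u)); exact: continuous_id.
  by apply: weight_continuous => //; exact: Rmult_lt_0_compat.
apply: continuous_comp; last by apply: continuous_Rinv; have := pow_lt u 2 u0; lra.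
apply: (ex_derive_continuous (fun u : R => u ^ 2)); by auto_derive.
Qed.

Lemma weight_quot_ex_RInt (om : R -> R) t a b : is_weight_function om -> 0 < t -> 0 < a -> 0 < b ->
  ex_RInt (fun u => om (t * u) / u ^ 2) a b.
Proof.
move=> hom t0 a0 b0; apply: (ex_RInt_continuous (V := R_CompleteNormedModule)) => u hu.
apply: weight_quot_continuous => //; have : 0 < Rmin a b by apply: Rmin_case.
lra.
Qed.

Lemma weight_quot_RInt_le (om : R -> R) t I : is_weight_function om -> 0 < t ->
  RInt (fun u => om (t * u) / u ^ 2) 1 (2 ^ I) <=
  2 * \big[Rplus/0]_(l < I) (/ 2 * (/ 2) ^ l * om (2 ^ l.+1 * t)).
Proof.
move=> hom t0; elim: I => [|I IH]; first by rewrite big_ord0 RInt_point /zero /=; lra.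
have pw : 0 < 2 ^ I by apply: pow_lt; lra.
rewrite big_ord_recr /= -(RInt_Chasles _ 1 (2 ^ I)); try (apply: weight_quot_ex_RInt => //; lra).
rewrite Rmult_plus_distr_l; apply: Rplus_le_compat => //.
apply: Rle_trans (RInt_le _ (fun=> om (2 * 2 ^ I * t) * (/ 2) ^ I * (/ 2) ^ I) _ _ _ _ _ _) _.
- lra.
- by apply: weight_quot_ex_RInt => //; lra.
- exact: ex_RInt_const.
- move=> u hu; rewrite Rmult_assoc; apply: Rmult_le_compat.
  + by apply: om_ge0 => //; nra.
  + by left; apply: Rinv_0_lt_compat; nra.
  + by apply: om_mono => //; nra.
  + rewrite -Rpow_mult_distr -Rinv_mult pow_inv; apply: Rinv_le_contravar.
      by apply: pow_lt; lra.
    by rewrite Rpow_mult_distr /=; nra.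
rewrite RInt_const /scal /= /mult /=.
apply: Req_le.
have -> : (2 * 2 ^ I - 2 ^ I) * (om (2 * 2 ^ I * t) * (/ 2) ^ I * (/ 2) ^ I) =
  (2 ^ I * (/ 2) ^ I) * (om (2 * 2 ^ I * t) * (/ 2) ^ I) by ring.
by rewrite pow2_half; field.
Qed.

Lemma INR_le_pow2 k : INR k <= 2 ^ k.
Proof.
elim: k => [|k IH]; first by rewrite /=; lra.
have h1 : 1 <= 2 ^ k by apply: pow_R1_Rle; lra.
by rewrite S_INR /=; lra.
Qed.

Lemma extension_necessity n (om sg : R -> R) : (1 <= n)%N ->
  is_weight_function om -> is_weight_function sg ->
  (forall E : pt n -> Prop, compact_Rn E -> jet_surjective om sg E) ->
  exists C, 0 < C /\ forall t, 0 < t ->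
      improper_int_1_le (fun u => om (t * u) / (u ^ 2)) (C * sg t + C).
Proof.
move=> n1 hom hsg hE.
have [C0 [rho [C00 [rho0 hU]]]] := borel_extension_uniform n1 hom hE.
pose C := C0 + 1.
have C1 : 1 <= C by rewrite /C; lra.
have W0 k : 0 < wmat om rho k by exact: exp_pos.
have hSW p : wmat sg 1 p <= C * wmat om rho p.
  have [g [_ [hb [<- _]]]] := hU p 0%N.
  by have := hb p 0; have := W0 p; rewrite /C; split_Rabs; nra.
have [D [D0 hD]] := om_le_of_wmat_le hom hsg C1 rho0 hSW.
have lnC : 0 <= ln (4 * C) by apply: ln_ge0; lra.
pose B := 2 * (D + rho * (2 + 80 * (ln (4 * C) + 2))).
have B0 : 0 < B.
  suff : 0 <= rho * (2 + 80 * (ln (4 * C) + 2)) by rewrite /B; lra.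
  by apply: Rmult_le_pos; lra.
have main t T : 1 <= t -> 1 <= T -> RInt (fun u => om (t * u) / u ^ 2) 1 T <= B * (sg t + 1).
  move=> t1 T1; have [I hI] := archimed_nat T.
  have {}hI : T <= 2 ^ I by have := INR_le_pow2 I; lra.
  have s0 : 0 <= sg t by apply: om_ge0 => //; lra.
  have [p [p1 p2]] := nat_ceil (x := sg t + ln (4 * C) + 1) ltac:(lra).
  have htail j : t * \big[Rplus/0]_(i < j) (wmat om rho (p + i)%N / wmat om rho (p + i).+1) <= 19 * INR p.
    have [g [h1 [h2 [h3 h4]]]] := hU p (p + j)%N.
    apply: (tail_bound hom hsg C1 rho0 t1 p1 h1 _ h3 h4) => k h.
    by apply: Rle_trans (h2 k h) _; have := W0 k; rewrite /C; nra.
  have h1 := dyadic_sum_le I hom hsg rho0 t1 D0 (hD t t1) htail.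
  have h2 := weight_quot_RInt_le I hom (t := t) ltac:(lra).
  apply: (Rle_trans _ (RInt (fun u => om (t * u) / u ^ 2) 1 (2 ^ I))).
    have := RInt_Chasles (fun u => om (t * u) / u ^ 2) 1 T (2 ^ I) _ _.
    move=> <-; try (apply: weight_quot_ex_RInt => //; lra).
    rewrite /plus /=.
    rewrite -[X in X <= _]Rplus_0_r; apply: Rplus_le_compat_l.
    apply: RInt_ge_0 => //; first by apply: weight_quot_ex_RInt => //; lra.
    move=> u hu; apply: Rle_mult_inv_pos; last by nra.
    by apply: om_ge0 => //; nra.
  apply: Rle_trans h2 _; apply: Rle_trans (Rmult_le_compat_l 2 _ _ ltac:(lra) h1) _.
  have : rho * (2 + 80 * INR p) <= rho * (2 + 80 * (ln (4 * C) + 2)) * (sg t + 1).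
    rewrite Rmult_assoc; apply: Rmult_le_compat_l; first lra.
    have : 0 <= (ln (4 * C) + 2) * sg t by apply: Rmult_le_pos; lra.
    have : 1 * sg t <= (ln (4 * C) + 2) * sg t by apply: Rmult_le_compat_r; lra.
    lra.
  by rewrite /B; lra.
have s1 := om_ge0 hsg (t := 1) ltac:(lra).
(* The factor [sg 1 + 1] covers [t < 1], where the integral is compared with the one at [t = 1]. *)
exists (B * (sg 1 + 1)); split; first by apply: Rmult_lt_0_compat; lra.
have BB : B <= B * (sg 1 + 1) by nra.
move=> t t0 T T1.
have ex := weight_quot_ex_RInt hom t0 Rlt_0_1 (b := T) ltac:(lra).
exists (ex_RInt_Reals_0 _ _ _ ex); rewrite -RInt_Reals.
have st := om_ge0 hsg (Rlt_le _ _ t0).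
have BBt : B * sg t <= B * (sg 1 + 1) * sg t by apply: Rmult_le_compat_r.
case: (Rle_dec 1 t) => ht.
  by apply: Rle_trans (main t T ht T1) _; lra.
apply: (Rle_trans _ (RInt (fun u => om (1 * u) / u ^ 2) 1 T)).
  apply: RInt_le => //; first by apply: weight_quot_ex_RInt => //; lra.
  move=> u hu; apply: Rmult_le_compat_r; first by left; apply: Rinv_0_lt_compat; apply: pow_lt; lra.
  by apply: om_mono => //; nra.
have := main 1 T ltac:(lra) T1.
have : 0 <= B * (sg 1 + 1) * sg t by apply: Rmult_le_pos => //; nra.
lra.
Qed.

(** * Smooth step functions *)

Definition clamp (x : R) : R := Rmax 0 (Rmin 1 x).

(** The mean of [g] over [[x - a, x]], written with primitives based at 0 so that its derivative is
    visibly a difference quotient of [g]. *)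
Definition avg (a : R) (g : R -> R) (x : R) : R := / a * (RInt g 0 x - RInt g 0 (x - a)).

(** The widths are [a k, ..., a (k + m - 1)], the first one outermost, so that the limits [U k] over
    [m] satisfy [U k = avg (a k) (U k.+1)]. *)
Fixpoint iter_avg (a : nat -> R) (g : R -> R) (m k : nat) : R -> R :=
  if m is m'.+1 then avg (a k) (iter_avg a g m' k.+1) else g.

(** As the derivative of a mean is a difference quotient, the derivative of order [k] of the limit
    [U 0] is [iter_diff a k (U k)]. *)
Fixpoint iter_diff (a : nat -> R) (k : nat) (g : R -> R) : R -> R :=
  if k is k'.+1 then iter_diff a k' (fun y => / a k' * (g y - g (y - a k'))) else g.

Lemma derivable_RInt (g : R -> R) x : (forall y, continuous g y) ->
  derivable_pt_lim (fun x => RInt g 0 x) x (g x).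
Proof.
move=> hc; apply/is_derive_Reals; apply: (is_derive_RInt g _ 0) => //.
apply: filter_forall => y; apply: RInt_correct.
by apply: (ex_RInt_continuous (V := R_CompleteNormedModule)).
Qed.

Lemma derivable_shift (g : R -> R) c x l : derivable_pt_lim g (x + c) l ->
  derivable_pt_lim (fun x => g (x + c)) x l.
Proof.
move=> h; have -> : l = l * 1 by ring.
apply: (derivable_pt_lim_comp (fun s => s + c) g) => //.
have -> : 1 = 1 + 0 by ring.
by apply: derivable_pt_lim_plus; [exact: derivable_pt_lim_id|exact: derivable_pt_lim_const].
Qed.

Lemma derivable_avg a (g : R -> R) x : (forall y, continuous g y) ->
  derivable_pt_lim (avg a g) x (/ a * (g x - g (x - a))).
Proof.
move=> hc; apply: derivable_pt_lim_scal; apply: derivable_pt_lim_minus.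
  exact: derivable_RInt.
exact: (derivable_shift (c := - a) (derivable_RInt _ hc)).
Qed.

(** The mean value theorem for the difference of the two primitives; hence averaging does not
    increase uniform distances. *)
Lemma avg_mean a (g h : R -> R) x : 0 < a -> (forall y, continuous g y) -> (forall y, continuous h y) ->
  exists c, x - a <= c <= x /\ avg a g x - avg a h x = g c - h c.
Proof.
move=> a0 hg hh.
have [c [e hc]] := MVT_cor2 (fun x => RInt g 0 x - RInt h 0 x) (fun x => g x - h x) (x - a) x ltac:(lra)
  (fun c _ => derivable_pt_lim_minus _ _ _ _ _ (derivable_RInt c hg) (derivable_RInt c hh)).
exists c; split; first lra.
rewrite /avg -Rmult_minus_distr_l; apply: (Rmult_eq_reg_l a); last lra.
rewrite -Rmult_assoc Rinv_r; last lra.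
have : (g c - h c) * (x - (x - a)) = a * (g c - h c) by ring.
lra.
Qed.

Lemma avg_value a (g : R -> R) x : 0 < a -> (forall y, continuous g y) ->
  exists c, x - a <= c <= x /\ avg a g x = g c.
Proof.
move=> a0 hg; have [c [hc e]] := @avg_mean a g (fun=> 0) x a0 hg (fun y => continuous_const 0 y).
exists c; split=> //; move: e; rewrite /avg !RInt_const /scal /= /mult /=; lra.
Qed.

Lemma avg_shift a (g : R -> R) x y : 0 < a -> (forall y, continuous g y) ->
  exists c, avg a g x - avg a g y = g (c + (x - y)) - g c.
Proof.
move=> a0 hg.
have [c [e hc]] := MVT_cor2 (fun s => RInt g 0 (s + (x - y)) - RInt g 0 s)
  (fun s => g (s + (x - y)) - g s) (y - a) y ltac:(lra)
  (fun c _ => derivable_pt_lim_minus _ _ _ _ _ (derivable_shift (derivable_RInt _ hg)) (derivable_RInt c hg)).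
exists c; move: e.
have -> : y + (x - y) = x by ring.
have -> : y - a + (x - y) = x - a by ring.
move=> e; rewrite /avg; apply: (Rmult_eq_reg_l a); last lra.
have -> : a * (/ a * (RInt g 0 x - RInt g 0 (x - a)) - / a * (RInt g 0 y - RInt g 0 (y - a))) =
  (RInt g 0 x - RInt g 0 (x - a)) - (RInt g 0 y - RInt g 0 (y - a)) by field; lra.
have : (g (c + (x - y)) - g c) * (y - (y - a)) = a * (g (c + (x - y)) - g c) by ring.
lra.
Qed.

Lemma lipschitz_continuous (g : R -> R) L x : (forall x y, Rabs (g x - g y) <= L * Rabs (x - y)) ->
  continuous g x.
Proof.
move=> h; have L0 : 0 <= L by have := h 1 0; have := Rabs_pos (g 1 - g 0); rewrite Rminus_0_r Rabs_R1; lra.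
apply/continuity_pt_filterlim => eps e0; exists (eps / (L + 1)); split.
  by apply: Rdiv_lt_0_compat; lra.
move=> y [_ hy]; rewrite /= /R_dist in hy *; apply: Rle_lt_trans (h y x) _.
have : (L + 1) * Rabs (y - x) < eps.
  apply: (Rmult_lt_reg_r (/ (L + 1))); first by apply: Rinv_0_lt_compat; lra.
  have -> : (L + 1) * Rabs (y - x) * / (L + 1) = Rabs (y - x) by field; lra.
  by [].
by have := Rabs_pos (y - x); lra.
Qed.

Lemma clamp_lip x y : Rabs (clamp x - clamp y) <= Rabs (x - y).
Proof.
rewrite /clamp /Rmin; case: (Rle_dec 1 x) => ?; case: (Rle_dec 1 y) => ?; rewrite /Rmax;
  do ! case: Rle_dec => ? /=; split_Rabs; lra.
Qed.

Lemma clamp_range x : 0 <= clamp x <= 1.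
Proof.
by rewrite /clamp /Rmin; case: (Rle_dec 1 x) => ?; rewrite /Rmax; case: Rle_dec => ?; lra.
Qed.

Lemma clamp_left x : x <= 0 -> clamp x = 0.
Proof.
by move=> ?; rewrite /clamp /Rmin; case: (Rle_dec 1 x) => ?; rewrite /Rmax; case: Rle_dec => ?; lra.
Qed.

Lemma clamp_right x : 1 <= x -> clamp x = 1.
Proof.
by move=> ?; rewrite /clamp /Rmin; case: (Rle_dec 1 x) => ?; rewrite /Rmax; case: Rle_dec => ?; lra.
Qed.

Section Step.
Variables (delta : R) (a : nat -> R).
Hypotheses (d0 : 0 < delta) (a0 : forall i, 0 < a i)
  (ha : forall m, \big[Rplus/0]_(i < m) a i <= delta).

Let A m := \big[Rplus/0]_(i < m) a i.
Let V := iter_avg a (fun x => clamp (x / delta)).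

Let VS m k x : V m.+1 k x = avg (a k) (V m k.+1) x. Proof. by []. Qed.

Let lipV m k : forall x y, Rabs (V m k x - V m k y) <= / delta * Rabs (x - y).
Proof.
elim: m k => [|m IH] k x y.
  apply: Rle_trans (clamp_lip _ _) _.
  rewrite -Rmult_minus_distr_r Rabs_mult Rmult_comm (Rabs_right (/ delta)); first lra.
  by left; exact: Rinv_0_lt_compat.
have hc z : continuous (V m k.+1) z by apply: lipschitz_continuous; exact: IH.
rewrite !VS; have [c ->] := avg_shift x y (a0 k) hc.
by apply: Rle_trans (IH _ _ _) _; apply: Req_le; congr (_ * Rabs _); ring.
Qed.

Let contV m k z : continuous (V m k) z.
Proof. by apply: lipschitz_continuous; exact: lipV. Qed.

Let rangeV m k x : 0 <= V m k x <= 1.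
Proof.
elim: m k x => [|m IH] k x; first exact: clamp_range.
by rewrite VS; have [c [_ ->]] := avg_value x (a0 k) (@contV m k.+1).
Qed.

Let V_left m k x : x <= 0 -> V m k x = 0.
Proof.
elim: m k x => [|m IH] k x hx.
  have : x / delta <= 0.
    apply: (Rmult_le_reg_r delta) => //.
    have -> : x / delta * delta = x by field; lra.
    lra.
  exact: clamp_left.
by rewrite VS; have [c [hc ->]] := avg_value x (a0 k) (@contV m k.+1); apply: IH; lra.
Qed.

Let V_right m k x : delta + (A (k + m) - A k) <= x -> V m k x = 1.
Proof.
elim: m k x => [|m IH] k x.
  rewrite addn0 Rminus_diag Rplus_0_r => hx /=.
  have : 1 <= x / delta.
    apply: (Rmult_le_reg_r delta) => //.
    have -> : x / delta * delta = x by field; lra.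
    lra.
  exact: clamp_right.
move=> hx; rewrite VS; have [c [hc ->]] := avg_value x (a0 k) (@contV m k.+1); apply: IH.
have e : A k.+1 = A k + a k by rewrite /A big_ord_recr.
by rewrite addSnnS; lra.
Qed.

(** The additional averaging acts innermost, on the ramp, whose Lipschitz constant is [/ delta]; the
    outer averages do not increase the change. *)
Let V_step m k x : Rabs (V m.+1 k x - V m k x) <= / delta * a (k + m)%N.
Proof.
have id := Rinv_0_lt_compat _ d0.
elim: m k x => [|m IH] k x.
  rewrite VS addn0; have [c [hc ->]] := avg_value x (a0 k) (@contV 0 k).
  apply: Rle_trans (@lipV 0%N k c x) _; apply: Rmult_le_compat_l; first lra.
  by split_Rabs; lra.
have [c [hc e]] := avg_mean x (a0 k) (@contV m.+1 k.+1) (@contV m k.+1).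
have -> : V m.+2 k x - V m.+1 k x = V m.+1 k.+1 c - V m k.+1 c by exact: e.
by apply: Rle_trans (IH _ _) _; rewrite addSnnS; lra.
Qed.

Let A_mono m m' : (m <= m')%N -> A m <= A m'.
Proof.
apply: nat_nondecreasing => {}m; have := a0 m.
by rewrite /A big_ord_recr /=; lra.
Qed.

Let V_diff m m' k x : (m <= m')%N -> Rabs (V m' k x - V m k x) <= / delta * (A (k + m') - A (k + m)).
Proof.
elim: m' => [|m' IH] h.
  have -> : m = 0%N by lia.
  by rewrite !Rminus_diag Rabs_R0; lra.
case: (ltngtP m m'.+1) => h1; [|by lia|by rewrite h1 !Rminus_diag Rabs_R0; lra].
have e : A (k + m'.+1) = A (k + m') + a (k + m')%N by rewrite addnS /A big_ord_recr.
have := IH ltac:(lia); have := V_step m' k x; rewrite e.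
by split_Rabs; lra.
Qed.

Let A_lim : exists L, (forall m, A m <= L) /\ forall eps, 0 < eps -> exists N, forall m, (N <= m)%N -> L - A m < eps.
Proof.
have hb : bound (fun y => exists m, y = A m) by exists delta => y [m ->]; exact: ha.
have [L [h1 h2]] := completeness _ hb (ex_intro _ (A 0) (ex_intro _ 0%N erefl)).
exists L; split; first by move=> m; apply: h1; exists m.
move=> eps e0; apply: NNPP => hn.
have : L <= L - eps; last lra.
apply: h2 => y [m ->]; apply: Rnot_lt_le => hm; apply: hn; exists m => m' hm'.
by have := A_mono hm'; lra.
Qed.

Let U_ex : exists (U : nat -> R -> R) (r : nat -> nat -> R), 
  (forall k m x, Rabs (U k x - V m k x) <= r k m) /\
  forall k eps, 0 < eps -> exists N, forall m, (N <= m)%N -> r k m < eps.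
Proof.
have [L [hL1 hL2]] := A_lim; have id := Rinv_0_lt_compat _ d0.
have hr k eps : 0 < eps -> exists N, forall m, (N <= m)%N -> / delta * (L - A (k + m)) < eps.
  move=> e0; have [N hN] := hL2 (delta * eps) (Rmult_lt_0_compat _ _ d0 e0); exists N => m hm.
  have := hN (k + m)%N ltac:(lia) => /(Rmult_lt_compat_l _ _ _ id).
  by rewrite -Rmult_assoc Rinv_l ?Rmult_1_l; lra.
have conv k x : exists l, forall m, Rabs (l - V m k x) <= / delta * (L - A (k + m)).
  apply: cauchy_rate_limit; last exact: hr.
  move=> m m' h; apply: Rle_trans (V_diff k x h) _.
  by apply: Rmult_le_compat_l; [lra|have := hL1 (k + m')%N; lra].
exists (fun k x => proj1_sig (constructive_indefinite_description _ (conv k x))).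
exists (fun k m => / delta * (L - A (k + m))); split => // k m x.
by case: constructive_indefinite_description.
Qed.

Lemma iter_diff_derivable k (g g' : R -> R) : (forall y, derivable_pt_lim g y (g' y)) ->
  forall y, derivable_pt_lim (iter_diff a k g) y (iter_diff a k g' y).
Proof.
elim: k g g' => [|k IH] g g' hg //=; apply: IH => y.
apply: derivable_pt_lim_scal; apply: derivable_pt_lim_minus => //.
exact: (derivable_shift (c := - a k)).
Qed.

Lemma iter_diff_bound k (g : R -> R) c : (forall y, Rabs (g y) <= c) ->
  forall y, Rabs (iter_diff a k g y) <= \big[Rmult/1]_(i < k) (2 / a i) * c.
Proof.
elim: k g c => [|k IH] g c hg y /=; first by rewrite big_ord0 Rmult_1_l.
rewrite big_ord_recr /= Rmult_assoc; apply: IH => z.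
have ik := Rinv_0_lt_compat _ (a0 k).
rewrite Rabs_mult Rabs_right; last lra.
have -> : 2 / a k * c = / a k * (c + c) by rewrite /Rdiv; ring.
apply: Rmult_le_compat_l; first lra.
by have := hg z; have := hg (z - a k); split_Rabs; lra.
Qed.

(* The function is an infinite convolution of the indicators of [0, a i], scaled to mass 1,
   with a ramp of width [delta]. *)
Lemma smooth_step : exists s : nat -> R -> R,
  (forall k y, derivable_pt_lim (s k) y (s k.+1 y)) /\
  (forall y, y <= 0 -> s 0%N y = 0) /\ (forall y, 2 * delta <= y -> s 0%N y = 1) /\
  forall k y, Rabs (s k y) <= \big[Rmult/1]_(i < k) (2 / a i).
Proof.
have [U [r [hU hr]]] := U_ex; have id := Rinv_0_lt_compat _ d0.
have close k x l : (forall m, Rabs (l - V m k x) <= r k m) -> U k x = l.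
  move=> h; apply: cond_eq => eps e0; have [N hN] := hr k (eps / 2) ltac:(lra).
  by have := h N; have := hU k N x; have := hN N (leqnn _); split_Rabs; lra.
have lipU k x y : Rabs (U k x - U k y) <= / delta * Rabs (x - y).
  apply: le_epsilon => eps e0; have [N hN] := hr k (eps / 2) ltac:(lra).
  have := lipV N k x y; have := hU k N x; have := hU k N y; have := hN N (leqnn _).
  by split_Rabs; lra.
have contU k z : continuous (U k) z by apply: lipschitz_continuous; exact: lipU.
have limU k x l : (forall m, V m k x = l) -> U k x = l.
  by move=> h; apply: close => m; rewrite h Rminus_diag Rabs_R0; apply: Rle_trans (hU k m x); exact: Rabs_pos.
have rangeU k x : Rabs (U k x) <= 1.
  apply: le_epsilon => eps e0; have [N hN] := hr k eps e0.
  by have := rangeV N k x; have := hU k N x; have := hN N (leqnn _); split_Rabs; lra.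
have avgU k x : U k x = avg (a k) (U k.+1) x.
  apply: cond_eq => eps e0.
  have [N hN] := hr k (eps / 2) ltac:(lra); have [N' hN'] := hr k.+1 (eps / 2) ltac:(lra).
  have [c [hc e]] := avg_mean x (a0 k) (@contV (N + N') k.+1) (@contU k.+1).
  have h1 := hU k (N + N').+1 x; have h2 := hN (N + N').+1 ltac:(lia).
  have h3 := hU k.+1 (N + N')%N c; have h4 := hN' (N + N')%N ltac:(lia).
  have e' : V (N + N').+1 k x - avg (a k) (U k.+1) x = V (N + N') k.+1 c - U k.+1 c by exact: e.
  by move: h1 h3 e'; split_Rabs; lra.
exists (fun k => iter_diff a k (U k)); split; [|split; [|split]].
- move=> k y; rewrite /=; apply: iter_diff_derivable => z.
  have -> : U k = avg (a k) (U k.+1) by apply: functional_extensionality.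
  exact: derivable_avg.
- by move=> y hy; apply: limU => m; exact: V_left.
- move=> y hy; apply: limU => m; apply: V_right.
  have := ha m; rewrite -/(A m) add0n => h.
  have -> : A 0 = 0 by rewrite /A big_ord0.
  lra.
- by move=> k y; have := iter_diff_bound k (rangeU k) y; rewrite Rmult_1_r.
Qed.
End Step.

(** * The integral condition in dyadic form, and step functions adapted to the weight *)

Lemma weight_quot_RInt_ge (om : R -> R) t I : is_weight_function om -> 0 < t ->
  / 4 * \big[Rplus/0]_(l < I) ((/ 2) ^ l * om (2 ^ l * t)) <=
  RInt (fun u => om (t * u) / u ^ 2) 1 (2 ^ I).
Proof.
move=> hom t0; elim: I => [|I IH]; first by rewrite big_ord0 RInt_point /zero /=; lra.
have pw : 0 < 2 ^ I by apply: pow_lt; lra.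
rewrite big_ord_recr /= -(RInt_Chasles _ 1 (2 ^ I)); try (apply: weight_quot_ex_RInt => //; lra).
rewrite Rmult_plus_distr_l; apply: Rplus_le_compat => //.
apply: Rle_trans _ (RInt_le (fun=> om (2 ^ I * t) * (/ 4 * ((/ 2) ^ I * (/ 2) ^ I))) _ _ _ _ _ _ _).
- rewrite RInt_const /scal /= /mult /=.
  apply: Req_le.
  have -> : (2 * 2 ^ I - 2 ^ I) * (om (2 ^ I * t) * (/ 4 * ((/ 2) ^ I * (/ 2) ^ I))) =
    (2 ^ I * (/ 2) ^ I) * (om (2 ^ I * t) * (/ 4 * (/ 2) ^ I)) by ring.
  by rewrite pow2_half; ring.
- lra.
- exact: ex_RInt_const.
- by apply: weight_quot_ex_RInt => //; lra.
- move=> u hu; apply: Rmult_le_compat.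
  + by apply: om_ge0 => //; nra.
  + apply: Rmult_le_pos; first lra.
    by apply: Rmult_le_pos; apply: pow_le; lra.
  + by apply: om_mono => //; nra.
  + rewrite -Rpow_mult_distr -Rinv_mult pow_inv -Rinv_mult; apply: Rinv_le_contravar; first nra.
    by rewrite Rpow_mult_distr /=; nra.
Qed.

Lemma dyadic_sum_of_integral (om sg : R -> R) C : is_weight_function om -> is_weight_function sg -> 0 < C ->
  (forall t, 0 < t -> improper_int_1_le (fun u => om (t * u) / (u ^ 2)) (C * sg t + C)) ->
  forall t I, 0 < t -> \big[Rplus/0]_(l < I) ((/ 2) ^ l * om (2 ^ l * t)) <= 4 * C * (sg t + 1).
Proof.
move=> hom hsg C0 h t I t0.
have [pr hpr] := h t t0 (2 ^ I) (pow2_ge1 I); rewrite -RInt_Reals in hpr.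
by have := Rle_trans _ _ _ (weight_quot_RInt_ge I hom t0) hpr; lra.
Qed.

(** The tails are [L - S m], with [L] the least upper bound of the partial sums. The minimality of
    [K m] among the bounds of its partial sums is what transfers estimates from finite sums to
    [K]. *)
Lemma series_tail (b : nat -> R) (B : R) : (forall l, 0 <= b l) ->
  (forall I, \big[Rplus/0]_(l < I) b l <= B) ->
  exists K : nat -> R, (forall m, K m = b m + K m.+1) /\
    (forall m I, \big[Rplus/0]_(l < I) b (m + l)%N <= K m) /\
    (forall m c, (forall I, \big[Rplus/0]_(l < I) b (m + l)%N <= c) -> K m <= c) /\
    (forall eps, 0 < eps -> exists N, forall m, (N <= m)%N -> K m < eps).
Proof.
move=> b0 hB; pose S I := \big[Rplus/0]_(l < I) b l.
have SS j : S j.+1 = S j + b j by rewrite /S big_ord_recr.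
have SD m I : S (m + I)%N = S m + \big[Rplus/0]_(l < I) b (m + l)%N.
  elim: I => [|I IH]; first by rewrite addn0 big_ord0 Rplus_0_r.
  by rewrite addnS SS IH big_ord_recr /=; ring.
have hb : bound (fun y => exists m, y = S m) by exists B => y [m ->]; exact: hB.
have [L [h1 h2]] := completeness _ hb (ex_intro _ (S 0%N) (ex_intro _ 0%N erefl)).
have S1 m : S m <= L by apply: h1; exists m.
have Sm m m' : (m <= m')%N -> S m <= S m'.
  move=> hm; rewrite -(subnKC hm) SD; have : 0 <= \big[Rplus/0]_(l < m' - m) b (m + l)%N by apply: rsum_ge0.
  lra.
exists (fun m => L - S m); split; [|split; [|split]].
- by move=> m; rewrite /S big_ord_recr /=; ring.
- by move=> m I; have := S1 (m + I)%N; rewrite SD; lra.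
- move=> m c hc; suff : L <= S m + c by lra.
  apply: h2 => y [I ->]; apply: Rle_trans (Sm I (m + I)%N _) _; first by lia.
  by rewrite SD; apply: Rplus_le_compat_l; exact: hc.
- move=> eps e0; apply: NNPP => hn.
  have : L <= L - eps; last lra.
  apply: h2 => y [m ->]; apply: Rnot_lt_le => hm; apply: hn; exists m => m' hm'.
  by have := Sm _ _ hm'; lra.
Qed.

Lemma count_lt_le q x : 0 <= x -> \big[Rplus/0]_(i < q | ~~ Rleb x (INR i)) 1 <= x + 1.
Proof.
move=> x0; elim: q => [|q IH]; first by rewrite big_ord0; lra.
rewrite big_mkcond big_ord_recr -big_mkcond /=; case: RlebP => h /=; first by rewrite Rplus_0_r.
apply: Rplus_le_compat_r; apply: (Rle_trans _ (INR q)); last lra.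
rewrite big_mkcond; apply: (Rle_trans _ (\big[Rplus/0]_(i < q) 1)); last by rewrite rsum_const; lra.
by apply: rsum_le => i _; case: ifP => _; lra.
Qed.

Definition dy (om : R -> R) (l : nat) : R := om (2 ^ l).

Section Dyadic.
Variables (om : R -> R) (hom : is_weight_function om).

Lemma dy_ge0 l : 0 <= dy om l.
Proof. by apply: om_ge0 => //; have := pow2_ge1 l; lra. Qed.

Lemma dy_mono l l' : (l <= l')%N -> dy om l <= dy om l'.
Proof.
move=> h; apply: om_mono => //; first by have := pow2_ge1 l; lra.
by apply: pow_mono => //; lra.
Qed.

Lemma dy_unbounded M : exists l0, forall l, (l0 <= l)%N -> M < dy om l.
Proof.
case: (hom) => _ [_] [_] [_] [h _]; have [T hT] := h (M + 1).
have [l0 hl0] := archimed_nat T; exists l0 => l hl.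
have := hT (2 ^ l0) ltac:(have := INR_le_pow2 l0; lra); have := dy_mono hl; rewrite /dy; lra.
Qed.

(* The step uses the widths [2^-(lev i)] where [lev i] is the first level [l >= m]
   with [i < e * om (2^l)]; their total is at most [2 * e * K m]. *)
Lemma weight_step (K : nat -> R) (A eta : R) : 0 < A -> 0 < eta ->
  (forall m I, \big[Rplus/0]_(l < I) ((/ 2) ^ (m + l) * dy om (m + l)) <= K m) ->
  exists (rho C : R) (m0 : nat), 0 < rho /\ 0 < C /\ forall m delta, (m0 <= m)%N ->
    0 < delta -> A * K m <= delta ->
    exists s : nat -> R -> R,
      (forall k y, derivable_pt_lim (s k) y (s k.+1 y)) /\
      (forall y, y <= 0 -> s 0%N y = 0) /\ (forall y, 2 * delta <= y -> s 0%N y = 1) /\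
      forall k y, Rabs (s k y) <= C * exp (eta * dy om m) * wmat om rho k.
Proof.
move=> A0 eta0 hK.
pose e := A / 2; have e0 : 0 < e by rewrite /e; lra.
have [D4 [D41 hD4]] := om_scale hom (A := 4) ltac:(lra).
have [D8 [D81 hD8]] := om_scale hom (A := 8) ltac:(lra).
(* From [m0] on [e * dy om l >= 1], so a count of at most [e * dy om l + 1] widths is at most
   [2 * e * dy om l]. *)
have [m0 hm0] := dy_unbounded (/ e).
have ln2 := ln2_gt0.
have eln : 0 < e * ln 2 by exact: Rmult_lt_0_compat.
(* [D4 / eta] serves the orders whose level is still [m]; [D8 / (e * ln 2)] serves higher levels,
   where minimality one level below bounds [om] by a multiple of the order. The summands [D4] and
   [D8] absorb additive constants. *)
pose rho := D4 / eta + D4 + D8 / (e * ln 2) + D8.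
have q1 : 0 < D4 / eta by apply: Rdiv_lt_0_compat; lra.
have q2 : 0 < D8 / (e * ln 2) by apply: Rdiv_lt_0_compat; lra.
have rho0 : 0 < rho by rewrite /rho; lra.
have W0 k : 0 < wmat om rho k by exact: exp_pos.
exists rho, (exp 1 + exp (om 1 / rho)), m0; split => //; split.
  by apply: Rplus_lt_0_compat; exact: exp_pos.
move=> m delta hm d0 hd.
have levP i : exists l, (m <= l)%N && ~~ Rleb (e * dy om l) (INR i).
  have [l0 hl0] := dy_unbounded (INR i / e); exists (m + l0)%N; rewrite leq_addr /=.
  apply/RlebP => h; have := hl0 (m + l0)%N ltac:(lia).
  move/(Rmult_lt_compat_l e _ _ e0); have -> : e * (INR i / e) = INR i by field; lra.
  lra.
pose lev i := ex_minn (levP i).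
have lev_ge i : (m <= lev i)%N by rewrite /lev; case: ex_minnP => l /andP[].
have lev_gt i : INR i < e * dy om (lev i).
  by rewrite /lev; case: ex_minnP => l /andP[_ /RlebP h] _; lra.
have lev_min i l : (m <= l)%N -> (l < lev i)%N -> e * dy om l <= INR i.
  rewrite /lev; case: ex_minnP => l' _ hmin h1 h2; apply: Rnot_lt_le => h3.
  have := hmin l; rewrite h1 /=; case: RlebP => h4 /=; first by exfalso; lra.
  by move=> /(_ isT); lia.
have lev_mono i j : (i <= j)%N -> (lev i <= lev j)%N.
  move=> hij; rewrite leqNgt; apply/negP => hlt.
  have := lev_min i (lev j) (lev_ge j) hlt; have := lev_gt j; have := INR_le hij; lra.
have h2 := half_pow_gt0.
pose a i := (/ 2) ^ lev i.
have ha q : \big[Rplus/0]_(i < q) a i <= delta.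
  (* The widths are grouped by level, and those of each level are compared with one term of the
     series bounded by [K m]. *)
  pose N := (lev q - m).+1.
  have -> : \big[Rplus/0]_(i < q) a i =
      \big[Rplus/0]_(l < N) \big[Rplus/0]_(i < q | lev i == (m + l)%N) (/ 2) ^ (m + l).
    rewrite (exchange_big_dep xpredT) //=; apply: eq_bigr => i _.
    have hi : (lev i - m < N)%N by have := lev_mono i q (ltnW (ltn_ord i)); rewrite /N; lia.
    rewrite (big_pred1 (Ordinal hi)) /=; first by rewrite subnKC.
    move=> l; apply/eqP/eqP => [hl|->] /=; last by rewrite subnKC.
    by apply: val_inj => /=; have := lev_ge i; lia.
  apply: (Rle_trans _ (2 * e * K m)); last by rewrite /e; lra.
  have h3 := Rmult_le_compat_l (2 * e) _ _ ltac:(lra) (hK m N).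
  apply: Rle_trans h3; rewrite -rsumZ; apply: rsum_le => l _.
  have -> : \big[Rplus/0]_(i < q | lev i == (m + l)%N) (/ 2) ^ (m + l) =
     (/ 2) ^ (m + l) * \big[Rplus/0]_(i < q | lev i == (m + l)%N) 1.
    by rewrite -rsumZ; apply: eq_bigr => i _; ring.
  have -> : 2 * e * ((/ 2) ^ (m + l) * dy om (m + l)) = (/ 2) ^ (m + l) * (2 * e * dy om (m + l)) by ring.
  apply: Rmult_le_compat_l; first exact: Rlt_le.
  have hw := hm0 (m + l)%N ltac:(lia).
  have hw1 : 1 <= e * dy om (m + l).
    by have := Rmult_lt_compat_l e _ _ e0 hw; rewrite Rinv_r; lra.
  apply: (Rle_trans _ (e * dy om (m + l) + 1)); last lra.
  apply: Rle_trans (count_lt_le q (x := e * dy om (m + l)) _); last lra.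
  rewrite big_mkcond [X in _ <= X]big_mkcond; apply: rsum_le => i _.
  case: eqP => hi; last by case: ifP => _; lra.
  by have := lev_gt i; rewrite hi; case: RlebP => h /=; lra.
have [s [s1 [s2 [s3 s4]]]] := smooth_step d0 (fun i => h2 (lev i)) ha.
exists s; split => //; split => //; split => // k y.
apply: Rle_trans (s4 k y) _.
have E1 : 1 <= exp (eta * dy om m) by apply: exp_ge1; apply: Rmult_le_pos; [lra|exact: dy_ge0].
have e1 := exp_pos 1; have e2 := exp_pos (om 1 / rho).
case: k => [|k].
  rewrite big_ord0; have := wmat_pow_le hom 0 rho0 (r := 1) ltac:(lra); rewrite /= => h.
  have : 1 * exp (om 1 / rho) <= exp (eta * dy om m) * exp (om 1 / rho) by apply: Rmult_le_compat_r; lra.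
  have h3 : 0 < exp 1 * exp (eta * dy om m) by apply: Rmult_lt_0_compat; lra.
  move=> h4; apply: Rle_trans h _; rewrite Rmult_comm; apply: Rmult_le_compat_r; [exact: Rlt_le|lra].
pose L := lev k.
have hprod : \big[Rmult/1]_(i < k.+1) (2 / (/ 2) ^ lev i) <= (2 * 2 ^ L) ^ k.+1.
  rewrite -rprod_const; apply: rprod_le => i _; have -> : 2 / (/ 2) ^ lev i = 2 * 2 ^ lev i.
    by rewrite pow_inv; field; have := pow2_ge1 (lev i); lra.
  split; first by have := pow2_ge1 (lev i); lra.
  apply: Rmult_le_compat_l; first lra.
  by apply: pow_mono; [lra|apply: lev_mono; have := ltn_ord i; lia].
apply: Rle_trans hprod _.
(* Taken at twice the radius [2 * 2 ^ L] that is needed: the surplus [2 ^ k.+1] pays for the term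
   [INR k.+1 * ln 2] of the penalty. *)
have hr := wmat_pow_le hom k.+1 rho0 (r := 4 * 2 ^ L) ltac:(have := pow2_ge1 L; lra).
have hexp : om (4 * 2 ^ L) / rho <= INR k.+1 * ln 2 + eta * dy om m + 1.
  have k0 : 0 <= INR k.+1 * ln 2 by apply: Rmult_le_pos; [exact: pos_INR|lra].
  have w0 : 0 <= eta * dy om m by apply: Rmult_le_pos; [lra|exact: dy_ge0].
  apply: (Rmult_le_reg_r rho) => //; have -> : om (4 * 2 ^ L) / rho * rho = om (4 * 2 ^ L) by field; lra.
  case: (ltngtP m L) => hL; last 1 first.
  - have h4 := hD4 (2 ^ m) ltac:(have := pow2_ge1 m; lra); rewrite -hL.
    apply: Rle_trans h4 _; rewrite -/(dy om m).
    have : D4 * dy om m <= rho * eta * dy om m.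
      apply: Rmult_le_compat_r; first exact: dy_ge0.
      have -> : D4 = D4 / eta * eta by field; lra.
      by apply: Rmult_le_compat_r; rewrite /rho; lra.
    have : 0 <= INR k.+1 * ln 2 * rho by apply: Rmult_le_pos; lra.
    have : D4 <= rho by rewrite /rho; lra.
    lra.
  - have h8 := hD8 (2 ^ L.-1) ltac:(have := pow2_ge1 L.-1; lra).
    have -> : 4 * 2 ^ L = 8 * 2 ^ L.-1.
      have -> : L = L.-1.+1 by lia.
      by rewrite /=; ring.
    apply: Rle_trans h8 _; rewrite -/(dy om _).
    have h5 := lev_min k L.-1 ltac:(lia) ltac:(rewrite /L; lia).
    have : D8 * dy om L.-1 <= rho * ln 2 * INR k.
      apply: (Rle_trans _ (D8 / (e * ln 2) * ln 2 * INR k)).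
        have -> : D8 / (e * ln 2) * ln 2 * INR k = D8 * (INR k / e) by field; lra.
        apply: Rmult_le_compat_l; first lra.
        apply: (Rmult_le_reg_l e) => //; have -> : e * (INR k / e) = INR k by field; lra.
        lra.
      apply: Rmult_le_compat_r; first exact: pos_INR.
      by apply: Rmult_le_compat_r; rewrite /rho; lra.
    have : 0 <= eta * dy om m * rho by apply: Rmult_le_pos; lra.
    have : D8 <= rho by rewrite /rho; lra.
    have : 0 <= rho * ln 2 by apply: Rmult_le_pos; lra.
    rewrite S_INR; lra.
  - by have := lev_ge k; rewrite -/L; lia.
have h4 : 2 ^ k.+1 = exp (INR k.+1 * ln 2) by rewrite -pow_exp_ln; lra.
apply: (Rmult_le_reg_l (2 ^ k.+1)); first by apply: pow_lt; lra.
rewrite -Rpow_mult_distr; have -> : 2 * (2 * 2 ^ L) = 4 * 2 ^ L by ring.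
apply: Rle_trans hr _; apply: Rle_trans (Rmult_le_compat_l _ _ _ (Rlt_le _ _ (W0 _)) (exp_le hexp)) _.
rewrite !exp_plus -h4.
have -> : wmat om rho k.+1 * (2 ^ k.+1 * exp (eta * dy om m) * exp 1) =
  2 ^ k.+1 * (exp 1 * (exp (eta * dy om m) * wmat om rho k.+1)) by ring.
apply: Rmult_le_compat_l; first by apply: pow_le; lra.
rewrite Rmult_assoc; apply: Rmult_le_compat_r; last lra.
by apply: Rmult_le_pos; [lra|exact: Rlt_le].
Qed.
End Dyadic.

(** * Degrees of the Taylor polynomials *)

Lemma dyadic_floor r : 1 <= r -> exists m, 2 ^ m <= r <= 2 ^ m.+1.
Proof.
move=> r1; have [N hN] := archimed_nat r.
have {hN} : r <= 2 ^ N by have := INR_le_pow2 N; lra.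
elim: N => [|N IH] hN; first by exists 0%N; move: hN => /=; lra.
case: (Rle_dec r (2 ^ N)) => h; first exact: IH.
by exists N; lra.
Qed.

Section Degrees.
Variables (sg : R -> R) (x0 : R) (hsg : is_weight_function sg) (x00 : 0 < x0).

(** [(2 ^ m) ^ k * exp (- (dy sg m / x0))] is always a lower bound of [S_k]. At a good degree this
    single radius reaches the supremum up to [2 ^ k], the loss of rounding radii to powers of 2, and
    [2 ^ m], the loss of rounding the degree to an integer. *)
Definition good_degree (k m : nat) : Prop :=
  wmat sg x0 k <= (2 * 2 ^ m) ^ k * (2 ^ m * exp (- (dy sg m / x0))).

Let c m := dy sg m / x0.
Let e m := c m.+1 - c m.

Lemma pow2_exp m : 2 ^ m = exp (INR m * ln 2).
Proof. by rewrite -pow_exp_ln; lra. Qed.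

Let ln2 := ln2_gt0.

Let e_mono m m' : (m <= m')%N -> e m <= e m'.
Proof.
apply: nat_nondecreasing => {m}m'.
have := om_convex hsg (s1 := INR m' * ln 2) (s2 := INR m'.+1 * ln 2) (s3 := INR m'.+2 * ln 2).
rewrite -!pow2_exp -/(dy sg m') -/(dy sg m'.+1) -/(dy sg m'.+2).
rewrite !S_INR => /(_ ltac:(lra) ltac:(lra)) h2.
have h3 : 2 * dy sg m'.+1 <= dy sg m' + dy sg m'.+2.
  by apply: (Rmult_le_reg_l (ln 2)) => //; lra.
suff : 2 * c m'.+1 <= c m' + c m'.+2 by rewrite /e; lra.
rewrite /c; have := Rmult_le_compat_r (/ x0) _ _ (Rlt_le _ _ (Rinv_0_lt_compat _ x00)) h3.
by rewrite /Rdiv; lra.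
Qed.

(** The hypotheses place [k * ln 2] between the slopes of [c] before and after [m], up to an error
    [ln 2]; therefore [m' * k * ln 2 - c m'] is largest at [m' = m] up to [m * ln 2]. *)
Let good_of k m :
  (forall m', (m' < m)%N -> e m' <= (INR k + 1) * ln 2) ->
  (forall m', (m <= m')%N -> INR k * ln 2 <= e m') -> good_degree k m.
Proof.
move=> hlo hhi.
have up j : c m + INR j * (INR k * ln 2) <= c (m + j)%N.
  elim: j => [|j IH]; first by rewrite addn0 Rmult_0_l; lra.
  by have := hhi (m + j)%N ltac:(lia); rewrite S_INR addnS /e; lra.
have lo j : (j <= m)%N -> c m - c (m - j)%N <= INR j * ((INR k + 1) * ln 2).
  elim: j => [|j IH] hj; first by rewrite subn0 Rmult_0_l; lra.
  have := IH ltac:(lia); have := hlo (m - j.+1)%N ltac:(lia); rewrite S_INR /e.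
  by rewrite (_ : (m - j.+1).+1 = (m - j)%N); [lra|lia].
have main m' : INR m' * (INR k * ln 2) - c m' <= INR m * (INR k * ln 2) - c m + INR m * ln 2.
  have k0 := pos_INR k; have m0 := pos_INR m; have m0' := pos_INR m'.
  have p1 : 0 <= INR m * ln 2 by apply: Rmult_le_pos; lra.
  case: (leqP m m') => h.
    have := up (m' - m)%N; rewrite subnKC // minus_INR; last by lia.
    lra.
  have := lo (m - m')%N ltac:(lia); rewrite subKn; last by lia.
  rewrite minus_INR; last by lia.
  have p2 : 0 <= INR m' * ln 2 by apply: Rmult_le_pos; lra.
  lra.
apply: wmat_le => // r r1; have [m' [h1 h2]] := dyadic_floor r1.
have pm' := pow2_ge1 m'.
apply: (Rle_trans _ ((2 * 2 ^ m') ^ k * exp (- c m'))).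
  apply: Rmult_le_compat; [by apply: pow_le; lra|by left; exact: exp_pos|by apply: pow_incr; split; [lra|exact: h2]|].
  apply: exp_le; suff : c m' <= sg r / x0 by lra.
  apply: Rmult_le_compat_r; first by left; exact: Rinv_0_lt_compat.
  by apply: om_mono => //; lra.
rewrite !Rpow_mult_distr !Rmult_assoc; apply: Rmult_le_compat_l; first by apply: pow_le; lra.
rewrite !pow2_exp -!exp_INR -!exp_plus; apply: exp_le; rewrite -/(c m).
by have := main m'; lra.
Qed.

Let e_ge0 m : 0 <= e m.
Proof.
suff : c m <= c m.+1 by rewrite /e; lra.
apply: Rmult_le_compat_r; first by left; exact: Rinv_0_lt_compat.
exact: dy_mono.
Qed.

(** [q m] is the slope [e m] in units of [ln 2], rounded down. A degree above [q m] and at most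
    [q m.+1] exceeds all slopes before [m + 1] and none from there on, so it is good at [m + 1].
    Bounded degrees would make [sg (2 ^ m)] grow at most linearly in [m], against
    [ln t = o(sg t)]. *)
Lemma degree_sequence : exists q : nat -> nat,
  (forall m m', (m <= m')%N -> (q m <= q m')%N) /\ (forall m, good_degree (q m) m) /\
  (forall m k, (q m <= k)%N -> (k <= q m.+1)%N -> good_degree k m \/ good_degree k m.+1) /\
  forall P, exists m0, forall m, (m0 <= m)%N -> (P <= q m)%N.
Proof.
have hq m : exists q : nat, INR q * ln 2 <= e m < (INR q + 1) * ln 2.
  have [q [h1 h2]] := nat_floor (Rle_mult_inv_pos _ _ (e_ge0 m) ln2).
  have el : e m * / ln 2 * ln 2 = e m by field; lra.
  exists q; split.
    by rewrite -el; apply: Rmult_le_compat_r; lra.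
  by rewrite -{1}el; apply: Rmult_lt_compat_r; lra.
pose q m := proj1_sig (constructive_indefinite_description _ (hq m)).
have qP m : INR (q m) * ln 2 <= e m < (INR (q m) + 1) * ln 2.
  by rewrite /q; case: constructive_indefinite_description.
have qmono m m' : (m <= m')%N -> (q m <= q m')%N.
  move=> h; rewrite leqNgt; apply/negP => hlt.
  have [h1 _] := qP m; have [_ h2] := qP m'; have h3 := e_mono h.
  have : INR (q m').+1 <= INR (q m) by apply: INR_le.
  by rewrite S_INR => /(Rmult_le_compat_r _ _ _ (Rlt_le _ _ ln2)); lra.
exists q; split => //; split; [|split].
- move=> m; apply: good_of => m' h.
    by apply: Rle_trans (e_mono (ltnW h)) _; have := qP m; lra.
  by apply: Rle_trans _ (e_mono h); have := qP m; lra.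
- move=> m k h1 h2; case: (ltngtP (q m) k) => h3; [right|by lia|left].
    apply: good_of => m' h.
      have [_ h4] := qP m; apply: Rle_trans (@e_mono m' m ltac:(lia)) _.
      have := INR_le h3; rewrite S_INR => /(Rmult_le_compat_r _ _ _ (Rlt_le _ _ ln2)); lra.
    have [h4 _] := qP m.+1; apply: Rle_trans _ (e_mono h); apply: Rle_trans _ h4.
    by apply: Rmult_le_compat_r; [lra|exact: INR_le].
  rewrite -h3; apply: good_of => m' h.
    by apply: Rle_trans (e_mono (ltnW h)) _; have := qP m; lra.
  by apply: Rle_trans _ (e_mono h); have := qP m; lra.
- move=> P; apply: NNPP => hn.
  have hlt m : (q m < P)%N.
    rewrite ltnNge; apply/negP => h; apply: hn; exists m => m' hm'.
    by apply: leq_trans h _; exact: qmono.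
  pose B := INR P * ln 2; have B0 : 0 <= B by apply: Rmult_le_pos; [exact: pos_INR|lra].
  have eB m : e m <= B.
    have [_ h] := qP m; have := INR_le (hlt m); rewrite S_INR.
    by move/(Rmult_le_compat_r _ _ _ (Rlt_le _ _ ln2)); rewrite -/B; lra.
  have cB m : c m <= c 0%N + INR m * B.
    elim: m => [|m IH]; first by rewrite Rmult_0_l; lra.
    by have := eB m; rewrite S_INR /e; lra.
  pose eps := ln 2 / (x0 * (B + 1)).
  have xB : 0 < x0 * (B + 1) by apply: Rmult_lt_0_compat; lra.
  have eps0 : 0 < eps by apply: Rdiv_lt_0_compat.
  have [C2 [C20 hC2]] := om_ln_le hsg eps0.
  pose C3 := (B + 1) * C2 / ln 2.
  have [m hm] := archimed_nat (c 0%N + C3 + 1).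
  have := hC2 (2 ^ m) (pow2_ge1 m); rewrite ln_pow; last lra.
  rewrite -/(dy sg m); have -> : eps * dy sg m = ln 2 / (B + 1) * c m.
    by rewrite /eps /c; field; lra.
  move/(Rmult_le_compat_r ((B + 1) / ln 2) _ _ ltac:(left; apply: Rdiv_lt_0_compat; lra)).
  have -> : INR m * ln 2 * ((B + 1) / ln 2) = INR m * (B + 1) by field; lra.
  have -> : (ln 2 / (B + 1) * c m + C2) * ((B + 1) / ln 2) = c m + C3 by rewrite /C3; field; lra.
  have := cB m; lra.
Qed.
End Degrees.

(** * Families of partial derivatives and the Leibniz rule *)

(** Continuity is left out here; it is recovered from bounds on the next order. *)
Definition chain n (U : mi n -> pt n -> R) : Prop :=
  forall a i x, derivable_pt_lim (fun h => U a (upd x i h)) 0 (U (mincr a i) x).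

Lemma upd0 n (x : pt n) i : upd x i 0 = x.
Proof. by apply: functional_extensionality => j; rewrite /upd; case: eqP => _; lra. Qed.

Lemma upd_upd n (x : pt n) i h s : upd (upd x i h) i s = upd x i (h + s).
Proof. by apply: functional_extensionality => j; rewrite /upd; case: eqP => _; lra. Qed.

Lemma chain_at n (U : mi n -> pt n -> R) a i x h : chain U ->
  derivable_pt_lim (fun h => U a (upd x i h)) h (U (mincr a i) (upd x i h)).
Proof.
move=> hU eps e0; have [delta hd] := hU a i (upd x i h) eps e0; exists delta => s s0 hs.
by have := hd s s0 hs; rewrite !upd_upd !Rplus_0_l Rplus_0_r.
Qed.

Lemma mabs_mincr n (a : mi n) i : mabs (mincr a i) = (mabs a).+1.
Proof.
rewrite /mabs (bigD1 i) //= [in RHS](bigD1 i) //= ffunE eqxx; congr (_ + _).+1.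
by apply: eq_bigr => j hj; rewrite ffunE (negbTE hj).
Qed.

Lemma mabs_mzero n : mabs (@mzero n) = 0%N.
Proof. by rewrite /mabs big1 // => i _; rewrite ffunE. Qed.

Lemma mincrC n (a : mi n) i j : mincr (mincr a i) j = mincr (mincr a j) i.
Proof. by apply/ffunP => k; rewrite !ffunE; do ! case: eqP. Qed.

Lemma derivable_rsum (I : eqType) (r : seq I) (P : pred I) (f : I -> R -> R) (d : I -> R) x :
  (forall i, P i -> derivable_pt_lim (f i) x (d i)) ->
  derivable_pt_lim (fun h => \big[Rplus/0]_(i <- r | P i) f i h) x (\big[Rplus/0]_(i <- r | P i) d i).
Proof.
move=> h; elim: r => [|i r IH].
  rewrite big_nil; have -> : (fun h => \big[Rplus/0]_(i <- [::] | P i) f i h) = (fun=> 0).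
    by apply: functional_extensionality => y; rewrite big_nil.
  exact: derivable_pt_lim_const.
rewrite big_cons; case hP : (P i).
  have -> : (fun h => \big[Rplus/0]_(j <- i :: r | P j) f j h) =
     (fun h => f i h + \big[Rplus/0]_(j <- r | P j) f j h).
    by apply: functional_extensionality => y; rewrite big_cons hP.
  by apply: (derivable_pt_lim_plus (f i)); [exact: h|exact: IH].
have -> // : (fun h => \big[Rplus/0]_(j <- i :: r | P j) f j h) = (fun h => \big[Rplus/0]_(j <- r | P j) f j h).
by apply: functional_extensionality => y; rewrite big_cons hP.
Qed.

Lemma chain_sum n (I : eqType) (r : seq I) (P : pred I) (U : I -> mi n -> pt n -> R) :
  (forall i, P i -> chain (U i)) ->
  chain (fun a x => \big[Rplus/0]_(i <- r | P i) U i a x).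
Proof. by move=> h a i x; apply: derivable_rsum => j hj; exact: h. Qed.

Lemma chain_sub n (U V : mi n -> pt n -> R) : chain U -> chain V -> chain (fun a x => U a x - V a x).
Proof. by move=> hU hV a i x; apply: derivable_pt_lim_minus; [exact: hU|exact: hV]. Qed.

Lemma chain_add n (U V : mi n -> pt n -> R) : chain U -> chain V -> chain (fun a x => U a x + V a x).
Proof. by move=> hU hV a i x; apply: derivable_pt_lim_plus; [exact: hU|exact: hV]. Qed.

Lemma chain_tensor n (u : 'I_n -> nat -> R -> R) :
  (forall c k y, derivable_pt_lim (u c k) y (u c k.+1 y)) ->
  chain (fun a x => \big[Rmult/1]_(c < n) u c (a c) (x c)).
Proof.
move=> hu a i x; rewrite (bigD1 i) //= ffunE eqxx.
have -> : (fun h => \big[Rmult/1]_(c < n) u c (a c) (upd x i h c)) =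
  (fun h => u i (a i) (x i + h) * \big[Rmult/1]_(c < n | c != i) u c (a c) (x c)).
  apply: functional_extensionality => h; rewrite (bigD1 i) //= /upd eqxx; congr (_ * _).
  by apply: eq_bigr => c hc; rewrite (negbTE hc).
rewrite (eq_bigr (fun c => u c (a c) (x c))) => [|c hc]; last by rewrite ffunE (negbTE hc).
set B := \big[Rmult/1]_(c < n | c != i) _.
have -> : (fun h => u i (a i) (x i + h) * B) = (fun h => B * u i (a i) (x i + h)).
  by apply: functional_extensionality => h; ring.
rewrite Rmult_comm; apply: derivable_pt_lim_scal.
have -> : (fun h => u i (a i) (x i + h)) = (fun h => u i (a i) (h + x i)).
  by apply: functional_extensionality => h; rewrite Rplus_comm.
by apply: derivable_shift; rewrite Rplus_0_l.
Qed.

Definition mshift n (i : 'I_n) (U : mi n -> R) : mi n -> R := fun a => U (mincr a i).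

(* Lists of directions avoid multi-binomials. *)
Fixpoint leib n (l : seq 'I_n) (U V : mi n -> R) : R :=
  if l is i :: l' then leib l' (mshift i U) V + leib l' U (mshift i V)
  else U (@mzero n) * V (@mzero n).

Definition mlist n (a : mi n) : seq 'I_n := flatten [seq nseq (a i) i | i <- enum 'I_n].

Definition fprod n (U V : mi n -> pt n -> R) : mi n -> pt n -> R :=
  fun a x => leib (mlist a) (U^~ x) (V^~ x).

Lemma mshiftC n i j (U : mi n -> R) : mshift i (mshift j U) = mshift j (mshift i U).
Proof. by apply: functional_extensionality => a; rewrite /mshift mincrC. Qed.

Lemma leib_move n i (l1 l2 : seq 'I_n) U V : leib (l1 ++ i :: l2) U V = leib (i :: l1 ++ l2) U V.
Proof.
elim: l1 U V => [//|j l1 IH] U V.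
by rewrite cat_cons [LHS]/= !IH /= (mshiftC j) (mshiftC j i V); ring.
Qed.

(** Shifts in different directions commute. Needed because [mlist (mincr a i)] agrees with
    [i :: mlist a] only up to order. *)
Lemma leib_perm n (l l' : seq 'I_n) U V : perm_eq l l' -> leib l U V = leib l' U V.
Proof.
elim: l l' U V => [|i l IH] l' U V h.
  by have -> : l' = [::] by apply/eqP; rewrite -size_eq0 -(perm_size h).
have hi : i \in l' by rewrite -(perm_mem h) mem_head.
case/splitPr: hi h => l1 l2 h; rewrite leib_move.
have {}h : perm_eq l (l1 ++ l2).
  by move: h; rewrite perm_sym (perm_catCA l1 [:: i] l2) perm_cons perm_sym.
by rewrite /= !(IH _ _ _ h).
Qed.

Lemma count_mlist n (a : mi n) j : count_mem j (mlist a) = a j.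
Proof.
rewrite /mlist count_flatten -map_comp sumnE big_map big_enum /= (bigD1 j) //=.
rewrite count_nseq /= eqxx mul1n big1 ?addn0 // => i hi.
by rewrite count_nseq /= (negbTE hi).
Qed.

Lemma size_mlist n (a : mi n) : size (mlist a) = mabs a.
Proof.
rewrite /mlist size_flatten /shape -map_comp sumnE big_map big_enum /=.
by apply: eq_bigr => i _; rewrite size_nseq.
Qed.

Lemma mlist_mincr n (a : mi n) i : perm_eq (mlist (mincr a i)) (i :: mlist a).
Proof.
apply/allP => j _; apply/eqP => /=; rewrite !count_mlist ffunE.
by rewrite (eq_sym i); case: eqP.
Qed.

Lemma derivable_leib n (l : seq 'I_n) (U V : R -> mi n -> R) (i : 'I_n) :
  (forall a, derivable_pt_lim (fun h => U h a) 0 (mshift i (U 0) a)) ->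
  (forall a, derivable_pt_lim (fun h => V h a) 0 (mshift i (V 0) a)) ->
  derivable_pt_lim (fun h => leib l (U h) (V h)) 0 (leib (i :: l) (U 0) (V 0)).
Proof.
elim: l U V => [|j l IH] U V hU hV.
  exact: (derivable_pt_lim_mult _ _ _ _ _ (hU _) (hV _)).
have hU' a : derivable_pt_lim (fun h => mshift j (U h) a) 0 (mshift i (mshift j (U 0)) a).
  by rewrite mshiftC; exact: hU.
have hV' a : derivable_pt_lim (fun h => mshift j (V h) a) 0 (mshift i (mshift j (V 0)) a).
  by rewrite mshiftC; exact: hV.
have := derivable_pt_lim_plus _ _ _ _ _ (IH (fun h => mshift j (U h)) V hU' hV)
  (IH U (fun h => mshift j (V h)) hU hV').
by rewrite /= (mshiftC i j) (mshiftC i j) !Rplus_assoc => h;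
   congr derivable_pt_lim: h; rewrite -!Rplus_assoc; congr Rplus; ring.
Qed.

Lemma chain_fprod n (U V : mi n -> pt n -> R) : chain U -> chain V -> chain (fprod U V).
Proof.
move=> hU hV a i x; rewrite /fprod (leib_perm _ _ (mlist_mincr a i)).
have := @derivable_leib n (mlist a) (fun h b => U b (upd x i h)) (fun h b => V b (upd x i h)) i.
rewrite !upd0; apply => b; rewrite /mshift ?upd0; [exact: hU|exact: hV].
Qed.

(** Unfolding produces [2 ^ size l] products. The sum over [g] stays inside each of them, so the
    bound depends on the overlap of supports and not on the number of cells. *)
Lemma leib_sum_bound n (I : Type) (r : seq I) (P : pred I) (l : seq 'I_n) (U V : I -> mi n -> R) B :
  (forall b c, (mabs b + mabs c)%N = size l ->
     \big[Rplus/0]_(g <- r | P g) (Rabs (U g b) * Rabs (V g c)) <= B) ->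
  \big[Rplus/0]_(g <- r | P g) Rabs (leib l (U g) (V g)) <= 2 ^ size l * B.
Proof.
elim: l U V => [|i l IH] U V h.
  rewrite Rmult_1_l; apply: Rle_trans _ (h (@mzero n) (@mzero n) _); last by rewrite mabs_mzero.
  by apply: rsum_le => g _; rewrite /= Rabs_mult; lra.
apply: (Rle_trans _ (\big[Rplus/0]_(g <- r | P g) Rabs (leib l (mshift i (U g)) (V g)) +
    \big[Rplus/0]_(g <- r | P g) Rabs (leib l (U g) (mshift i (V g))))).
  by rewrite -big_split; apply: rsum_le => g _; exact: Rabs_triang.
have h1 := IH (fun g => mshift i (U g)) V _; have h2 := IH U (fun g => mshift i (V g)) _.
have {}h1 := h1 ltac:(by move=> b c e; apply: h; rewrite mabs_mincr /= -e).
have {}h2 := h2 ltac:(by move=> b c e; apply: h; rewrite mabs_mincr /= -e; lia).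
by rewrite /=; lra.
Qed.

Lemma leib_bound n (l : seq 'I_n) (U V : mi n -> R) B :
  (forall b c, (mabs b + mabs c)%N = size l -> Rabs (U b) * Rabs (V c) <= B) ->
  Rabs (leib l U V) <= 2 ^ size l * B.
Proof.
move=> h; have := @leib_sum_bound n unit [:: tt] xpredT l (fun=> U) (fun=> V) B.
rewrite big_seq1; apply => b c e; rewrite big_seq1; exact: h.
Qed.

Lemma leib_suml n (I : Type) (r : seq I) (P : pred I) (l : seq 'I_n) (U : I -> mi n -> R) V :
  leib l (fun a => \big[Rplus/0]_(g <- r | P g) U g a) V = \big[Rplus/0]_(g <- r | P g) leib l (U g) V.
Proof.
elim: l U V => [|i l IH] U V /=.
  by rewrite Rmult_comm -rsumZ; apply: eq_bigr => g _; rewrite Rmult_comm.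
rewrite IH big_split; congr (_ + _); exact: (IH (fun g => mshift i (U g))).
Qed.

Lemma leib_subr n (l : seq 'I_n) U V W :
  leib l U (fun a => V a - W a) = leib l U V - leib l U W.
Proof.
elim: l U V W => [|i l IH] U V W /=; first by ring.
by rewrite IH (IH U (mshift i V) (mshift i W)); ring.
Qed.

Lemma leib0l n (l : seq 'I_n) V : leib l (fun=> 0) V = 0.
Proof. by elim: l V => [|i l IH] V /=; [ring|rewrite (IH V) IH; ring]. Qed.

(** The first factor is the jet of the constant 1, which is what the sum of the cutoffs is near
    [E]. *)
Lemma leib_one n (a : mi n) V : leib (mlist a) (fun b => if b == @mzero n then 1 else 0) V = V a.
Proof.
suff h : forall l V, leib l (fun b => if b == @mzero n then 1 else 0) V = V [ffun j => count_mem j l].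
  by rewrite h; congr V; apply/ffunP => j; rewrite ffunE count_mlist.
elim=> [|i l IH] {}V /=.
  by rewrite eqxx Rmult_1_l; congr V; apply/ffunP => j; rewrite !ffunE.
have -> : mshift i (fun b => if b == @mzero n then 1 else 0) = (fun=> 0).
  apply: functional_extensionality => b; rewrite /mshift; case: eqP => // /ffunP /(_ i).
  by rewrite !ffunE eqxx.
rewrite leib0l Rplus_0_l IH /mshift; congr V; apply/ffunP => j; rewrite !ffunE.
by rewrite (eq_sym i); case: eqP.
Qed.

(** * Taylor polynomials *)

Definition mono n (b : mi n) (v : pt n) : R := mpow v b / mfact b.

Definition dmono n (b : mi n) (i : 'I_n) (v : pt n) : R :=
  if (0 < b i)%N then mono [ffun j => if j == i then (b j).-1 else b j] v else 0.

Lemma mono_tensor n (b : mi n) v : mono b v = \big[Rmult/1]_(c < n) (v c ^ b c / INR (b c)`!).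
Proof.
rewrite /mono /mpow /mfact; apply: (big_ind3 (fun x y z => y <> 0 /\ x / y = z)
   (R1 := R) (R2 := R) (R3 := R) (op1 := Rmult) (op2 := Rmult) (op3 := Rmult) (id1 := 1) (id2 := 1) (id3 := 1)
   (r := index_enum _) (P := xpredT) (F1 := fun i => v i ^ b i) (F2 := fun i => INR (b i)`!)
   (F3 := fun c => v c ^ b c / INR (b c)`!) _ _ _).2.
- by split; [lra|field].
- move=> x1 x2 x3 y1 y2 y3 [h1 <-] [h2 <-]; split; [exact: Rmult_integral_contrapositive_currified|by field].
- by move=> i _; split => //; have := INR_fact_gt0 (b i); lra.
Qed.

Lemma mono_mincr n (b : mi n) i v : dmono (mincr b i) i v = mono b v.
Proof.
rewrite /dmono ffunE eqxx /=; congr mono; apply/ffunP => j; rewrite !ffunE.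
by case: eqP.
Qed.

Lemma derivable_mono n (b : mi n) i (x a : pt n) :
  derivable_pt_lim (fun h => mono b (fun c => upd x i h c - a c)) 0 (dmono b i (fun c => x c - a c)).
Proof.
pose u (c : 'I_n) k y := if (k <= b c)%N then (y - a c) ^ (b c - k) / INR (b c - k)`! else 0.
have hu c k y : derivable_pt_lim (u c k) y (u c k.+1 y).
  rewrite /u; case: (ltnP k (b c)) => h.
    rewrite (ltnW h); have -> : (b c - k)%N = (b c - k.+1).+1 by lia.
    set m := (b c - k.+1)%N.
    have -> : (fun y => (y - a c) ^ m.+1 / INR (m.+1)`!) = (fun y => / INR (m.+1)`! * (y - a c) ^ m.+1).
      by apply: functional_extensionality => z; rewrite /Rdiv Rmult_comm.
    have -> : (y - a c) ^ m / INR m`! = / INR (m.+1)`! * (INR m.+1 * (y - a c) ^ m).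
      rewrite factS mult_INR; have := INR_fact_gt0 m; have := lt_0_INR m.+1 ltac:(lia).
      by move=> *; field; lra.
    apply: derivable_pt_lim_scal.
    by apply: (derivable_shift (g := fun z => z ^ m.+1)); exact: (derivable_pt_lim_pow _ m.+1).
  case: (leqP k (b c)) => h'; last exact: derivable_pt_lim_const.
  have -> : (b c - k)%N = 0%N by lia.
  exact: (derivable_pt_lim_const (1 / INR 0`!)).
have := chain_tensor hu (@mzero n) i x.
have -> : (fun h => \big[Rmult/1]_(c < n) u c ((@mzero n) c) (upd x i h c)) =
   (fun h => mono b (fun c => upd x i h c - a c)).
  apply: functional_extensionality => h; rewrite mono_tensor; apply: eq_bigr => c _.
  by rewrite ffunE /u leq0n subn0.
congr derivable_pt_lim; rewrite /dmono; case: posnP => h.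
  by rewrite (bigD1 i) //= !ffunE eqxx /u h /= Rmult_0_l.
rewrite mono_tensor; apply: eq_bigr => c _; rewrite !ffunE /u; case: eqP => [->|_].
  by rewrite h subn1.
by rewrite leq0n subn0.
Qed.

(** As lists of multi-indices, boxes of different side lengths can be reindexed into each other, as
    differentiating a Taylor polynomial requires. *)
Definition box n N : seq (mi n) := [seq bnat b | b <- enum {: {ffun 'I_n -> 'I_N}}].

Lemma box_sum n N (P : pred (mi n)) (f : mi n -> R) :
  \big[Rplus/0]_(b : {ffun 'I_n -> 'I_N} | P (bnat b)) f (bnat b) = \big[Rplus/0]_(b <- box n N | P b) f b.
Proof. by rewrite /box big_map big_enum_cond; apply: eq_bigl. Qed.

Lemma box_uniq n N : uniq (box n N).
Proof.
rewrite map_inj_uniq ?enum_uniq // => b c /ffunP h; apply/ffunP => i; apply: val_inj => /=.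
by have := h i; rewrite !ffunE.
Qed.

Lemma mem_box n N (b : mi n) : (b \in box n N.+1) = [forall i, (b i <= N)%N].
Proof.
apply/mapP/forallP => [[c _ ->] i|h]; first by rewrite ffunE -ltnS ltn_ord.
exists [ffun i => inord (b i)]; first by rewrite mem_enum.
by apply/ffunP => i; rewrite !ffunE /= inordK // ltnS; exact: h.
Qed.

Lemma coord_le_mabs n (b : mi n) i : (b i <= mabs b)%N.
Proof. by rewrite /mabs (bigD1 i) //= leq_addr. Qed.

Lemma box_shift n m (i : 'I_n) (f : mi n -> R) :
  \big[Rplus/0]_(b <- box n m.+2 | (mabs b <= m.+1)%N && (0 < b i)%N) f b =
  \big[Rplus/0]_(b <- box n m.+1 | (mabs b <= m)%N) f (mincr b i).
Proof.
rewrite -big_filter -[RHS]big_filter -[RHS](big_map (fun b => mincr b i) xpredT f).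
have inj : injective (fun b : mi n => mincr b i).
  move=> b c /ffunP h; apply/ffunP => j; have := h j; rewrite !ffunE.
  by case: eqP => // _ [].
apply: perm_big; apply: uniq_perm; first by rewrite filter_uniq ?box_uniq.
  by rewrite map_inj_uniq ?filter_uniq ?box_uniq.
move=> b; rewrite mem_filter; apply/idP/mapP.
  case/andP => /andP[h1 h2] h3.
  pose c : mi n := [ffun j => if j == i then (b j).-1 else b j].
  have e : b = mincr c i.
    by apply/ffunP => j; rewrite !ffunE; case: eqP => // ->; rewrite prednK.
  exists c => //; rewrite mem_filter.
  have h4 : (mabs c <= m)%N by move: h1; rewrite e mabs_mincr.
  rewrite h4 mem_box; apply/forallP => j; exact: leq_trans (coord_le_mabs c j) h4.
case=> c; rewrite mem_filter => /andP[h1 _] ->.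
rewrite mabs_mincr ltnS h1 ffunE eqxx /= mem_box; apply/forallP => j.
by apply: leq_trans (coord_le_mabs _ j) _; rewrite mabs_mincr.
Qed.

(** The derivative of order [al] of the Taylor polynomial of degree [p]: [F al x] also occurs in
    [taylor_rem] and cancels, so [F] enters only through its values at [a]. The guard matters, since
    beyond [p] the truncated difference [p - mabs al] is 0 and the term [b = 0] would survive. *)
Definition tpoly n (F : mi n -> pt n -> R) p (a : pt n) (al : mi n) (x : pt n) : R :=
  if (mabs al <= p)%N then F al x - taylor_rem F p a al x else 0.

Lemma tpoly_sum n (F : mi n -> pt n -> R) p a al x : (mabs al <= p)%N ->
  tpoly F p a al x = \big[Rplus/0]_(b <- box n (p - mabs al).+1 | (mabs b <= p - mabs al)%N)
     (mono b (fun i => x i - a i) * F (madd al b) a).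
Proof.
move=> h; rewrite /tpoly h /taylor_rem -box_sum /mono.
by rewrite /Rminus Ropp_plus_distr Ropp_involutive -Rplus_assoc Rplus_opp_r Rplus_0_l.
Qed.

Lemma tpoly_high n (F : mi n -> pt n -> R) p a al x : (p < mabs al)%N -> tpoly F p a al x = 0.
Proof. by move=> h; rewrite /tpoly leqNgt h. Qed.

Lemma tpoly_diag n (F : mi n -> pt n -> R) p a al : (mabs al <= p)%N -> tpoly F p a al a = F al a.
Proof. by move=> h; rewrite /tpoly h taylor_rem_diag Rminus_0_r. Qed.

Lemma chain_tpoly n (F : mi n -> pt n -> R) p a : chain (tpoly F p a).
Proof.
move=> al i x; case: (leqP (mabs al) p) => h; last first.
  rewrite tpoly_high ?mabs_mincr; last by lia.
  have -> : (fun h => tpoly F p a al (upd x i h)) = (fun=> 0).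
    by apply: functional_extensionality => y; rewrite tpoly_high.
  exact: derivable_pt_lim_const.
have -> : (fun h => tpoly F p a al (upd x i h)) =
  (fun h => \big[Rplus/0]_(b <- box n (p - mabs al).+1 | (mabs b <= p - mabs al)%N)
     (mono b (fun c => upd x i h c - a c) * F (madd al b) a)).
  by apply: functional_extensionality => y; rewrite tpoly_sum.
suff -> : tpoly F p a (mincr al i) x =
  \big[Rplus/0]_(b <- box n (p - mabs al).+1 | (mabs b <= p - mabs al)%N)
     (dmono b i (fun c => x c - a c) * F (madd al b) a).
  apply: derivable_rsum => b _.
  have -> : (fun h => mono b (fun c => upd x i h c - a c) * F (madd al b) a) =
     (fun h => F (madd al b) a * mono b (fun c => upd x i h c - a c)).
    by apply: functional_extensionality => y; rewrite Rmult_comm.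
  by rewrite Rmult_comm; apply: derivable_pt_lim_scal; exact: derivable_mono.
rewrite [RHS](bigID (fun b : mi n => (0 < b i)%N)) /= [X in _ = _ + X]big1 ?Rplus_0_r; last first.
  by move=> b /andP[_ hb]; rewrite /dmono (negbTE hb) Rmult_0_l.
case: (ltngtP (mabs al) p) => h1; last 1 first.
- rewrite tpoly_high ?mabs_mincr ?h1 // subnn big1 // => b /andP[hb1 hb2].
  by have := coord_le_mabs b i; lia.
- have -> : (p - mabs al)%N = (p - mabs (mincr al i)).+1 by rewrite mabs_mincr; lia.
  rewrite box_shift tpoly_sum ?mabs_mincr //; apply: eq_bigr => b _.
  rewrite mono_mincr; congr (_ * F _ _); apply/ffunP => j; rewrite !ffunE.
  by case: eqP => _; lia.
- by lia.
Qed.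

(** Bounds [B * lam ^ mabs al] at one point are those of an exponential. They propagate along a
    coordinate line by descent from the orders above [p], where the derivatives vanish; the sign
    [sgn] covers both directions. *)
Lemma poly_growth1 n (P : mi n -> pt n -> R) p B lam y i : chain P -> 0 <= B -> 0 <= lam ->
  (forall al x, (p < mabs al)%N -> P al x = 0) ->
  (forall al, Rabs (P al y) <= B * lam ^ mabs al) ->
  forall al h, Rabs (P al (upd y i h)) <= B * lam ^ mabs al * exp (lam * Rabs h).
Proof.
move=> hP B0 l0 hhigh hy.
have main : forall (sgn : R), Rabs sgn = 1 -> forall k al s, (p < mabs al + k)%N -> 0 <= s ->
   Rabs (P al (upd y i (sgn * s))) <= B * lam ^ mabs al * exp (lam * s).
  move=> sgn hsgn; elim=> [|k IH] al s hk s0.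
    rewrite hhigh ?Rabs_R0; last by lia.
    by apply: Rmult_le_pos; [apply: Rmult_le_pos => //; exact: pow_le|left; exact: exp_pos].
  have -> : s = 0 + s by ring.
  rewrite {2}Rplus_0_l.
  apply: (@deriv_abs_le (fun s => P al (upd y i (sgn * s))) (fun s => sgn * P (mincr al i) (upd y i (sgn * s)))
    (fun s => B * lam ^ mabs al * exp (lam * s)) (fun s => B * lam ^ mabs al * lam * exp (lam * s))) => //.
  - move=> r hr; rewrite Rplus_0_l (Rmult_comm sgn).
    apply: (derivable_pt_lim_comp (fun s => sgn * s) (fun h => P al (upd y i h))); last exact: chain_at.
    have {2}-> : sgn = sgn * 1 by ring.
    by apply: derivable_pt_lim_scal; exact: derivable_pt_lim_id.
  - by move=> r _; exact: derivable_pt_lim_expZ.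
  - move=> r hr; rewrite Rabs_mult hsgn Rmult_1_l.
    apply: Rle_trans (IH (mincr al i) r _ _) _; [by rewrite mabs_mincr; lia|lra|].
    by rewrite mabs_mincr /=; apply: Req_le; ring.
  - by rewrite !Rmult_0_r upd0 exp_0 Rmult_1_r.
move=> al h; case: (Rle_dec 0 h) => h0.
  have := main 1 Rabs_R1 p.+1 al h ltac:(lia) h0.
  by rewrite Rmult_1_l (Rabs_right h); [|lra].
have := main (-1) ltac:(split_Rabs; lra) p.+1 al (- h) ltac:(lia) ltac:(lra).
have -> : -1 * - h = h by ring.
by rewrite (Rabs_left h); [|lra].
Qed.

(** The coordinates are changed one after the other, and [r] is the length of the path so far; this
    reduces estimates in several variables to one. *)
Lemma path_induction n (Q : R -> pt n -> Prop) (x y : pt n) :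
  Q 0 x -> (forall r z i h, 0 <= r -> Q r z -> Q (r + Rabs h) (upd z i h)) ->
  Q (\big[Rplus/0]_(c < n) Rabs (y c - x c)) y.
Proof.
move=> h0 hS.
pose z (j : nat) : pt n := fun c => if (c < j)%N then y c else x c.
have main j : (j <= n)%N -> Q (\big[Rplus/0]_(c < n | (c < j)%N) Rabs (y c - x c)) (z j).
  elim: j => [|j IH] hj.
    rewrite big_pred0 //; have -> // : z 0%N = x by apply: functional_extensionality.
  pose i : 'I_n := Ordinal hj.
  have -> : z j.+1 = upd (z j) i (y i - x i).
    apply: functional_extensionality => c; rewrite /z /upd ltnS leq_eqVlt -(inj_eq val_inj) /=.
    case: eqP => [e|_] //=; rewrite e ltnn; have -> : c = i by apply: val_inj.
    by ring.
  have -> : \big[Rplus/0]_(c < n | (c < j.+1)%N) Rabs (y c - x c) =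
     \big[Rplus/0]_(c < n | (c < j)%N) Rabs (y c - x c) + Rabs (y i - x i).
    rewrite (bigD1 i) /= ?ltnSn // Rplus_comm; congr (_ + _); apply: eq_bigl => c.
    by rewrite -(inj_eq val_inj) /=; lia.
  apply: hS; last by apply: IH; lia.
  by apply: rsum_ge0 => c _; exact: Rabs_pos.
have := main n (leqnn n); have -> : z n = y by apply: functional_extensionality => c; rewrite /z ltn_ord.
by rewrite (eq_bigl xpredT) // => c; rewrite ltn_ord.
Qed.

Lemma poly_growth n (P : mi n -> pt n -> R) p B lam b : chain P -> 0 <= B -> 0 <= lam ->
  (forall al x, (p < mabs al)%N -> P al x = 0) ->
  (forall al, Rabs (P al b) <= B * lam ^ mabs al) ->
  forall al x, Rabs (P al x) <= B * lam ^ mabs al * exp (lam * \big[Rplus/0]_(c < n) Rabs (x c - b c)).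
Proof.
move=> hP B0 l0 hhigh hb al x.
pose Q r (z : pt n) := forall al, Rabs (P al z) <= B * lam ^ mabs al * exp (lam * r).
suff : Q (\big[Rplus/0]_(c < n) Rabs (x c - b c)) x by apply.
apply: path_induction; first by move=> be; rewrite Rmult_0_r exp_0 Rmult_1_r.
move=> r z i h r0 hQ be.
have B1 : 0 <= B * exp (lam * r) by apply: Rmult_le_pos => //; left; exact: exp_pos.
have := @poly_growth1 n P p (B * exp (lam * r)) lam z i hP B1 l0 hhigh _ be h.
rewrite Rmult_plus_distr_l exp_plus => hh; apply: Rle_trans (hh _) _.
  by move=> ga; apply: Rle_trans (hQ ga) _; apply: Req_le; ring.
by apply: Req_le; ring.
Qed.

(** * Partitions of unity *)

Lemma derivable_locally_const (f : R -> R) (c l x r : R) : 0 < r ->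
  (forall y, Rabs (y - x) < r -> f y = c) -> derivable_pt_lim f x l -> l = 0.
Proof.
move=> r0 hf hd; apply: cond_eq => eps e0; have [[d d0] hdd] := hd eps e0.
pose h := Rmin r d / 2.
have m0 : 0 < Rmin r d by apply: Rmin_case.
have h0 : 0 < h by rewrite /h; lra.
have hr : h < r by rewrite /h; have := Rmin_l r d; lra.
have hd' : h < d by rewrite /h; have := Rmin_r r d; lra.
have := hdd h ltac:(lra) ltac:(rewrite Rabs_right /=; lra).
rewrite hf ?hf; first by rewrite Rminus_diag /Rdiv Rmult_0_l; split_Rabs; lra.
- by rewrite Rminus_diag Rabs_R0.
- have -> : x + h - x = h by ring.
  by rewrite Rabs_right; lra.
Qed.

Lemma sum_ones (I : Type) (r : seq I) : \big[Rplus/0]_(i <- r) 1 = INR (size r).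
Proof.
elim: r => [|i r IH]; first by rewrite big_nil.
by rewrite big_cons IH -[size (i :: r)]/(size r).+1 S_INR Rplus_comm.
Qed.

Lemma sum_near_le N z : \big[Rplus/0]_(j < N | Rleb (Rabs (z - INR j)) 2) 1 <= 5.
Proof.
pose P j := Rleb (Rabs (z - INR j)) 2.
rewrite -(big_mkord P (fun=> 1)) -big_filter sum_ones.
suff h : (size [seq i <- index_iota 0 N | P i] <= 5)%N.
  by apply: Rle_trans (INR_le h) _; rewrite /=; lra.
case: (boolP (has P (index_iota 0 N))) => [/hasP[j1 _ hj1]|]; last first.
  by rewrite has_filter negbK => /eqP ->.
have ex : exists j, P j by exists j1.
case: (ex_minnP ex) => j0 /RlebP hj0 hmin.
rewrite -(size_iota j0 5); apply: uniq_leq_size; first by rewrite filter_uniq ?iota_uniq.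
move=> j; rewrite mem_filter mem_iota => /andP[hj _]; rewrite mem_iota (hmin j hj) /=.
move/RlebP: hj => hj; rewrite ltnNge; apply/negP => /INR_le; rewrite plus_INR /=.
by move: hj0 hj; split_Rabs; lra.
Qed.

Section Window.
Variables (delta : R) (s : nat -> R -> R) (b : nat -> R).
Hypotheses (d0 : 0 < delta) (hs : forall k y, derivable_pt_lim (s k) y (s k.+1 y))
  (sl : forall y, y <= 0 -> s 0%N y = 0) (sr : forall y, 2 * delta <= y -> s 0%N y = 1)
  (sb : forall k y, Rabs (s k y) <= b k).

(** Translates by multiples of [delta] telescope, so they add up to 1 whatever the step does between
    0 and [2 * delta]. *)
Definition window k y := s k (y + delta) - s k y.

Lemma step_left k y : y < 0 -> s k y = 0.
Proof.
elim: k y => [|k IH] y hy; first by apply: sl; lra.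
apply: (derivable_locally_const (c := 0) (r := - y) _ _ (hs k y)); first lra.
by move=> z hz; apply: IH; move: hz; split_Rabs; lra.
Qed.

Lemma step_right k y : 2 * delta < y -> s k y = if k == 0%N then 1 else 0.
Proof.
elim: k y => [|k IH] y hy; first by apply: sr; lra.
apply: (derivable_locally_const (r := y - 2 * delta) _ _ (hs k y)); first lra.
by move=> z hz; apply: IH; move: hz; split_Rabs; lra.
Qed.

Lemma window_derivable k y : derivable_pt_lim (window k) y (window k.+1 y).
Proof. by apply: derivable_pt_lim_minus; [apply: derivable_shift; exact: hs|exact: hs]. Qed.

Lemma window_support k y : window k y <> 0 -> Rabs y <= 2 * delta.
Proof.
move=> h; apply: Rnot_lt_le => hy; apply: h; rewrite /window.
case: (Rle_dec 0 y) => h0.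
  have hy' : 2 * delta < y by move: hy; split_Rabs; lra.
  by rewrite !step_right; lra.
have hy' : y < - (2 * delta) by move: hy; split_Rabs; lra.
by rewrite !step_left; lra.
Qed.

Lemma window_bound k y : Rabs (window k y) <= 2 * b k.
Proof. by rewrite /window; have := sb k y; have := sb k (y + delta); split_Rabs; lra. Qed.

Lemma window_sum k y G : Rabs y <= (INR G - 2) * delta ->
  \big[Rplus/0]_(j < (2 * G).+1) window k (y - delta * (INR j - INR G)) = if k == 0%N then 1 else 0.
Proof.
move=> hy.
have tel N : \big[Rplus/0]_(j < N) window k (y - delta * (INR j - INR G)) =
  s k (y + delta * (INR G + 1)) - s k (y + delta * (INR G + 1) - delta * INR N).
  elim: N => [|N IH]; first by rewrite big_ord0 /= Rmult_0_r Rminus_0_r; ring.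
  rewrite big_ord_recr [LHS]/= IH /window S_INR.
  have -> : y - delta * (INR N - INR G) + delta = y + delta * (INR G + 1) - delta * INR N by ring.
  have -> : y + delta * (INR G + 1) - delta * (INR N + 1) = y - delta * (INR N - INR G) by ring.
  ring.
rewrite tel S_INR mult_INR /=.
have gd := Rmult_le_pos _ _ (pos_INR G) (Rlt_le _ _ d0).
rewrite step_right; last by move: hy; split_Rabs; lra.
by rewrite step_left; [ring|move: hy; split_Rabs; lra].
Qed.

Lemma window_abs_sum k y N G : 0 <= b k ->
  \big[Rplus/0]_(j < N) Rabs (window k (y - delta * (INR j - INR G))) <= 10 * b k.
Proof.
move=> b0; pose z := y / delta + INR G.
apply: (Rle_trans _ (\big[Rplus/0]_(j < N | Rleb (Rabs (z - INR j)) 2) (2 * b k * 1))).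
  rewrite [X in _ <= X]big_mkcond; apply: rsum_le => j _.
  case: RlebP => h; first by have := window_bound k (y - delta * (INR j - INR G)); lra.
  have -> : window k (y - delta * (INR j - INR G)) = 0; last by rewrite Rabs_R0; lra.
  apply: NNPP => hn; apply: h; have := window_support hn.
  have -> : y - delta * (INR j - INR G) = delta * (z - INR j) by rewrite /z; field; lra.
  rewrite Rabs_mult (Rabs_right delta); last lra.
  by rewrite (Rmult_comm 2) => /Rmult_le_reg_l; apply.
rewrite rsumZ; apply: Rle_trans (Rmult_le_compat_l (2 * b k) _ _ _ (sum_near_le N z)) _; lra.
Qed.

Definition cell n (G : nat) (g : {ffun 'I_n -> 'I_(2 * G).+1}) (a : mi n) (x : pt n) : R :=
  \big[Rmult/1]_(c < n) window (a c) (x c - delta * (INR (g c) - INR G)).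

Lemma cell_chain n G (g : {ffun 'I_n -> 'I_(2 * G).+1}) : chain (cell g).
Proof.
apply: (chain_tensor (u := fun c k y => window k (y - delta * (INR (g c) - INR G)))) => c k y.
exact: (derivable_shift (c := - (delta * (INR (g c) - INR G))) (window_derivable _ _)).
Qed.

Lemma cell_support n G (g : {ffun 'I_n -> 'I_(2 * G).+1}) a x : cell g a x <> 0 ->
  forall c, Rabs (x c - delta * (INR (g c) - INR G)) <= 2 * delta.
Proof.
move=> h c; apply: (@window_support (a c)) => e; apply: h.
by rewrite /cell (bigD1 c) //= e Rmult_0_l.
Qed.

Lemma cell_sum n G (x : pt n) a : (forall c, Rabs (x c) <= (INR G - 2) * delta) ->
  \big[Rplus/0]_(g : {ffun 'I_n -> 'I_(2 * G).+1}) cell g a x = if a == @mzero n then 1 else 0.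
Proof.
move=> hx; rewrite -(bigA_distr_bigA (fun c (j : 'I_(2 * G).+1) => window (a c) (x c - delta * (INR j - INR G)))).
rewrite (eq_bigr (fun c => if a c == 0%N then 1 else 0)) => [|c _]; last exact: window_sum.
case: eqP => [->|ne]; first by rewrite big1 // => c _; rewrite ffunE.
have [c hc] : exists c, a c != 0%N.
  apply/existsP; rewrite -negb_forall; apply/negP => /forallP h; apply: ne; apply/ffunP => c.
  by rewrite ffunE; apply/eqP; exact: h.
by rewrite (bigD1 c) //= (negbTE hc) Rmult_0_l.
Qed.

(** The sum over cells factors into one-dimensional sums, in each of which at most five windows are
    nonzero; so the bound is independent of [G]. *)
Lemma cell_abs_sum n G (x : pt n) (a : mi n) : (forall k, 0 <= b k) ->
  \big[Rplus/0]_(g : {ffun 'I_n -> 'I_(2 * G).+1}) Rabs (cell g a x) <=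
  \big[Rmult/1]_(c < n) (10 * b (a c)).
Proof.
move=> b0; rewrite (eq_bigr (fun g : {ffun 'I_n -> 'I_(2 * G).+1} =>
  \big[Rmult/1]_(c < n) Rabs (window (a c) (x c - delta * (INR (g c) - INR G))))) => [|g _]; last exact: rprod_abs.
rewrite -(bigA_distr_bigA (fun c (j : 'I_(2 * G).+1) => Rabs (window (a c) (x c - delta * (INR j - INR G))))).
apply: rprod_le => c _; split; first by apply: rsum_ge0 => j _; exact: Rabs_pos.
exact: window_abs_sum.
Qed.
End Window.

Lemma wmat_ge_const om rho k : is_weight_function om -> 0 < rho -> 1 <= exp (om 1 / rho) * wmat om rho k.
Proof. by move=> hom r0; have := wmat_pow_le hom k r0 (r := 1) ltac:(lra); rewrite pow1; lra. Qed.

Lemma wmat_prod_le n om rho (a : mi n) : is_weight_function om -> 0 < rho ->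
  \big[Rmult/1]_(c < n) wmat om rho (a c) <= exp (om 1 / rho) * wmat om rho (mabs a).
Proof.
move=> hom r0; rewrite /mabs; elim: (index_enum _) => [|c r IH].
  by rewrite !big_nil; exact: wmat_ge_const.
rewrite !big_cons; apply: Rle_trans (Rmult_le_compat_l _ _ _ (Rlt_le _ _ (wmat_gt0 om rho (a c))) IH) _.
rewrite -Rmult_assoc (Rmult_comm (wmat _ _ _)) Rmult_assoc.
by apply: Rmult_le_compat_l; [left; exact: exp_pos|exact: wmat_mulM].
Qed.

Lemma cutoff_family n (om : R -> R) (K : nat -> R) (A eta : R) : is_weight_function om ->
  0 < A -> 0 < eta ->
  (forall m I, \big[Rplus/0]_(l < I) ((/ 2) ^ (m + l) * dy om (m + l)) <= K m) ->
  exists (rho C : R) (m0 : nat), 0 < rho /\ 0 < C /\ forall m delta G, (m0 <= m)%N ->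
    0 < delta -> A * K m <= delta ->
    exists Th : {ffun 'I_n -> 'I_(2 * G).+1} -> mi n -> pt n -> R,
      (forall g, chain (Th g)) /\
      (forall g a x, Th g a x <> 0 -> forall c, Rabs (x c - delta * (INR (g c) - INR G)) <= 2 * delta) /\
      (forall x, (forall c, Rabs (x c) <= (INR G - 2) * delta) -> forall a,
         \big[Rplus/0]_g Th g a x = if a == @mzero n then 1 else 0) /\
      forall a x, \big[Rplus/0]_g Rabs (Th g a x) <= C * exp (eta * dy om m) * wmat om rho (mabs a).
Proof.
move=> hom A0 eta0 hK.
have n0 : 0 < INR n + 1 by have := pos_INR n; lra.
(* A cell collects one exponential factor per coordinate, so [eta] is divided by [n + 1]
   beforehand. *)
have [rho [C [m0 [rho0 [C0 hstep]]]]] := weight_step hom A0 (Rdiv_lt_0_compat _ _ eta0 n0) hK.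
exists rho, ((10 * C) ^ n * exp (om 1 / rho)), m0; split => //; split.
  by apply: Rmult_lt_0_compat; [apply: pow_lt; lra|exact: exp_pos].
move=> m delta G hm d0 hd; have [s [s1 [s2 [s3 s4]]]] := hstep m delta hm d0 hd.
exists (@cell delta s n G); split; first by move=> g; exact: cell_chain.
split; first by move=> g a x; exact: (cell_support d0 s1 s2 s3 s4).
split; first by move=> x hx a; exact: (cell_sum d0 s1 s2 s3 s4).
move=> a x; set E := exp _ in s4.
have E0 : 0 < E by exact: exp_pos.
have W0 k : 0 < wmat om rho k by exact: exp_pos.
have CE : 0 < C * E by exact: Rmult_lt_0_compat.
apply: Rle_trans (cell_abs_sum d0 s1 s2 s3 s4 G x a _) _.
  by move=> k; apply: Rmult_le_pos; [lra|left].
rewrite (eq_bigr (fun c => 10 * C * E * wmat om rho (a c))) => [|c _]; last by ring.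
rewrite big_split /= rprod_const.
have hE : E ^ n <= exp (eta * dy om m).
  rewrite -exp_INR; apply: exp_le; have w0 := dy_ge0 hom m.
  have -> : INR n * (eta / (INR n + 1) * dy om m) = (eta * dy om m) * (INR n / (INR n + 1)) by field; lra.
  rewrite -[X in _ <= X]Rmult_1_r; apply: Rmult_le_compat_l; first by apply: Rmult_le_pos; lra.
  apply: (Rmult_le_reg_r (INR n + 1)) => //.
  have -> : INR n / (INR n + 1) * (INR n + 1) = INR n by field; lra.
  lra.
rewrite (Rpow_mult_distr (10 * C)).
have C10 : 0 < (10 * C) ^ n by apply: pow_lt; lra.
apply: (Rle_trans _ ((10 * C) ^ n * exp (eta * dy om m) * (exp (om 1 / rho) * wmat om rho (mabs a)))).
  apply: Rmult_le_compat; last exact: wmat_prod_le.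
  + by apply: Rmult_le_pos; [lra|apply: pow_le; lra].
  + by apply: rprod_ge0 => c _; left.
  + by apply: Rmult_le_compat_l; lra.
by apply: Req_le; ring.
Qed.

(** [m i] is the first level from [m0] on with [A * K m <= delta i]. Since [K] loses at most a
    factor 2 per level, [delta i] is within a factor 2 of [A * K (m i)]; dividing [delta] by 4,
    which is more, forces the levels to increase strictly. *)
Lemma levels (K : nat -> R) (A : R) (m0 : nat) : 0 < A -> (forall m, 0 < K m) ->
  (forall m, K m.+1 <= K m) -> (forall m, K m <= 2 * K m.+1) ->
  (forall eps, 0 < eps -> exists N, forall m, (N <= m)%N -> K m < eps) ->
  exists (delta : nat -> R) (m : nat -> nat), (forall i, 0 < delta i) /\
    (forall i, delta i.+1 = delta i / 4) /\ (forall i, A * K (m i) <= delta i) /\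
    (forall i, delta i <= 2 * A * K (m i)) /\ (forall i, (m0 <= m i)%N) /\
    forall i, (m i < m i.+1)%N.
Proof.
move=> A0 K0 Kd K2 Kl.
pose delta i := A * K m0 * (/ 4) ^ i.
have d4 i : delta i.+1 = delta i / 4 by rewrite /delta /=; field.
have dp i : 0 < delta i.
  by apply: Rmult_lt_0_compat; [apply: Rmult_lt_0_compat|apply: pow_lt; lra].
have dle i : delta i <= delta 0%N by elim: i => [|i IH]; [lra|rewrite d4; have := dp i; lra].
have hex i : exists m, (m0 <= m)%N /\ A * K m <= delta i /\ delta i <= 2 * A * K m.
  have ex : exists m, (m0 <= m)%N && Rleb (A * K m) (delta i).
    have [N hN] := Kl (delta i / A) (Rdiv_lt_0_compat _ _ (dp i) A0).
    exists (m0 + N)%N; rewrite leq_addr /=; apply/RlebP.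
    have := Rmult_lt_compat_l A _ _ A0 (hN (m0 + N)%N ltac:(lia)).
    have -> : A * (delta i / A) = delta i by field; lra.
    lra.
  case: (ex_minnP ex) => m /andP[h1 /RlebP h2] hmin; exists m; split => //; split => //.
  case: (ltngtP m0 m) => h; last 1 first.
  - have := dle i; rewrite -h /delta /= => hh.
    by have := Rmult_lt_0_compat _ _ A0 (K0 m0); lra.
  - apply: Rnot_lt_le => h3; have hm1 : (m0 <= m.-1)%N by lia.
    have := hmin m.-1; rewrite hm1 /=; case: RlebP => h4 /=.
      by move=> /(_ isT); lia.
    move=> _; apply: h4; have := K2 m.-1; have -> : m.-1.+1 = m by lia.
    by move/(Rmult_le_compat_l A _ _ (Rlt_le _ _ A0)); lra.
  - by lia.
pose m i := proj1_sig (constructive_indefinite_description _ (hex i)).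
have mP i : (m0 <= m i)%N /\ A * K (m i) <= delta i /\ delta i <= 2 * A * K (m i).
  by rewrite /m; case: constructive_indefinite_description.
have Kmono a b : (a <= b)%N -> K b <= K a.
  have hK l : - K l <= - K l.+1 by have := Kd l; lra.
  by move=> h; have := nat_nondecreasing hK h; lra.
exists delta, m; split => //; split => //; split; first by move=> i; case: (mP i) => _ [].
split; first by move=> i; case: (mP i) => _ [].
split; first by move=> i; case: (mP i).
move=> i; rewrite ltnNge; apply/negP => h; have := Kmono _ _ h.
move/(Rmult_le_compat_l A _ _ (Rlt_le _ _ A0)).
have := mP i; have := mP i.+1; rewrite d4; have := Rmult_lt_0_compat _ _ A0 (K0 (m i)).
by move=> h0 [_ [h1 h2]] [_ [h3 h4]]; lra.
Qed.

(** * Series of families of derivatives *)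

Lemma half_pow_lt B eps : 0 <= B -> 0 < eps -> exists N, forall m, (N <= m)%N -> B * (/ 2) ^ m < eps.
Proof.
move=> B0 e0; have [N hN] := archimed_nat (B / eps + 1); exists N => m hm.
have p2 : 0 < 2 ^ m by apply: pow_lt; lra.
apply: (Rmult_lt_reg_r (2 ^ m)) => //.
rewrite Rmult_assoc (Rmult_comm _ (2 ^ m)) pow2_half Rmult_1_r; have : INR N <= 2 ^ m.
  by apply: Rle_trans (INR_le hm) (INR_le_pow2 m).
move=> h; have := Rmult_lt_compat_l eps (B / eps) (2 ^ m) e0 ltac:(lra).
by have -> : eps * (B / eps) = B by field; lra.
Qed.

Lemma chain_mvt n (U : mi n -> pt n -> R) a i x h : chain U ->
  exists c, Rabs c <= Rabs h /\ U a (upd x i h) - U a x = h * U (mincr a i) (upd x i c).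
Proof.
move=> hU; case: (Rtotal_order 0 h) => [h0|[<-|h0]].
- have [c [e hc]] := MVT_cor2 (fun h => U a (upd x i h)) (fun h => U (mincr a i) (upd x i h)) 0 h h0
    (fun c _ => chain_at a i x c hU).
  by exists c; split; [split_Rabs; lra|rewrite upd0 in e; rewrite e; ring].
- by exists 0; rewrite upd0; split; [lra|ring].
- have [c [e hc]] := MVT_cor2 (fun h => U a (upd x i h)) (fun h => U (mincr a i) (upd x i h)) h 0 h0
    (fun c _ => chain_at a i x c hU).
  by exists c; split; [split_Rabs; lra|rewrite upd0 in e; lra].
Qed.

Lemma chain_second_order n (U : mi n -> pt n -> R) a i x h B : chain U ->
  (forall y, Rabs (U (mincr (mincr a i) i) y) <= B) ->
  Rabs (U a (upd x i h) - U a x - h * U (mincr a i) x) <= Rabs h * Rabs h * B.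
Proof.
move=> hU hB; have [c [hc ->]] := chain_mvt a i x h hU.
have [c' [_ e']] := chain_mvt (mincr a i) i x c hU.
rewrite -Rmult_minus_distr_l e' !Rabs_mult Rmult_assoc.
apply: Rmult_le_compat_l; first exact: Rabs_pos.
by apply: Rmult_le_compat => //; exact: Rabs_pos.
Qed.

Lemma chain_lipschitz n (U : mi n -> pt n -> R) a B : chain U ->
  (forall i y, Rabs (U (mincr a i) y) <= B) ->
  forall x y, Rabs (U a y - U a x) <= B * \big[Rplus/0]_(c < n) Rabs (y c - x c).
Proof.
move=> hU hB x y.
pose Q r (z : pt n) := Rabs (U a z - U a x) <= B * r.
apply: (path_induction (Q := Q)); first by rewrite /Q Rminus_diag Rabs_R0; lra.
move=> r z i h r0; rewrite /Q => hQ.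
suff : Rabs (U a (upd z i h) - U a z) <= B * Rabs h by move: hQ; split_Rabs; lra.
have [c [_ ->]] := chain_mvt a i z h hU.
by rewrite Rabs_mult Rmult_comm; apply: Rmult_le_compat_r; [exact: Rabs_pos|].
Qed.

Lemma chain_continuous n (U : mi n -> pt n -> R) (M : nat -> R) : chain U ->
  (forall a x, Rabs (U a x) <= M (mabs a)) -> forall a x, cont_at (U a) x.
Proof.
move=> hU hM a x eps e0; pose B := M (mabs a).+1.
have hB i y : Rabs (U (mincr a i) y) <= Rabs B.
  by apply: Rle_trans (hM _ _) _; rewrite mabs_mincr; exact: Rle_abs.
have B0 := Rabs_pos B; have n0 := pos_INR n.
have p : 0 < Rabs B * INR n + 1 by have := Rmult_le_pos _ _ B0 n0; lra.
exists (eps / (Rabs B * INR n + 1)); split; first exact: Rdiv_lt_0_compat.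
move=> y hy; apply: Rle_lt_trans (chain_lipschitz hU hB x y) _.
have : \big[Rplus/0]_(c < n) Rabs (y c - x c) <= INR n * dist y x.
  by rewrite -rsum_const; apply: rsum_le => c _; exact: coord_le_dist.
move/(Rmult_le_compat_l (Rabs B) _ _ B0) => h; apply: Rle_lt_trans h _.
have d0 : 0 <= dist y x by exact: sqrt_pos.
have := Rmult_lt_compat_r (Rabs B * INR n + 1) _ _ p hy.
have -> : eps / (Rabs B * INR n + 1) * (Rabs B * INR n + 1) = eps by field; lra.
lra.
Qed.

(** Differentiability of the limit comes from the second-order estimate for the partial sums: its
    constant does not depend on [N], so it passes to the limit pointwise. *)
Lemma chain_series n (G : nat -> mi n -> pt n -> R) (M : nat -> R) :
  (forall i, chain (G i)) -> (forall i a x, Rabs (G i a x) <= M (mabs a) * (/ 2) ^ i) ->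
  exists D, chain D /\ (forall a x, Rabs (D a x) <= 2 * M (mabs a)) /\
    forall N a x, Rabs (D a x - \big[Rplus/0]_(i < N) G i a x) <= 2 * M (mabs a) * (/ 2) ^ N.
Proof.
move=> hG hM; pose S N a x := \big[Rplus/0]_(i < N) G i a x.
have SS N a x : S N.+1 a x = S N a x + G N a x by rewrite /S big_ord_recr.
have M0 (a : mi n) : 0 <= M (mabs a).
  by have := hM 0%N a (@origin n); have := Rabs_pos (G 0%N a (@origin n)); rewrite /=; lra.
have h2 := half_pow_gt0.
have hS a x N N' : (N <= N')%N -> Rabs (S N' a x - S N a x) <= 2 * M (mabs a) * (/ 2) ^ N.
  move=> h; suff h1 : Rabs (S N' a x - S N a x) <= 2 * M (mabs a) * ((/ 2) ^ N - (/ 2) ^ N').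
    by have := Rmult_le_pos _ _ (M0 a) (Rlt_le _ _ (h2 N')); lra.
  elim: N' h => [|N' IH] h.
    by rewrite (_ : N = 0%N); [rewrite !Rminus_diag Rabs_R0; lra|lia].
  case: (ltngtP N N'.+1) => hN; [|by lia|by rewrite hN !Rminus_diag Rabs_R0; lra].
  have := IH ltac:(lia); have := hM N' a x; rewrite SS /=; split_Rabs; lra.
have conv a x : exists l, forall N, Rabs (l - S N a x) <= 2 * M (mabs a) * (/ 2) ^ N.
  apply: cauchy_rate_limit; first exact: hS.
  by move=> eps e0; apply: half_pow_lt => //; have := M0 a; lra.
pose D a x := proj1_sig (constructive_indefinite_description _ (conv a x)).
have hD a x N : Rabs (D a x - S N a x) <= 2 * M (mabs a) * (/ 2) ^ N.
  by rewrite /D; case: constructive_indefinite_description.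
have SM N a x : Rabs (S N a x) <= 2 * M (mabs a).
  by have := hS a x 0%N N (leq0n _); rewrite /S big_ord0 Rminus_0_r /= Rmult_1_r.
exists D; split; [|split]; last by move=> N a x; exact: hD.
- move=> a i x; pose B := 2 * M (mabs (mincr (mincr a i) i)).
  have B0 : 0 <= B by have := M0 (mincr (mincr a i) i); rewrite /B; lra.
  have so h : Rabs (D a (upd x i h) - D a x - h * D (mincr a i) x) <= Rabs h * Rabs h * B.
    apply: le_epsilon => eps e0.
    pose C := 2 * M (mabs a) + 2 * M (mabs a) + Rabs h * (2 * M (mabs (mincr a i))).
    have C0 : 0 <= C.
      have := M0 a; have := M0 (mincr a i); have := Rabs_pos h => r1 r2 r3.
      by have := Rmult_le_pos _ _ r1 r2; rewrite /C; lra.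
    have [N hN] := half_pow_lt C0 e0.
    have cS : chain (S N) by apply: (@chain_sum n _ _ xpredT (fun i : 'I_N => G i)) => j _; exact: hG.
    have := hN N (leqnn _); have := @chain_second_order n (S N) a i x h B cS (SM N _).
    have := hD a (upd x i h) N; have := hD a x N; have := hD (mincr a i) x N.
    have : Rabs (h * D (mincr a i) x - h * S N (mincr a i) x) <= Rabs h * (2 * M (mabs (mincr a i)) * (/ 2) ^ N).
      by rewrite -Rmult_minus_distr_l Rabs_mult; apply: Rmult_le_compat_l; [exact: Rabs_pos|exact: hD].
    rewrite /C; set t1 := D a _; set t2 := S N a _; set t3 := D a x; set t4 := S N a x.
    set t5 := h * D _ _; set t6 := h * S _ _ _ => a1 _ a2 a3 a4 a5.
    have : 2 * M (mabs a) * (/ 2) ^ N + 2 * M (mabs a) * (/ 2) ^ N +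
       Rabs h * (2 * M (mabs (mincr a i)) * (/ 2) ^ N) < eps by lra.
    set z1 := 2 * M (mabs a) * _ in a2 a3 *; set z2 := Rabs h * (_ * _) in a1 *.
    set z3 := Rabs h * Rabs h * B in a4 *.
    by move: a1 a2 a3 a4; clear; split_Rabs; lra.
  move=> eps e0; have d0 : 0 < eps / (B + 1) by apply: Rdiv_lt_0_compat; lra.
  exists (mkposreal _ d0) => h hn hh; rewrite Rplus_0_l upd0.
  have -> : (D a (upd x i h) - D a x) / h - D (mincr a i) x = (D a (upd x i h) - D a x - h * D (mincr a i) x) / h.
    by field.
  have h0 : 0 < Rabs h by exact: Rabs_pos_lt.
  rewrite /Rdiv Rabs_mult Rabs_inv; apply: (Rmult_lt_reg_r (Rabs h)) => //.
  rewrite Rmult_assoc Rinv_l ?Rmult_1_r; last lra.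
  apply: Rle_lt_trans (so h) _.
  have hB : (B + 1) * Rabs h < eps.
    have := Rmult_lt_compat_l (B + 1) _ _ ltac:(lra) hh; rewrite /=.
    by have -> : (B + 1) * (eps / (B + 1)) = eps by field; lra.
  have := Rmult_lt_compat_l _ _ _ h0 hB.
  have := Rmult_lt_0_compat _ _ h0 h0; lra.
- by move=> a x; have := hD a x 0%N; rewrite /S big_ord0 Rminus_0_r /= Rmult_1_r.
Qed.

(** * Estimates for jets *)

(** With [lam = 4 * R0 * 2 ^ m], a good degree makes [R0 ^ k * S_k / lam ^ k] at most [(/ 2) ^ k * 2
    ^ m * exp (- (dy sg m / x0))]. Up to constants, [2 ^ m], the exponential and [lam ^ a] each cost
    an eighth of this exponent: the first by [ln t = o(sg t)], the second by the choice of [A], the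
    third by that of [z]. Five eighths remain and one half is claimed. The 20 is 14 for the distance
    of two anchors plus 6 for that of a point from its anchor. *)
Lemma poly_small n (om sg : R -> R) (C1 x0 R0 : R) :
  is_weight_function om -> is_weight_function sg -> 0 < C1 -> 0 < x0 -> 1 <= R0 ->
  (forall m, dy om m <= C1 * (dy sg m + 1)) ->
  exists A z Cp, 0 < A /\ 0 < z /\ 0 < Cp /\ forall k m delta a,
    good_degree sg x0 k m -> 2 ^ m * delta <= A * (dy sg m + 1) ->
    R0 ^ k * wmat sg x0 k * / (4 * R0 * 2 ^ m) ^ k * exp (4 * R0 * 2 ^ m * (20 * INR n * delta)) *
      (4 * R0 * 2 ^ m) ^ a
    <= Cp * (/ 2) ^ k * exp (- (dy sg m / (2 * x0))) * wmat om z a.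
Proof.
move=> hom hsg C10 x00 R1 hC.
have [D [D1 hD]] := om_scale hom (A := 4 * R0) ltac:(lra).
have DC : 0 < D * (C1 + 1) by apply: Rmult_lt_0_compat; lra.
have x8 : 0 < 8 * x0 by lra.
have ix := Rinv_0_lt_compat _ x8.
have [C2 [C20 hC2]] := om_ln_le hsg ix.
have n0 := pos_INR n.
have nR : 0 < 80 * (INR n + 1) * R0 by nra.
pose z := 8 * x0 * (D * (C1 + 1)).
have z0 : 0 < z by apply: Rmult_lt_0_compat.
exists (/ (8 * x0) * / (80 * (INR n + 1) * R0)), z, (exp (C2 + 2 * / (8 * x0))).
split; first by apply: Rmult_lt_0_compat => //; exact: Rinv_0_lt_compat.
split => //; split; first exact: exp_pos.
move=> k m delta a hgood hdelta.
have p2 := pow2_ge1 m; have s0 := dy_ge0 hsg m.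
set lam := 4 * R0 * 2 ^ m; have l1 : 1 <= lam by rewrite /lam; nra.
have h1 : lam ^ a <= wmat om z a * exp (/ (8 * x0) * (dy sg m + 1)).
  apply: Rle_trans (wmat_pow_le hom a z0 l1) _.
  apply: Rmult_le_compat_l; first by left; exact: exp_pos.
  apply: exp_le; apply: (Rmult_le_reg_r z) => //.
  have -> : om lam / z * z = om lam by field; lra.
  have -> : / (8 * x0) * (dy sg m + 1) * z = D * (C1 + 1) * (dy sg m + 1) by rewrite /z; field; lra.
  have := hD (2 ^ m) ltac:(lra); rewrite -/lam -/(dy om m).
  have := Rmult_le_compat_l D _ _ ltac:(lra) (hC m).
  have : 0 <= D * dy sg m by apply: Rmult_le_pos; lra.
  lra.
have h2 : exp (lam * (20 * INR n * delta)) <= exp (/ (8 * x0) * (dy sg m + 1)).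
  apply: exp_le; case: (Rle_dec 0 delta) => hd; last first.
    have : lam * (20 * INR n * delta) <= 0.
      have : 0 <= lam * (20 * INR n) by apply: Rmult_le_pos; lra.
      by move=> h; have := Rmult_le_compat_l _ delta 0 h ltac:(lra); lra.
    have : 0 <= / (8 * x0) * (dy sg m + 1) by apply: Rmult_le_pos; lra.
    lra.
  apply: (Rle_trans _ (80 * (INR n + 1) * R0 * (2 ^ m * delta))).
    have : 0 <= R0 * (2 ^ m * delta) by apply: Rmult_le_pos; [lra|apply: Rmult_le_pos; lra].
    by rewrite /lam; lra.
  apply: Rle_trans (Rmult_le_compat_l _ _ _ (Rlt_le _ _ nR) hdelta) _.
  by apply: Req_le; field; lra.
have h3 : R0 ^ k * wmat sg x0 k * / lam ^ k <= (/ 2) ^ k * (2 ^ m * exp (- (dy sg m / x0))).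
  have lk : 0 < lam ^ k by apply: pow_lt; lra.
  apply: (Rmult_le_reg_r (lam ^ k)) => //.
  rewrite Rmult_assoc Rinv_l ?Rmult_1_r; last lra.
  apply: Rle_trans (Rmult_le_compat_l _ _ _ _ hgood) _; first by apply: pow_le; lra.
  have e1 : R0 ^ k * (2 * 2 ^ m) ^ k = (/ 2) ^ k * lam ^ k.
    by rewrite -!Rpow_mult_distr /lam; congr (_ ^ _); field.
  by apply: Req_le; rewrite -Rmult_assoc e1; ring.
have h4 : 2 ^ m <= exp (/ (8 * x0) * dy sg m + C2).
  by rewrite -(exp_ln (2 ^ m)); [apply: exp_le; exact: hC2|lra].
set e := exp (/ (8 * x0) * (dy sg m + 1)) in h1 h2.
have e0 : 0 < e by exact: exp_pos.
have w0 := wmat_gt0 om z a.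
have hk := half_pow_gt0 k.
have E0 := exp_pos (- (dy sg m / x0)).
apply: (Rle_trans _ ((/ 2) ^ k * (2 ^ m * exp (- (dy sg m / x0))) * e * (wmat om z a * e))).
  have q0 : 0 <= R0 ^ k * wmat sg x0 k * / lam ^ k.
    apply: Rmult_le_pos; first apply: Rmult_le_pos; [by apply: pow_le; lra|by left; exact: exp_pos|].
    by left; apply: Rinv_0_lt_compat; apply: pow_lt; lra.
  apply: Rmult_le_compat; last exact: h1.
  - by apply: Rmult_le_pos => //; left; exact: exp_pos.
  - by apply: pow_le; lra.
  - by apply: Rmult_le_compat => //; left; exact: exp_pos.
have key : 2 ^ m * exp (- (dy sg m / x0)) * e * e <= exp (C2 + 2 * / (8 * x0)) * exp (- (dy sg m / (2 * x0))).
  apply: (Rle_trans _ (exp (/ (8 * x0) * dy sg m + C2) * exp (- (dy sg m / x0)) * e * e)).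
    by do 3 (apply: Rmult_le_compat_r; first lra).
  rewrite /e -!exp_plus; apply: exp_le.
  have -> : dy sg m / x0 = 8 * (/ (8 * x0) * dy sg m) by field; lra.
  have -> : dy sg m / (2 * x0) = 4 * (/ (8 * x0) * dy sg m) by field; lra.
  have : 0 <= / (8 * x0) * dy sg m by apply: Rmult_le_pos; lra.
  lra.
have -> : (/ 2) ^ k * (2 ^ m * exp (- (dy sg m / x0))) * e * (wmat om z a * e) =
  ((/ 2) ^ k * wmat om z a) * (2 ^ m * exp (- (dy sg m / x0)) * e * e) by ring.
apply: Rle_trans (Rmult_le_compat_l _ _ _ _ key) _; first by apply: Rmult_le_pos; lra.
by apply: Req_le; ring.
Qed.

Section Jet.
Variables (n : nat) (om sg : R -> R) (x0 R0 CF A z Cp : R) (E : pt n -> Prop) (F : mi n -> pt n -> R).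
Hypotheses (R1 : 1 <= R0) (CF0 : 0 < CF) (Cp0 : 0 < Cp)
  (hsmall : forall k m delta a,
    good_degree sg x0 k m -> 2 ^ m * delta <= A * (dy sg m + 1) ->
    R0 ^ k * wmat sg x0 k * / (4 * R0 * 2 ^ m) ^ k * exp (4 * R0 * 2 ^ m * (20 * INR n * delta)) *
      (4 * R0 * 2 ^ m) ^ a
    <= Cp * (/ 2) ^ k * exp (- (dy sg m / (2 * x0))) * wmat om z a)
  (hF1 : forall al a, E a -> Rabs (F al a) <= CF * R0 ^ mabs al * wmat sg x0 (mabs al))
  (hF2 : forall al (p : nat) a b, (mabs al <= p)%N -> E a -> E b ->
       Rabs (taylor_rem F p a al b) <=
         CF * R0 ^ (p.+1) * wmat sg x0 (p.+1) * dist b a ^ (p.+1 - mabs al)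
           / INR (factorial (p.+1 - mabs al))).

Lemma sum_coord_le (x a : pt n) r : (forall c, Rabs (x c - a c) <= r) ->
  \big[Rplus/0]_(c < n) Rabs (x c - a c) <= INR n * r.
Proof. by move=> h; rewrite -rsum_const; apply: rsum_le => c _. Qed.

Lemma poly_growth_scaled (P : mi n -> pt n -> R) p k m delta (a x : pt n) d :
  chain P -> (forall al y, (p < mabs al)%N -> P al y = 0) ->
  good_degree sg x0 k m -> 2 ^ m * delta <= A * (dy sg m + 1) ->
  d <= 14 * INR n * delta -> (forall c, Rabs (x c - a c) <= 6 * delta) ->
  (forall al, Rabs (P al a) <= CF * (R0 ^ k * wmat sg x0 k * / (4 * R0 * 2 ^ m) ^ k) *
     exp (4 * R0 * 2 ^ m * d) * (4 * R0 * 2 ^ m) ^ mabs al) ->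
  forall al, Rabs (P al x) <= CF * Cp * (/ 2) ^ k * exp (- (dy sg m / (2 * x0))) * wmat om z (mabs al).
Proof.
move=> hP hhigh hgood hdelta hd hx hb al.
have p2 := pow2_ge1 m; set lam := 4 * R0 * 2 ^ m in hb *; have l1 : 1 <= lam by rewrite /lam; nra.
set Q := R0 ^ k * _ * _ in hb *.
have Q0 : 0 < Q.
  apply: Rmult_lt_0_compat; first apply: Rmult_lt_0_compat; [by apply: pow_lt; lra|exact: exp_pos|].
  by apply: Rinv_0_lt_compat; apply: pow_lt; lra.
have E0 : 0 < exp (lam * d) by exact: exp_pos.
have B0 : 0 < CF * Q * exp (lam * d) by apply: Rmult_lt_0_compat => //; exact: Rmult_lt_0_compat.
have := poly_growth hP (Rlt_le _ _ B0) (lam := lam) ltac:(lra) hhigh hb al x.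
move=> h; apply: Rle_trans h _.
have := hsmall (mabs al) hgood hdelta; rewrite -/lam -/Q => h.
have {h} := Rmult_le_compat_l CF _ _ ltac:(lra) h.
have -> : CF * (Cp * (/ 2) ^ k * exp (- (dy sg m / (2 * x0))) * wmat om z (mabs al)) =
  CF * Cp * (/ 2) ^ k * exp (- (dy sg m / (2 * x0))) * wmat om z (mabs al) by ring.
apply: Rle_trans.
have -> : CF * Q * exp (lam * d) * lam ^ mabs al * exp (lam * \big[Rplus/0]_(c < n) Rabs (x c - a c)) =
  CF * (Q * exp (lam * d + lam * \big[Rplus/0]_(c < n) Rabs (x c - a c)) * lam ^ mabs al) by rewrite exp_plus; ring.
apply: Rmult_le_compat_l; first lra.
apply: Rmult_le_compat_r; first by apply: pow_le; lra.
apply: Rmult_le_compat_l; first lra.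
apply: exp_le; rewrite -Rmult_plus_distr_l; apply: Rmult_le_compat_l; first lra.
by have := sum_coord_le hx; lra.
Qed.

(** At [a] the derivatives of the difference are the remainders [taylor_rem F p b], and [dist ^ j /
    j! <= exp (lam * dist) / lam ^ j] brings the jet estimate of order [p + 1] into the form that
    propagates to [x]. *)
Lemma tpoly_diff_small p m delta (a b x : pt n) al :
  E a -> E b -> good_degree sg x0 p.+1 m -> 2 ^ m * delta <= A * (dy sg m + 1) ->
  (forall c, Rabs (x c - a c) <= 6 * delta) -> (forall c, Rabs (a c - b c) <= 14 * delta) ->
  Rabs (tpoly F p a al x - tpoly F p b al x) <=
    CF * Cp * (/ 2) ^ p.+1 * exp (- (dy sg m / (2 * x0))) * wmat om z (mabs al).
Proof.
move=> ha hb hgood hdelta hxa hab.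
have p2 := pow2_ge1 m.
apply: (@poly_growth_scaled (fun al x => tpoly F p a al x - tpoly F p b al x) p p.+1 m delta a x (dist a b)) => //.
- by apply: chain_sub; exact: chain_tpoly.
- by move=> ga y h; rewrite !tpoly_high // Rminus_diag.
- by apply: Rle_trans (dist_le_sum _ _) _; have := sum_coord_le hab; lra.
move=> ga; set lam := 4 * R0 * 2 ^ m; have l1 : 1 <= lam by rewrite /lam; nra.
have d0 : 0 <= dist a b by exact: sqrt_pos.
have S0 : 0 < wmat sg x0 p.+1 by exact: exp_pos.
have Rp : 0 < R0 ^ p.+1 by apply: pow_lt; lra.
have lk : 0 < / lam ^ p.+1 by apply: Rinv_0_lt_compat; apply: pow_lt; lra.
case: (leqP (mabs ga) p) => h; last first.
  rewrite !tpoly_high // Rminus_diag Rabs_R0.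
  apply: Rmult_le_pos; last by apply: pow_le; lra.
  apply: Rmult_le_pos; last by left; exact: exp_pos.
  by apply: Rmult_le_pos; [lra|apply: Rmult_le_pos; [apply: Rmult_le_pos|]; lra].
rewrite tpoly_diag //; have -> : F ga a - tpoly F p b ga a = taylor_rem F p b ga a.
  by rewrite /tpoly h; ring.
apply: Rle_trans (hF2 h hb ha) _; set j := (p.+1 - mabs ga)%N.
have lj : 0 < lam ^ j by apply: pow_lt; lra.
have := pow_le_fact_exp j (z := lam * dist a b) ltac:(apply: Rmult_le_pos; lra).
rewrite Rpow_mult_distr => he.
have e1 : lam ^ p.+1 = lam ^ j * lam ^ mabs ga by rewrite -Rdef_pow_add; congr (_ ^ _); rewrite /j; lia.
have lg : 0 < lam ^ mabs ga by apply: pow_lt; lra.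
have f0 := INR_fact_gt0 j.
apply: (Rle_trans _ (CF * (R0 ^ p.+1 * wmat sg x0 p.+1 * / lam ^ p.+1) *
    (lam ^ j * dist a b ^ j / INR j`!) * lam ^ mabs ga)).
  by apply: Req_le; rewrite e1; field; lra.
apply: Rmult_le_compat_r; first lra.
apply: Rmult_le_compat_l => //.
by apply: Rmult_le_pos; [lra|apply: Rmult_le_pos; [apply: Rmult_le_pos|]; lra].
Qed.

(** At the anchor only the derivatives of order exactly [k + 1] of the added homogeneous part are
    nonzero, and they are values of the jet. *)
Lemma tpoly_step_small k m delta (a x : pt n) al : E a ->
  good_degree sg x0 k.+1 m -> 2 ^ m * delta <= A * (dy sg m + 1) ->
  0 <= delta -> (forall c, Rabs (x c - a c) <= 6 * delta) ->
  Rabs (tpoly F k.+1 a al x - tpoly F k a al x) <=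
    CF * Cp * (/ 2) ^ k.+1 * exp (- (dy sg m / (2 * x0))) * wmat om z (mabs al).
Proof.
move=> ha hgood hdelta d0 hxa.
have p2 := pow2_ge1 m.
apply: (@poly_growth_scaled (fun al x => tpoly F k.+1 a al x - tpoly F k a al x) k.+1 k.+1 m delta a x 0) => //.
- by apply: chain_sub; exact: chain_tpoly.
- by move=> ga y h; rewrite !tpoly_high; [rewrite Rminus_diag|lia|lia].
- by have := pos_INR n => n0; apply: Rmult_le_pos => //; lra.
move=> ga; set lam := 4 * R0 * 2 ^ m; have l1 : 1 <= lam by rewrite /lam; nra.
have S0 : 0 < wmat sg x0 k.+1 by exact: exp_pos.
have Rp : 0 < R0 ^ k.+1 by apply: pow_lt; lra.
have lk : 0 < / lam ^ k.+1 by apply: Rinv_0_lt_compat; apply: pow_lt; lra.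
have q0 : 0 <= CF * (R0 ^ k.+1 * wmat sg x0 k.+1 * / lam ^ k.+1).
  by apply: Rmult_le_pos; [lra|apply: Rmult_le_pos; [apply: Rmult_le_pos|]; lra].
rewrite Rmult_0_r exp_0 Rmult_1_r.
case: (ltngtP (mabs ga) k.+1) => h; last 1 first.
- rewrite tpoly_diag ?h // tpoly_high ?h // Rminus_0_r.
  apply: Rle_trans (hF1 _ ha) _; rewrite h; apply: Req_le; field.
  by have : 0 < lam ^ k.+1 by [apply: pow_lt; lra]; rewrite /lam; nra.
- rewrite !tpoly_diag ?Rminus_diag ?Rabs_R0; [|by lia|by lia].
  by apply: Rmult_le_pos => //; apply: pow_le; lra.
- rewrite !tpoly_high ?Rminus_diag ?Rabs_R0; [|by lia|by lia].
  by apply: Rmult_le_pos => //; apply: pow_le; lra.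
Qed.

Lemma tpoly_steps_small p p' m0 delta (a x : pt n) al : is_weight_function sg -> 0 < x0 -> E a -> (p <= p')%N ->
  (forall k, (p < k)%N -> (k <= p')%N -> exists m, (m0 <= m)%N /\ good_degree sg x0 k m /\
     2 ^ m * delta <= A * (dy sg m + 1)) ->
  0 <= delta -> (forall c, Rabs (x c - a c) <= 6 * delta) ->
  Rabs (tpoly F p' a al x - tpoly F p a al x) <=
    CF * Cp * exp (- (dy sg m0 / (2 * x0))) * wmat om z (mabs al).
Proof.
move=> hsg x00 ha hp hk d0 hxa; set B := CF * Cp * _ * _.
have B0 : 0 < B.
  by apply: Rmult_lt_0_compat; [apply: Rmult_lt_0_compat; [exact: Rmult_lt_0_compat|]|]; exact: exp_pos.
(* Each degree brings its own factor [(/ 2) ^ k], so the number of degrees between [p] and [p'],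
   which is not controlled, does not enter. *)
suff : Rabs (tpoly F p' a al x - tpoly F p a al x) <= B * ((/ 2) ^ p - (/ 2) ^ p').
  move=> h; apply: Rle_trans h _; rewrite -[X in _ <= X]Rmult_1_r; apply: Rmult_le_compat_l; first lra.
  have := half_pow_gt0 p'.
  have : (/ 2) ^ p <= 1 by rewrite -(pow1 p); apply: pow_incr; lra.
  lra.
elim: p' hp hk => [|p' IH] hp hk.
  by rewrite (_ : p = 0%N); [rewrite !Rminus_diag Rabs_R0; lra|lia].
case: (ltngtP p p'.+1) => h; [|by lia|by rewrite h !Rminus_diag Rabs_R0; lra].
have [m [hm [hg hd]]] := hk p'.+1 h (leqnn _).
have h1 := tpoly_step_small al ha hg hd d0 hxa.
have h2 := IH ltac:(lia) (fun k h1 h2 => hk k h1 (leqW h2)).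
have : CF * Cp * (/ 2) ^ p'.+1 * exp (- (dy sg m / (2 * x0))) * wmat om z (mabs al) <= B * (/ 2) ^ p'.+1.
  rewrite /B; have -> : CF * Cp * (/ 2) ^ p'.+1 * exp (- (dy sg m / (2 * x0))) * wmat om z (mabs al) =
    CF * Cp * (/ 2) ^ p'.+1 * wmat om z (mabs al) * exp (- (dy sg m / (2 * x0))) by ring.
  have -> : CF * Cp * exp (- (dy sg m0 / (2 * x0))) * wmat om z (mabs al) * (/ 2) ^ p'.+1 =
    CF * Cp * (/ 2) ^ p'.+1 * wmat om z (mabs al) * exp (- (dy sg m0 / (2 * x0))) by ring.
  apply: Rmult_le_compat_l.
    left; apply: Rmult_lt_0_compat; last exact: exp_pos.
    by apply: Rmult_lt_0_compat; [exact: Rmult_lt_0_compat|apply: pow_lt; lra].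
  apply: exp_le; apply: Ropp_le_contravar; apply: Rmult_le_compat_r; last exact: dy_mono.
  by left; apply: Rinv_0_lt_compat; lra.
have -> : B * ((/ 2) ^ p - (/ 2) ^ p'.+1) = B * ((/ 2) ^ p - (/ 2) ^ p') + B * (/ 2) ^ p'.+1 by rewrite /=; field.
by move: h1 h2; split_Rabs; lra.
Qed.
End Jet.

(** * The extension *)

(** The grid size depends on the scale, so it is packed together with the cutoffs. *)
Record patch n := Patch {
  pgrid : nat;
  pcut : {ffun 'I_n -> 'I_(2 * pgrid).+1} -> mi n -> pt n -> R;
  panchor : {ffun 'I_n -> 'I_(2 * pgrid).+1} -> pt n }.

(** Cutoffs of cells far from [E] are to be dropped, so the total is 1 only within [2 * delta] of
    [E]. The radius 6 is 2 for the support of a cell plus 4 for the distance of its centre from the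
    anchor. *)
Definition is_patch n (E : pt n -> Prop) (delta c : R) (W : nat -> R) (P : patch n) : Prop :=
  (forall g, chain (@pcut n P g)) /\
  (forall g a x, @pcut n P g a x <> 0 ->
     E (panchor g) /\ forall i, Rabs (x i - @panchor n P g i) <= 6 * delta) /\
  (forall b x, E b -> (forall i, Rabs (x i - b i) <= 2 * delta) -> forall a,
     \big[Rplus/0]_g @pcut n P g a x = if a == @mzero n then 1 else 0) /\
  forall a x, \big[Rplus/0]_g Rabs (@pcut n P g a x) <= c * W (mabs a).

Lemma patch_exists n (om : R -> R) (K : nat -> R) (A eta B0 : R) (E : pt n -> Prop) : is_weight_function om ->
  0 < A -> 0 < eta ->
  (forall m I, \big[Rplus/0]_(l < I) ((/ 2) ^ (m + l) * dy om (m + l)) <= K m) ->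
  (forall b i, E b -> Rabs (b i) <= B0) ->
  exists (rho C : R) (m0 : nat), 0 < rho /\ 0 < C /\ forall m delta, (m0 <= m)%N ->
    0 < delta -> A * K m <= delta ->
    exists P, is_patch E delta (C * exp (eta * dy om m)) (wmat om rho) P.
Proof.
move=> hom A0 eta0 hK hB.
have [rho [C [m0 [rho0 [C0 hcut]]]]] := cutoff_family n hom A0 eta0 hK.
exists rho, C, m0; split => //; split => // m delta hm d0 hd.
(* Large enough that the [2 * delta]-neighbourhood of [E] lies where the full grid adds up to 1. *)
have [G hG] := archimed_nat (B0 / delta + 4).
have {}hG : B0 + 4 * delta <= INR G * delta.
  have := Rmult_le_compat_r delta _ _ ltac:(lra) hG.
  by have -> : (B0 / delta + 4) * delta = B0 + 4 * delta by field; lra.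
have [Th [t1 [t2 [t3 t4]]]] := hcut m delta G hm d0 hd.
pose ctr (g : {ffun 'I_n -> 'I_(2 * G).+1}) : pt n := fun i => delta * (INR (g i) - INR G).
(* Radius 4 suffices: if a cutoff is nonzero at a point within [2 * delta] of some [b] in [E], its
   centre is within [4 * delta] of [b], so the cutoff is kept. *)
pose near g b := E b /\ forall i, Rabs (b i - ctr g i) <= 4 * delta.
have [anc hanc] : exists anc : {ffun 'I_n -> 'I_(2 * G).+1} -> pt n,
    forall g b, near g b -> near g (anc g).
  exists (fun g => epsilon (inhabits (@origin n)) (near g)) => g b hb.
  by apply: epsilon_spec; exists b.
pose isnear g := if excluded_middle_informative (near g (anc g)) then true else false.
pose Th' g a x := if isnear g then Th g a x else 0.
have Th'0 g a x : Th' g a x <> 0 -> near g (anc g) /\ Th g a x <> 0.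
  by rewrite /Th' /isnear; case: excluded_middle_informative.
exists (@Patch n G Th' anc); split; [|split; [|split]] => /=.
- move=> g; rewrite /Th' /isnear; case: excluded_middle_informative => h; first exact: t1.
  by move=> a i x; exact: derivable_pt_lim_const.
- move=> g a x /Th'0 [[h1 h2] /t2 h3]; split => // i.
  by move: (h2 i) (h3 i); rewrite /ctr; split_Rabs; lra.
- move=> b x hb hx a; rewrite -(t3 x) => [|i].
    apply: eq_bigr => g _; rewrite /Th'; case hn : (isnear g) => //.
    symmetry; apply: NNPP => /t2 h; move: hn; rewrite /isnear; case: excluded_middle_informative => // hn.
    case: hn; apply: (hanc g b); split => // i.
    by move: (h i) (hx i); rewrite /ctr; split_Rabs; lra.
  by have := hx i; have := hB b i hb; split_Rabs; lra.
- move=> a x; apply: Rle_trans (t4 a x); apply: rsum_le => g _.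
  by rewrite /Th'; case: ifP => _; [lra|rewrite Rabs_R0; exact: Rabs_pos].
Qed.

Definition mask n (P : patch n) (a : mi n) (x : pt n) : R := \big[Rplus/0]_g @pcut n P g a x.

(* The derivative of order [a] at [x] of [sum_g pcut g * T (panchor g)], where [V b] is the
   jet of [T b] at [x]. *)
Definition blend n (P : patch n) (V : pt n -> mi n -> R) (a : mi n) (x : pt n) : R :=
  \big[Rplus/0]_g leib (mlist a) ((@pcut n P g)^~ x) (V (panchor g)).

Section Patch.
Variables (n : nat) (E : pt n -> Prop) (delta c : R) (W : nat -> R) (P : patch n).
Hypothesis hP : is_patch E delta c W P.

Lemma mask_chain : chain (mask P).
Proof. by case: hP => h _; apply: (@chain_sum n _ _ xpredT) => g _; exact: h. Qed.

Lemma blend_chain (T : pt n -> mi n -> pt n -> R) : (forall b, chain (T b)) ->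
  chain (fun a x => blend P (fun b => (T b)^~ x) a x).
Proof.
move=> hT; case: hP => h _; apply: (@chain_sum n _ _ xpredT (fun g => fprod (pcut g) (T (panchor g)))) => g _.
exact: chain_fprod.
Qed.

Lemma mask_bound a x : Rabs (mask P a x) <= c * W (mabs a).
Proof. by case: hP => _ [_ [_ h]]; apply: Rle_trans (rsum_abs _ _ _) (h a x). Qed.

Lemma mask_one b x : E b -> (forall i, Rabs (x i - b i) <= 2 * delta) ->
  (mask P)^~ x = (fun a => if a == @mzero n then 1 else 0).
Proof.
by move=> hb hx; apply: functional_extensionality => a; case: hP => _ [_ [h _]]; exact: h hb hx a.
Qed.

Lemma blend_bound (V : pt n -> mi n -> R) (W2 W3 : nat -> R) B x a :
  0 <= B -> (forall k, 0 <= W2 k) -> (forall j k, W j * W2 k <= W3 (j + k)%N) ->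
  (forall b, E b -> (forall i, Rabs (x i - b i) <= 6 * delta) -> forall ga, Rabs (V b ga) <= B * W2 (mabs ga)) ->
  0 <= c ->
  Rabs (blend P V a x) <= 2 ^ mabs a * (c * B * W3 (mabs a)).
Proof.
move=> B0 W20 hW hV c0; case: hP => _ [h2 [_ h4]].
apply: Rle_trans (rsum_abs _ _ _) _; rewrite -(size_mlist a).
apply: leib_sum_bound => b ga e; rewrite size_mlist in e *.
apply: (Rle_trans _ (\big[Rplus/0]_g (B * W2 (mabs ga) * Rabs (@pcut n P g b x)))).
  apply: rsum_le => g _; case: (Req_dec (@pcut n P g b x) 0) => [->|h].
    by rewrite Rabs_R0 Rmult_0_l Rmult_0_r; lra.
  rewrite Rmult_comm; apply: Rmult_le_compat_r; first exact: Rabs_pos.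
  by have [h5 h6] := h2 _ _ _ h; exact: hV.
rewrite rsumZ; have BW : 0 <= B * W2 (mabs ga) by exact: Rmult_le_pos.
apply: Rle_trans (Rmult_le_compat_l _ _ _ BW (h4 b x)) _.
have -> : B * W2 (mabs ga) * (c * W (mabs b)) = c * B * (W (mabs b) * W2 (mabs ga)) by ring.
apply: Rmult_le_compat_l; first exact: Rmult_le_pos.
by rewrite -e; exact: hW.
Qed.

Lemma blend_sub (V V' : pt n -> mi n -> R) a x :
  blend P (fun b ga => V b ga - V' b ga) a x = blend P V a x - blend P V' a x.
Proof. by rewrite /blend -rsumB; apply: eq_bigr => g _; exact: leib_subr. Qed.

Lemma blend_const (V : mi n -> R) a x : blend P (fun=> V) a x = leib (mlist a) ((mask P)^~ x) V.
Proof. by rewrite /mask leib_suml. Qed.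

Lemma blend_zero (V : pt n -> mi n -> R) a x : (forall g b, @pcut n P g b x = 0) -> blend P V a x = 0.
Proof.
move=> h; apply: big1 => g _; rewrite (_ : (pcut g)^~ x = fun=> 0); first exact: leib0l.
by apply: functional_extensionality => b; exact: h.
Qed.
End Patch.

Lemma extension_sufficiency n (om sg : R -> R) C : (1 <= n)%N ->
  is_weight_function om -> is_weight_function sg -> 0 < C ->
  (forall t, 0 < t -> improper_int_1_le (fun u => om (t * u) / (u ^ 2)) (C * sg t + C)) ->
  forall E : pt n -> Prop, compact_Rn E -> jet_surjective om sg E.
Proof.
move=> n1 hom hsg C0 hint E [[B0 hB0] _] F [x0 [x00 [_ [CF [R' [CF0 [R'0 [hF1' hF2']]]]]]]].
pose R0 := Rmax 1 R'; have R1 : 1 <= R0 by exact: Rmax_l.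
have RR : R' <= R0 by exact: Rmax_r.
have Rpow k : R' ^ k <= R0 ^ k by apply: pow_incr; lra.
have S0 k : 0 < wmat sg x0 k by exact: exp_pos.
have hF1 al a : E a -> Rabs (F al a) <= CF * R0 ^ mabs al * wmat sg x0 (mabs al).
  move=> ha; apply: Rle_trans (hF1' al a ha) _; apply: Rmult_le_compat_r; first exact: Rlt_le.
  by apply: Rmult_le_compat_l; [lra|].
have hF2 al p a b : (mabs al <= p)%N -> E a -> E b -> Rabs (taylor_rem F p a al b) <=
    CF * R0 ^ p.+1 * wmat sg x0 p.+1 * dist b a ^ (p.+1 - mabs al) / INR (factorial (p.+1 - mabs al)).
  move=> h ha hb; apply: Rle_trans (hF2' al p a b h ha hb) _.
  apply: Rmult_le_compat_r; first by left; apply: Rinv_0_lt_compat; exact: INR_fact_gt0.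
  apply: Rmult_le_compat_r; first by apply: pow_le; exact: sqrt_pos.
  apply: Rmult_le_compat_r; first exact: Rlt_le.
  by apply: Rmult_le_compat_l; [lra|].
have hB b i : E b -> Rabs (b i) <= B0.
  by move=> hb; have := coord_le_dist b (@origin n) i; rewrite /origin Rminus_0_r; have := hB0 b hb; rewrite /origin; lra.
pose C1 := 4 * C; have C10 : 0 < C1 by rewrite /C1; lra.
pose bb l := (/ 2) ^ l * dy om l.
have h2 := half_pow_gt0.
have bb0 l : 0 <= bb l by apply: Rmult_le_pos; [exact: Rlt_le|exact: dy_ge0].
have hdy m I : \big[Rplus/0]_(l < I) bb (m + l)%N <= (/ 2) ^ m * (C1 * (dy sg m + 1)).
  have h := dyadic_sum_of_integral hom hsg C0 hint (t := 2 ^ m) I ltac:(apply: pow_lt; lra).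
  apply: Rle_trans _ (Rmult_le_compat_l _ _ _ (Rlt_le _ _ (h2 m)) h); rewrite -rsumZ.
  by apply: Req_le; apply: eq_bigr => l _; rewrite /bb /dy !Rdef_pow_add (Rmult_comm (2 ^ m)); ring.
have [K [K1 [K2 [K3 K4]]]] := series_tail bb0 (hdy 0%N).
have hK m I : \big[Rplus/0]_(l < I) ((/ 2) ^ (m + l) * dy om (m + l)) <= K m by exact: K2.
have Ksig m : 2 ^ m * K m <= C1 * (dy sg m + 1).
  have := K3 m _ (hdy m) => h.
  have := Rmult_le_compat_l (2 ^ m) _ _ ltac:(apply: pow_le; lra) h.
  by rewrite -Rmult_assoc pow2_half Rmult_1_l.
have K0 m : 0 < K m.
  have [l0 hl0] := dy_unbounded hom 0; apply: Rlt_le_trans (hK m l0.+1); rewrite big_ord_recr /=.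
  apply: Rplus_le_lt_0_compat; first by apply: rsum_ge0 => l _; exact: bb0.
  by apply: Rmult_lt_0_compat => //; apply: hl0; lia.
have Kd m : K m.+1 <= K m by rewrite (K1 m); have := bb0 m; lra.
have K22 m : K m <= 2 * K m.+1.
  apply: K3 => I; apply: Rle_trans _ (Rmult_le_compat_l 2 _ _ ltac:(lra) (K2 m.+1 I)).
  rewrite -rsumZ; apply: rsum_le => l _; rewrite /bb addSn /=.
  have := dy_mono hom (leqnSn (m + l)); have := h2 (m + l)%N => p1 p2.
  by have := Rmult_le_compat_l _ _ _ (Rlt_le _ _ p1) p2; lra.
have omsg m : dy om m <= C1 * (dy sg m + 1).
  apply: Rle_trans _ (Ksig m); have := hK m 1%N; rewrite big_ord1 addn0 => h.
  have := Rmult_le_compat_l (2 ^ m) _ _ ltac:(apply: pow_le; lra) h.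
  by rewrite -Rmult_assoc pow2_half Rmult_1_l.
have [A' [z [Cp [A'0 [z0 [Cp0 hsmall]]]]]] := poly_small n hom hsg C10 x00 R1 omsg.
(* The 8 is 4 from [delta i = 4 * delta i.+1] times 2 from the upper bound in [levels]; [C1] comes
   from [2 ^ m * K m <= C1 * (dy sg m + 1)]. *)
pose A := A' / (8 * C1); have A0 : 0 < A by apply: Rdiv_lt_0_compat; lra.
(* Two cutoff factors then cost at most [exp ((dy sg m + 1) / (8 * x0))], about a quarter of the
   exponent gained in [exp (- (dy sg m / (2 * x0)))]; half of that exponent will pay for
   summability. *)
pose eta := / (16 * x0 * C1).
have xC : 0 < 16 * x0 * C1 by apply: Rmult_lt_0_compat; lra.
have eta0 : 0 < eta by exact: Rinv_0_lt_compat.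
have [rho [Cc [m0 [rho0 [Cc0 hpatch]]]]] := patch_exists hom A0 eta0 hK hB.
have [q [q1 [q2 [q3 q4]]]] := degree_sequence hsg x00.
have [mq hmq] := q4 1%N.
(* Starting beyond [mq] keeps the degrees [q (m i)] positive, so that [p i] below is a true
   predecessor. *)
have [delta [m [d0 [d4 [dlo [dhi [mlo mlt]]]]]]] := levels (maxn m0 mq) A0 K0 Kd K22 K4.
have mm0 i : (m0 <= m i)%N by have := mlo i; lia.
have q_gt0 i : (0 < q (m i))%N by apply: hmq; have := mlo i; lia.
have mi_ge i : (i <= m i)%N by elim: i => // i IH; exact: leq_ltn_trans IH (mlt i).
pose cst i := (Cc + 1) * exp (eta * dy om (m i)).
have cst1 i : 1 <= cst i.
  have : 1 <= exp (eta * dy om (m i)) by apply: exp_ge1; apply: Rmult_le_pos; [lra|exact: dy_ge0].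
  rewrite /cst => h; have : 0 <= Cc * exp (eta * dy om (m i)) by apply: Rmult_le_pos; lra.
  lra.
have cst_mono i : cst i <= cst i.+1.
  apply: Rmult_le_compat_l; first lra.
  apply: exp_le; apply: Rmult_le_compat_l; first lra.
  by apply: dy_mono => //; exact: ltnW.
have W0 k : 0 < wmat om rho k by exact: exp_pos.
have hpatch' i : exists P, is_patch E (delta i) (cst i) (wmat om rho) P.
  have [P [h1 [h3 [h4 h5]]]] := hpatch (m i) (delta i) (mm0 i) (d0 i) (dlo i).
  exists P; split => //; split => //; split => // a x; apply: Rle_trans (h5 a x) _.
  apply: Rmult_le_compat_r; first exact: Rlt_le.
  by apply: Rmult_le_compat_r; [left; exact: exp_pos|lra].
pose P i := proj1_sig (constructive_indefinite_description _ (hpatch' i)).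
have hP i : is_patch E (delta i) (cst i) (wmat om rho) (P i).
  by rewrite /P; case: constructive_indefinite_description.
pose p i := (q (m i)).-1.
have pS i : (p i).+1 = q (m i) by rewrite /p prednK.
have pmono i : (p i <= p i.+1)%N by have := q1 _ _ (ltnW (mlt i)); have := pS i; have := pS i.+1; lia.
pose Z := Rmax rho z.
have zZ : z <= Z by exact: Rmax_r.
have rZ : rho <= Z by exact: Rmax_l.
have Z0 : 0 < Z by lra.
pose WZ := wmat om Z; have WZ0 k : 0 < WZ k by exact: exp_pos.
have Wz0 k : 0 < wmat om z k by exact: exp_pos.
have WW j k : wmat om rho j * wmat om z k <= WZ (j + k)%N.
  apply: Rle_trans _ (wmat_mulM hom j k Z0).
  by apply: Rmult_le_compat; try exact: Rlt_le; exact: wmat_mono_x.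
have WW2 j k : wmat om rho j * (2 ^ k * WZ k) <= 2 ^ (j + k) * WZ (j + k)%N.
  have h : wmat om rho j * WZ k <= WZ (j + k)%N.
    apply: Rle_trans _ (wmat_mulM hom j k Z0).
    by apply: Rmult_le_compat_r; [exact: Rlt_le|exact: wmat_mono_x].
  have -> : wmat om rho j * (2 ^ k * WZ k) = 2 ^ k * (wmat om rho j * WZ k) by ring.
  apply: Rmult_le_compat => //; [by apply: pow_le; lra|by apply: Rmult_le_pos; exact: Rlt_le|].
  by apply: pow_mono; [lra|lia].
pose Bd j := CF * Cp * exp (- (dy sg (m j) / (2 * x0))).
have CC : 0 < CF * Cp by exact: Rmult_lt_0_compat.
have Bd0 j : 0 < Bd j by apply: Rmult_lt_0_compat => //; exact: exp_pos.
(* The scale [delta i] is admissible at all levels up to [m i.+1], not only up to [m i]; this is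
   what permits raising the degree before refining the cutoffs. *)
have scale i k : (k <= m i.+1)%N -> 2 ^ k * delta i <= A' * (dy sg k + 1).
  move=> hk; have Kk : K (m i.+1) <= K k.
    have h l : - K l <= - K l.+1 by have := Kd l; lra.
    by have := nat_nondecreasing h hk; lra.
  have hd : delta i <= 8 * A * K k.
    have := dhi i.+1; rewrite d4; have := Rmult_le_compat_l A _ _ (Rlt_le _ _ A0) Kk; lra.
  apply: Rle_trans (Rmult_le_compat_l (2 ^ k) _ _ ltac:(apply: pow_le; lra) hd) _.
  have -> : 2 ^ k * (8 * A * K k) = 8 * A * (2 ^ k * K k) by ring.
  apply: Rle_trans (Rmult_le_compat_l (8 * A) _ _ ltac:(lra) (Ksig k)) _.
  by apply: Req_le; rewrite /A; field; lra.
have good i : good_degree sg x0 (p i).+1 (m i) by rewrite pS.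
have goods i k : (p i < k)%N -> (k <= p i.+1)%N -> exists l, (m i <= l)%N /\ good_degree sg x0 k l /\
     2 ^ l * delta i <= A' * (dy sg l + 1).
  move=> h1 h3.
  have hq : (q (m i) <= k)%N by rewrite -pS.
  have hq' : (k <= q (m i.+1))%N by rewrite -pS; lia.
  have [l [hl1 [hl2 [hl3 hl4]]]] : exists l, (m i <= l)%N /\ (l < m i.+1)%N /\ (q l <= k)%N /\ (k <= q l.+1)%N.
    have hlt := mlt i; elim: (m i.+1) hlt hq' => // l IH hlt hq'.
    case: (leqP (q l) k) => h; first by exists l; split => //; lia.
    case: (ltngtP (m i) l) => hml; last 1 first.
    - by move: h; rewrite -hml; lia.
    - have [l' [a1 [a2 a3]]] := IH hml ltac:(lia); exists l'; split => //; split => //; lia.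
    - by lia.
  case: (q3 l k hl3 hl4) => hg.
    by exists l; split => //; split => //; apply: scale; lia.
  by exists l.+1; split; [lia|split => //; apply: scale].
(* The polynomials at the anchors are compared with the one at a single point of [E]; the distances
   8 and 6 add up to the 14 allowed between two base points. *)
have Qb j i b x a : E b -> (forall c, Rabs (x c - b c) <= 8 * delta j) ->
    2 ^ m i * delta j <= A' * (dy sg (m i) + 1) ->
    Rabs (blend (P j) (fun y ga => tpoly F (p i) y ga x - tpoly F (p i) b ga x) a x) <=
    2 ^ mabs a * (cst j * Bd i * WZ (mabs a)).
  move=> hb hx hs; apply: (blend_bound (hP j) (W2 := wmat om z)) => //.
  - exact: Rlt_le.
  - by move=> k; exact: Rlt_le.
  - move=> y hy hxy ga.
    have hyb c : Rabs (y c - b c) <= 14 * delta j by move: (hx c) (hxy c); split_Rabs; lra.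
    apply: Rle_trans (tpoly_diff_small R1 CF0 hsmall hF2 ga hy hb (good i) hs hxy hyb) _.
    apply: Rmult_le_compat_r; first exact: Rlt_le.
    apply: Rmult_le_compat_r; first by left; exact: exp_pos.
    rewrite -[X in _ <= X]Rmult_1_r; apply: Rmult_le_compat_l; first lra.
    by rewrite -(pow1 (p i).+1); apply: pow_incr; lra.
  - by have := cst1 j; lra.
pose T i x := fun b => (tpoly F i b)^~ x.
pose fam j i a x := blend (P j) (T (p i) x) a x.
have fam_chain j i : chain (fam j i) by apply: (blend_chain (hP j)) => b; exact: chain_tpoly.
(* [Dn] raises the degree under fixed cutoffs. [Jn] refines the cutoffs at fixed degree; the old sum
   is multiplied by the new mask, which confines the difference to the new supports. On [E] the mask
   is the jet of 1, so the series still telescopes there. *)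
pose Dn i a x := fam i i.+1 a x - fam i i a x.
pose Jn i a x := fam i.+1 i.+1 a x - fprod (mask (P i.+1)) (fam i i.+1) a x.
have Dn_bound i a x : Rabs (Dn i a x) <= 2 ^ mabs a * (cst i * Bd i * WZ (mabs a)).
  rewrite /Dn /fam -blend_sub; apply: (blend_bound (hP i) (W2 := wmat om z)) => //.
  - exact: Rlt_le.
  - by move=> k; exact: Rlt_le.
  - move=> y hy hxy ga.
    exact: (tpoly_steps_small R1 CF0 Cp0 hsmall hF1 hF2 ga hsg x00 hy (pmono i) (goods i) (Rlt_le _ _ (d0 i)) hxy).
  - by have := cst1 i; lra.
have Jn_bound i a x : Rabs (Jn i a x) <= 4 ^ mabs a * WZ (mabs a) * (2 * (cst i.+1 * cst i.+1 * Bd i.+1)).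
  have p4 : 4 ^ mabs a = 2 ^ mabs a * 2 ^ mabs a by rewrite -Rpow_mult_distr; congr (_ ^ _); ring.
  have p2 := pow2_ge1 (mabs a); have w0 := WZ0 (mabs a).
  have c1 := cst1 i.+1; have c2 := cst1 i; have c3 := cst_mono i; have b0 := Bd0 i.+1.
  (* Off the new supports both terms vanish. Otherwise the anchor [y] of a new cell is within
     [6 * delta i.+1 <= 2 * delta i] of [x], so the old mask is 1 at [x], and the polynomial at [y],
     multiplied by the new mask, can be subtracted from both terms. *)
  case: (classic (exists g b, @pcut n (P i.+1) g b x <> 0)) => [[g [b hg]]|hno]; last first.
    have h0 g b : @pcut n (P i.+1) g b x = 0.
      by apply: NNPP => h; apply: hno; exists g, b.
    rewrite /Jn /fam (blend_zero _ _ h0) /fprod.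
    have -> : (mask (P i.+1))^~ x = fun=> 0.
      by apply: functional_extensionality => b; apply: big1 => g _; exact: h0.
    rewrite leib0l Rminus_0_r Rabs_R0.
    apply: Rmult_le_pos; first by apply: Rmult_le_pos; [apply: pow_le|]; lra.
    by apply: Rmult_le_pos; [lra|apply: Rmult_le_pos; [apply: Rmult_le_pos|]; lra].
  have [hy hxy] := (proj1 (proj2 (hP i.+1))) g b x hg.
  set y := panchor g in hy hxy.
  have dd := d4 i; have di := d0 i.
  have hx8 c : Rabs (x c - y c) <= 8 * delta i.+1 by have := hxy c; have := d0 i.+1; lra.
  have hx8' c : Rabs (x c - y c) <= 8 * delta i by have := hxy c; lra.
  have hx2 c : Rabs (x c - y c) <= 2 * delta i by have := hxy c; lra.
  pose Q j ga := blend (P j) (fun b ga => tpoly F (p i.+1) b ga x - tpoly F (p i.+1) y ga x) ga x.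
  have e1 : Jn i a x = Q i.+1 a - leib (mlist a) ((mask (P i.+1))^~ x) (Q i).
    have eQ j ga : Q j ga = fam j i.+1 ga x - leib (mlist ga) ((mask (P j))^~ x) ((tpoly F (p i.+1) y)^~ x).
      by rewrite /Q blend_sub (blend_const (P j)).
    have -> : Q i = fun ga => fam i i.+1 ga x - tpoly F (p i.+1) y ga x.
      apply: functional_extensionality => ga.
      by rewrite eQ (mask_one (hP i) hy hx2) leib_one.
    by rewrite leib_subr eQ /Jn /fprod; ring.
  have s1 : 2 ^ m i.+1 * delta i.+1 <= A' * (dy sg (m i.+1) + 1).
    by apply: scale; exact: ltnW.
  have b1 := Qb i.+1 i.+1 y x a hy hx8 s1.
  have b2 : Rabs (leib (mlist a) ((mask (P i.+1))^~ x) (Q i)) <=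
      2 ^ mabs a * (cst i.+1 * (cst i * Bd i.+1) * (2 ^ mabs a * WZ (mabs a))).
    rewrite -(size_mlist a); apply: leib_bound => b' ga e; rewrite size_mlist in e *.
    have hm := mask_bound (hP i.+1) b' x.
    have hq := Qb i i.+1 y x ga hy hx8' (scale i _ (leqnn _)).
    apply: Rle_trans (Rmult_le_compat _ _ _ _ (Rabs_pos _) (Rabs_pos _) hm hq) _.
    have -> : cst i.+1 * wmat om rho (mabs b') * (2 ^ mabs ga * (cst i * Bd i.+1 * WZ (mabs ga))) =
      cst i.+1 * (cst i * Bd i.+1) * (wmat om rho (mabs b') * (2 ^ mabs ga * WZ (mabs ga))) by ring.
    apply: Rmult_le_compat_l; first by apply: Rmult_le_pos; [|apply: Rmult_le_pos]; lra.
    by rewrite -e; exact: WW2.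
  have u1 : cst i.+1 * Bd i.+1 * WZ (mabs a) <= 2 ^ mabs a * (cst i.+1 * cst i.+1 * Bd i.+1 * WZ (mabs a)).
    have t : 0 < cst i.+1 * Bd i.+1 * WZ (mabs a) by do 2 (apply: Rmult_lt_0_compat; last lra); lra.
    have t2 : 1 <= 2 ^ mabs a * cst i.+1 by rewrite -(Rmult_1_l 1); apply: Rmult_le_compat; lra.
    have := Rmult_le_compat_r _ _ _ (Rlt_le _ _ t) t2; lra.
  have u2 : cst i.+1 * (cst i * Bd i.+1) <= cst i.+1 * cst i.+1 * Bd i.+1.
    by rewrite -Rmult_assoc; apply: Rmult_le_compat_r; [lra|apply: Rmult_le_compat_l; lra].
  have p20 : 0 <= 2 ^ mabs a by lra.
  have v1 := Rmult_le_compat_l _ _ _ p20 u1.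
  have v2 : 2 ^ mabs a * (cst i.+1 * (cst i * Bd i.+1) * (2 ^ mabs a * WZ (mabs a))) <=
     2 ^ mabs a * (cst i.+1 * cst i.+1 * Bd i.+1 * (2 ^ mabs a * WZ (mabs a))).
    apply: Rmult_le_compat_l => //; apply: Rmult_le_compat_r => //.
    by apply: Rmult_le_pos; lra.
  have b3 : Rabs (Jn i a x) <= Rabs (Q i.+1 a) + Rabs (leib (mlist a) ((mask (P i.+1))^~ x) (Q i)).
    by rewrite e1; apply: Rle_trans (Rabs_triang _ _) _; rewrite Rabs_Ropp; lra.
  rewrite p4; apply: Rle_trans b3 _; apply: Rle_trans (Rplus_le_compat _ _ _ _ b1 b2) _.
  apply: Rle_trans (Rplus_le_compat _ _ _ _ v1 v2) _; apply: Req_le; ring.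
(* Half of the exponent gained is set against [ln (2 ^ m i)]. This yields [(/ 2) ^ m i] and, since
   [i <= m i], a geometric bound in [i]. *)
have [K1' [K1'0 hcost]] : exists K', 0 < K' /\ forall i, cst i * cst i * Bd i <= K' * (/ 2) ^ i.
  have i4 : 0 < / (4 * x0) by apply: Rinv_0_lt_compat; lra.
  have [C2 [C20 hC2]] := om_ln_le hsg i4.
  exists ((Cc + 1) * (Cc + 1) * (CF * Cp) * exp (/ (8 * x0) + C2)); split.
    apply: Rmult_lt_0_compat; last exact: exp_pos.
    by apply: Rmult_lt_0_compat => //; apply: Rmult_lt_0_compat; lra.
  move=> i; have -> : cst i * cst i * Bd i = (Cc + 1) * (Cc + 1) * (CF * Cp) *
     exp (eta * dy om (m i) + eta * dy om (m i) - dy sg (m i) / (2 * x0)).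
    by rewrite /Rminus !exp_plus /cst /Bd; ring.
  rewrite Rmult_assoc; rewrite Rmult_assoc (Rmult_assoc _ (exp (/ (8 * x0) + C2))).
  rewrite -!Rmult_assoc (Rmult_assoc ((Cc + 1) * (Cc + 1) * CF * Cp)).
  apply: Rmult_le_compat_l.
    by apply: Rmult_le_pos; [apply: Rmult_le_pos; [apply: Rmult_le_pos|]|]; lra.
  apply: (Rle_trans _ (exp (/ (8 * x0) + C2) * (/ 2) ^ m i)); last first.
    apply: Rmult_le_compat_l; first by left; exact: exp_pos.
    have -> : m i = (i + (m i - i))%N by rewrite subnKC.
    rewrite Rdef_pow_add -[X in _ <= X]Rmult_1_r; apply: Rmult_le_compat_l; first exact: Rlt_le.
    by rewrite -(pow1 (m i - i)); apply: pow_incr; lra.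
  have hl := hC2 (2 ^ m i) (pow2_ge1 _).
  have -> : (/ 2) ^ m i = exp (- ln (2 ^ m i)).
    by rewrite exp_Ropp exp_ln ?pow_inv //; apply: pow_lt; lra.
  rewrite -exp_plus; apply: exp_le.
  have ho := omsg (m i).
  have : eta * dy om (m i) <= / (16 * x0) * (dy sg (m i) + 1).
    apply: Rle_trans (Rmult_le_compat_l _ _ _ (Rlt_le _ _ eta0) ho) _.
    by apply: Req_le; rewrite /eta; field; lra.
  have -> : / (16 * x0) * (dy sg (m i) + 1) = / 4 * (/ (4 * x0) * dy sg (m i)) + / 2 * / (8 * x0) by field; lra.
  have -> : dy sg (m i) / (2 * x0) = 2 * (/ (4 * x0) * dy sg (m i)) by field; lra.
  move: hl; rewrite -/(dy sg (m i)); set s := / (4 * x0) * dy sg (m i).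
  have s0 : 0 <= s by apply: Rmult_le_pos; [lra|exact: dy_ge0].
  lra.
(* The first term has a fixed degree and a fixed scale, so polynomial growth with [lam = 1] is
   enough. *)
have [Bst [Bst0 hstart]] : exists B, 0 < B /\ forall a x, Rabs (fam 0%N 0%N a x) <= B * (4 ^ mabs a * WZ (mabs a)).
  pose B := \big[Rplus/0]_(j < (p 0%N).+1) (CF * R0 ^ j * wmat sg x0 j).
  have t0 j : 0 <= CF * R0 ^ j * wmat sg x0 j.
    by apply: Rmult_le_pos; [apply: Rmult_le_pos; [lra|apply: pow_le; lra]|exact: Rlt_le].
  have B0' : 0 <= B by apply: rsum_ge0.
  have hc := fun k => wmat_ge_const k hom z0.
  set ez := exp (om 1 / z) in hc; have ez0 : 0 < ez by exact: exp_pos.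
  have Ed := exp_pos (INR n * (6 * delta 0%N)).
  pose B' := B * exp (INR n * (6 * delta 0%N)) * ez.
  have B'0 : 0 <= B' by apply: Rmult_le_pos; [apply: Rmult_le_pos|]; lra.
  exists (cst 0%N * B' + 1); split.
    by have := Rmult_le_pos _ _ (Rle_trans _ _ _ Rle_0_1 (cst1 0%N)) B'0; lra.
  move=> a x.
  have h : Rabs (fam 0%N 0%N a x) <= 2 ^ mabs a * (cst 0%N * B' * WZ (mabs a)).
    apply: (blend_bound (hP 0%N) (W2 := wmat om z)) => //.
    - by move=> k; exact: Rlt_le.
    - move=> y hy hxy ga; rewrite /T.
      have := @poly_growth n (tpoly F (p 0%N) y) (p 0%N) B 1 y (chain_tpoly _ _ _) B0' Rle_0_1
         (fun al x h => tpoly_high _ _ _ h) _ ga x.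
      rewrite pow1 Rmult_1_r Rmult_1_l => h; apply: Rle_trans (h _) _.
        move=> al; rewrite pow1 Rmult_1_r; case: (leqP (mabs al) (p 0%N)) => hal; last first.
          by rewrite tpoly_high // Rabs_R0.
        rewrite tpoly_diag //; apply: Rle_trans (hF1 al y hy) _.
        rewrite /B (bigD1 (Ordinal (hal : (mabs al < (p 0%N).+1)%N))) //= -[X in X <= _]Rplus_0_r.
        by apply: Rplus_le_compat_l; apply: rsum_ge0.
      rewrite /B' Rmult_assoc; apply: (Rle_trans _ (B * exp (INR n * (6 * delta 0%N)) * 1)).
        rewrite Rmult_1_r; apply: Rmult_le_compat_l => //.
        by apply: exp_le; exact: sum_coord_le.
      by apply: Rmult_le_compat_l; [apply: Rmult_le_pos; lra|exact: hc].
    - by have := cst1 0%N; lra.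
  apply: Rle_trans h _; have w0 := WZ0 (mabs a).
  have h24 : 2 ^ mabs a <= 4 ^ mabs a by apply: pow_incr; lra.
  have p2 := pow2_ge1 (mabs a).
  have cb : 0 <= cst 0%N * B' by apply: Rmult_le_pos; [have := cst1 0%N; lra|].
  apply: (Rle_trans _ (4 ^ mabs a * (cst 0%N * B' * WZ (mabs a)))).
    by apply: Rmult_le_compat_r => //; apply: Rmult_le_pos; lra.
  have : 0 <= 4 ^ mabs a * WZ (mabs a) by apply: Rmult_le_pos; lra.
  lra.
pose Gs i := if i is i'.+1 then fun a x => Dn i' a x + Jn i' a x else fam 0%N 0%N.
pose V k := 4 ^ k * WZ k.
have V0 k : 0 < V k by apply: Rmult_lt_0_compat; [apply: pow_lt; lra|].
have absorb i k : 2 ^ k * (cst i * Bd i * WZ k) <= V k * (K1' * (/ 2) ^ i).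
  have c1 := cst1 i; have b0 := Bd0 i; have w0 := WZ0 k; have hi := h2 i; have p2 := pow2_ge1 k.
  have hc : cst i * Bd i <= K1' * (/ 2) ^ i.
    apply: Rle_trans _ (hcost i); apply: Rmult_le_compat_r; first lra.
    by rewrite -[X in X <= _]Rmult_1_r; apply: Rmult_le_compat_l; lra.
  apply: (Rle_trans _ (2 ^ k * (K1' * (/ 2) ^ i * WZ k))).
    by apply: Rmult_le_compat_l; [lra|apply: Rmult_le_compat_r; lra].
  have -> : V k * (K1' * (/ 2) ^ i) = 4 ^ k * (K1' * (/ 2) ^ i * WZ k) by rewrite /V; ring.
  apply: Rmult_le_compat_r; last by apply: pow_incr; lra.
  by apply: Rmult_le_pos; [apply: Rmult_le_pos|]; lra.
pose M k := (Bst + 6 * K1') * V k.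
have Gs_chain i : chain (Gs i).
  case: i => [|i] /=; first exact: fam_chain.
  apply: chain_add; apply: chain_sub => //.
  by apply: chain_fprod; [exact: (mask_chain (hP i.+1))|exact: fam_chain].
have Gs_bound i a x : Rabs (Gs i a x) <= M (mabs a) * (/ 2) ^ i.
  have v0 := V0 (mabs a).
  case: i => [|i].
    rewrite /= Rmult_1_r; apply: Rle_trans (hstart a x) _; rewrite -/(V _) /M.
    by apply: Rmult_le_compat_r; lra.
  have kv : 0 < K1' * V (mabs a) by exact: Rmult_lt_0_compat.
  have hi := h2 i.
  have r1 : Rabs (Dn i a x) <= V (mabs a) * (K1' * (/ 2) ^ i).
    exact: (Rle_trans _ _ _ (Dn_bound i a x) (absorb i _)).
  have r2 : Rabs (Jn i a x) <= V (mabs a) * (2 * (K1' * (/ 2) ^ i.+1)).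
    apply: Rle_trans (Jn_bound i a x) _; rewrite -/(V _); apply: Rmult_le_compat_l; first lra.
    by apply: Rmult_le_compat_l; [lra|exact: hcost].
  rewrite /= in r2 *; apply: Rle_trans (Rabs_triang _ _) _.
  have kvi : 0 < K1' * V (mabs a) * (/ 2) ^ i by exact: Rmult_lt_0_compat.
  have bvi : 0 < Bst * V (mabs a) * (/ 2) ^ i by apply: Rmult_lt_0_compat => //; exact: Rmult_lt_0_compat.
  by rewrite /M; lra.
have [D [D1 [D2 D3]]] := chain_series Gs_chain Gs_bound.
exists (D (@mzero n)), D; split; [|split].
- split => //; split => //.
  exact: (chain_continuous (M := fun k => 2 * M k)).
(* The factor [4 ^ k], left by two applications of the product rule, is absorbed by a larger
   parameter of the weight matrix. *)
- have [y [C4 [y0 [_ [C40 hy]]]]] := wmat_geom hom (A := 4) ltac:(lra) Z0.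
  have [r hr] := archimed_nat (y + 1).
  have r0 : (1 <= r)%N by case: r hr => // /=; lra.
  exists r; split => //; exists (2 * ((Bst + 6 * K1') * C4)) => x a.
  have w0 : 0 < wmat om (INR r) (mabs a) by exact: exp_pos.
  have e : exp (- / INR r * young_conj om (INR r * INR (mabs a))) * wmat om (INR r) (mabs a) = 1.
    by rewrite /wmat -exp_plus -exp_0; congr exp; ring.
  apply: (Rmult_le_reg_r (wmat om (INR r) (mabs a))) => //.
  rewrite Rmult_assoc e Rmult_1_r; apply: Rle_trans (D2 a x) _.
  rewrite /M /V; have := hy (mabs a); rewrite -/(WZ _) => h.
  have h' : C4 * wmat om y (mabs a) <= C4 * wmat om (INR r) (mabs a).
    by apply: Rmult_le_compat_l; [lra|apply: wmat_mono_x => //; lra].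
  have := Rmult_le_compat_l (Bst + 6 * K1') _ _ ltac:(lra) (Rle_trans _ _ _ h h'); lra.
- move=> al x hx.
  have tele N : \big[Rplus/0]_(i < N.+1) Gs i al x = fam N N al x.
    elim: N => [|N IH]; first by rewrite big_ord1.
    rewrite big_ord_recr /= IH /Dn /Jn.
    have -> : fprod (mask (P N.+1)) (fam N N.+1) al x = fam N N.+1 al x.
      rewrite /fprod (mask_one (hP N.+1) hx) ?leib_one // => c.
      by rewrite Rminus_diag Rabs_R0; have := d0 N.+1; lra.
    ring.
  (* With [b = x] in [Qb] the comparison polynomial has the derivative [F al x] at [x] once the
     degree reaches [mabs al]. *)
  have close N : (mabs al <= p N)%N ->
      Rabs (D al x - F al x) <= (2 * M (mabs al) + V (mabs al) * K1') * (/ 2) ^ N.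
    move=> hN; have h1 := D3 N.+1 al x; rewrite tele in h1.
    have b1 := Qb N N x x al hx (fun c => _) _.
    have {}b1 := b1 ltac:(by move=> c; rewrite Rminus_diag Rabs_R0; have := d0 N; lra)
       (scale N _ (ltnW (mlt N))).
    rewrite blend_sub (blend_const (P N)) (mask_one (hP N) hx) ?leib_one ?tpoly_diag // in b1; last first.
      by move=> c; rewrite Rminus_diag Rabs_R0; have := d0 N; lra.
    have m0' : 0 <= M (mabs al) * (/ 2) ^ N.
      by apply: Rle_trans (Gs_bound N al x); exact: Rabs_pos.
    have h3 : Rabs (fam N N al x - F al x) <= V (mabs al) * (K1' * (/ 2) ^ N).
      exact: (Rle_trans _ _ _ b1 (absorb N _)).
    rewrite /= in h1.
    have : Rabs (D al x - F al x) <= Rabs (D al x - fam N N al x) + Rabs (fam N N al x - F al x).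
      have -> : D al x - F al x = (D al x - fam N N al x) + (fam N N al x - F al x) by ring.
      exact: Rabs_triang.
    lra.
  have p_large : exists N0, forall N, (N0 <= N)%N -> (mabs al <= p N)%N.
    have [l0 hl0] := q4 (mabs al).+1; exists l0 => N hN.
    by have := hl0 (m N) (leq_trans hN (mi_ge N)); rewrite -pS.
  have [N0 hN0] := p_large.
  apply: cond_eq => eps e0.
  have cc : 0 <= 2 * M (mabs al) + V (mabs al) * K1'.
    have : 0 < V (mabs al) * K1' by exact: Rmult_lt_0_compat.
    have : 0 < M (mabs al) by apply: Rmult_lt_0_compat => //; lra.
    lra.
  have [N hN] := half_pow_lt cc e0.
  by apply: Rle_lt_trans (close (N0 + N)%N _) (hN _ _); [apply: hN0|]; lia.
Qed.

Theorem theorem1p3 (n : nat) (om sg : R -> R) :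
  (1 <= n)%N ->
  is_weight_function om -> non_quasianalytic om -> concave_on_nonneg om ->
  is_weight_function sg -> little_o_t sg ->
  (forall x, 0 < x -> exists y, 0 < y /\ exists C, 1 <= C /\
     forall j k : nat, (1 <= j)%N -> (j <= k)%N ->
       wmat sg x j / (INR j * wmat sg x (j.-1))
         <= C * (wmat sg y k / (INR k * wmat sg y (k.-1)))) ->
  ((forall E : pt n -> Prop, compact_Rn E -> jet_surjective om sg E)
   <->
   (exists C, 0 < C /\ forall t, 0 < t ->
      improper_int_1_le (fun u => om (t * u) / (u ^ 2)) (C * sg t + C))).
Proof.
move=> n1 hom _ _ hsg _ _; split; first exact: extension_necessity.
by case=> C [C0 hC]; exact: (extension_sufficiency n1 hom hsg C0 hC).
Qed.
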